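(* Let $n\ge3$, $1\le j\le n-1$, and let $P$ and $Q$ be origin-symmetric convex bodies with non-empty interior in $\mathbb{R}^n$ such that $P$ is the $j$-projection body of $Q$. Then $$S_j(P,\mathbb{S}^{n-1}\cap E)=\frac{\kappa_{n-j}}{\kappa_j}\,S_{n-j}(Q,\mathbb{S}^{n-1}\cap E^\perp)\qquad\text{for every } E\in\mathrm{Gr}_{n-j,n}.$$ Moreover, if $P$ is a polytope, then $Q$ is a polytope, and for every $F\in\mathrm{Gr}_{j,n}$, $P$ has a $j$-dimensional face whose affine hull is parallel to $F$ if and only if $Q$ has an $(n-j)$-dimensional face whose affine hull is parallel to $F^\perp$.
   Context: $K$ is called the $j$-projection body of $L$ if $\mathrm{vol}_j(K|E^\perp)=\mathrm{vol}_{n-j}(L|E)$ for every $E\in\mathrm{Gr}_{n-j,n}$, the Grassmannian of $(n-j)$-dimensional linear subspaces ($K|E$ orthogonal projection). $\kappa_m$ is the volume of the $m$-dimensional unit ball. $S_i(K,\cdot)$ is the area measure of order $i$, defined by $S_{n-1}(K+rB,\cdot)=\sum_{i=0}^{n-1}r^{n-1-i}\binom{n-1}{i}S_i(K,\cdot)$ for $r\ge0$, with $S_{n-1}$ the surface area measure and $B$ the unit ball. *)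

(* Defs.v *)
From HB Require Import structures.
From mathcomp Require Import all_boot all_order all_algebra.
From mathcomp Require Import all_classical all_reals all_analysis.
Set Implicit Arguments. Unset Strict Implicit. Unset Printing Implicit Defensive.
Import Order.TTheory GRing.Theory Num.Theory.
Import numFieldNormedType.Exports.
Local Open Scope classical_set_scope.
Local Open Scope ring_scope.

Section Convex.
Variable R : realType.

Definition dotv (n : nat) (x y : 'rV[R]_n) : R := (x *m y^T) 0 0.
Definition enorm (n : nat) (x : 'rV[R]_n) : R := Num.sqrt (dotv x x).

(** n-dimensional Lebesgue integral of a nonnegative function on 'rV_n,
    as iterated one-dimensional Lebesgue integrals (Tonelli). *)
Fixpoint ninteg (n : nat) : ('rV[R]_n -> \bar R) -> \bar R :=
  match n with
  | 0 => fun f => f 0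
  | m.+1 => fun f =>
      (\int[@lebesgue_measure R]_(x in [set: R])
          ninteg (fun v : 'rV[R]_m => f (row_mx (\row_(_ < 1) x) v)))%E
  end.

Definition voln (n : nat) (A : set 'rV[R]_n) : \bar R :=
  ninteg (fun x => (\1_A x)%:E).

Definition kappa (m : nat) : R := fine (voln [set x : 'rV[R]_m | enorm x <= 1]).

Definition convex_set (n : nat) (K : set 'rV[R]_n) : Prop :=
  forall x y t, K x -> K y -> 0 <= t <= 1 -> K (t *: x + (1 - t) *: y).

Definition convex_body (n : nat) (K : set 'rV[R]_n) : Prop :=
  compact K /\ convex_set K /\ K !=set0.

Definition origin_symmetric (n : nat) (K : set 'rV[R]_n) : Prop :=
  forall x, K x -> K (- x).

Definition polytope (n : nat) (K : set 'rV[R]_n) : Prop :=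
  exists (k : nat) (p : 'I_k -> 'rV[R]_n),
    K = [set x | exists l : 'I_k -> R, (forall i, 0 <= l i) /\
                  \sum_(i < k) l i = 1 /\ x = \sum_(i < k) l i *: p i].

(** Linear subspaces of R^n are represented by square matrices (row spaces).
    E^perp := row space of kermx E^T = {u | u *m E^T = 0}. *)
Definition perp (n : nat) (E : 'M[R]_n) : 'M[R]_n := kermx E^T.

Definition subsp (n : nat) (E : 'M[R]_n) : set 'rV[R]_n := [set x | (x <= E)%MS].

Definition proj (n : nat) (K : set 'rV[R]_n) (E : 'M[R]_n) : set 'rV[R]_n :=
  [set y | (y <= E)%MS /\ exists x, K x /\ (x - y) *m E^T = 0].

Definition orthonormal (k n : nat) (U : 'M[R]_(k, n)) : Prop := U *m U^T = 1%:M.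

(** k-dimensional volume of a set A contained in a k-dimensional subspace F,
    computed in the orthonormal coordinates given by U (row space of U = F).
    The value does not depend on the choice of U. *)
Definition volk (k n : nat) (U : 'M[R]_(k, n)) (A : set 'rV[R]_n) : \bar R :=
  voln [set z : 'rV[R]_k | A (z *m U)].

Definition jprojection_body (n j : nat) (K L : set 'rV[R]_n) : Prop :=
  forall E : 'M[R]_n, \rank E = (n - j)%N ->
  forall (U : 'M[R]_(j, n)) (W : 'M[R]_(n - j, n)),
    orthonormal U -> (U == perp E)%MS ->
    orthonormal W -> (W == E)%MS ->
    volk U (proj K (perp E)) = volk W (proj L E).

Definition sphere (n : nat) : set 'rV[R]_n := [set u | enorm u = 1].

Definition parallel_body (n : nat) (K : set 'rV[R]_n) (r : R) : set 'rV[R]_n :=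
  [set z | exists x b, K x /\ enorm b <= 1 /\ z = x + r *: b].

Definition local_parallel (n : nat) (K : set 'rV[R]_n) (e : R) (w : set 'rV[R]_n)
  : set 'rV[R]_n :=
  [set x | exists p, K p /\ (forall y, K y -> enorm (x - p) <= enorm (x - y)) /\
     0 < enorm (x - p) <= e /\ w ((enorm (x - p))^-1 *: (x - p))].

(** surface area measure S_{n-1}(K, w) = s (as the derivative at 0 of
    the volume of local parallel sets). *)
Definition surface_area_is (n : nat) (K : set 'rV[R]_n) (w : set 'rV[R]_n) (s : R)
  : Prop :=
  (fun e => fine (voln (local_parallel K e w)) / e) @ (0:R)^'+ --> s.

(** c i = S_i(K, w), i = 0..n-1, defined by
    S_{n-1}(K + rB, w) = sum_{i=0}^{n-1} r^{n-1-i} C(n-1,i) S_i(K,w), r >= 0. *)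
Definition area_measures_at (n : nat) (K : set 'rV[R]_n) (w : set 'rV[R]_n)
  (c : nat -> R) : Prop :=
  forall r : R, 0 <= r ->
    surface_area_is (parallel_body K r) w
      (\sum_(i < n) r ^+ (n.-1 - i) * ('C(n.-1, i))%:R * c i).

(** G has a k-dimensional face whose affine hull is parallel to F
    (faces of polytopes are exposed: G = {x in K | <x,u> = h_K(u)}) *)
Definition has_face_parallel (n : nat) (K : set 'rV[R]_n) (k : nat) (F : 'M[R]_n)
  : Prop :=
  exists u : 'rV[R]_n,
    let G := [set x | K x /\ forall y, K y -> dotv y u <= dotv x u] in
    (forall x y, G x -> G y -> (x - y <= F)%MS) /\
    exists M : 'M[R]_(k, n), (M == F)%MS /\
      forall i, exists x y, G x /\ G y /\ row i M = x - y.

End Convex.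

(* Main.v *)
Require Import Defs.
From HB Require Import structures.
From mathcomp Require Import all_boot all_order all_algebra.
From mathcomp Require Import all_classical all_reals all_analysis.
From mathcomp Require Import measurable_realfun ring lra zify.
Import Order.TTheory GRing.Theory Num.Theory.
Import numFieldNormedType.Exports.
(* Imported again so that [convex_set] is the one of Defs. *)
Require Import Defs.
Set Implicit Arguments. Unset Strict Implicit. Unset Printing Implicit Defensive.
Local Open Scope classical_set_scope.
Local Open Scope ring_scope.

(** For an orthonormal frame (W, U) of R^n with rows W (m of them) and U (j of
    them), n = m + j, let psi_P(u) be the volume of the projection along W of the
    face of P with normal u W, and psi_Q(v) that of the face of Q with normal v U.
    Rotating the frame in the plane of u and v and comparing the jumps at the angle 0
    of the derivatives of both sides of the projection identity gives an equality
    between the volumes of the sets of points extremal along lines; for almost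
    every direction of the lines these sets are the projected faces.  Hence
    psi_Q(v) <= psi_P(u) for every u and almost every v, and symmetrically, so both
    functions are almost everywhere equal to the same constant c.

    - Area measures.  The points x = a + u W with |u| <= r and a in the face of P
      with normal u W form a tube whose volume is continuous in r with right
      derivative S_{n-1}(P + r B, E), hence polynomial; it grows like c kappa_m r^m,
      which identifies S_j(P, E) as a multiple of c kappa_m.
    - Polytopes.  If P is a polytope, a rotation that crosses none of finitely many
      critical lines leaves the optimal basic solutions of the linear programs
      defining the projections unchanged, so the second difference vanishes
      exactly.  For Q this is impossible in the direction of a normal at a point
      touched by an inner ball.  So Q has finitely many such normals, and these
      suffice to describe it.
    - Faces.  A j-face of P parallel to F makes psi_P positive on an open set, so
      c > 0, and a generic direction v then yields an (n-j)-face of Q. *)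

(** * Lebesgue measure on row vectors *)

(** The projection identity enters only through rotations in one plane. The volume of a projection
    is an integral of widths of fibers, and the one-sided derivatives of a width are given by faces
    of the fiber. So the jump sees extremality only within fibers, that is, along lines, and the set
    obtained may be larger than the projected face. The obstacle is this excess. For fixed [u], the
    pairs (point, direction) in the excess form a null set of the product space, which yields
    equality for almost every direction only; on the other body mere inclusion is available, so each
    comparison is an inequality. For the area measures, [area_measures_at] gives nothing but right
    derivatives of tube volumes. Left continuity, obtained from a ball inside the body, is the
    missing ingredient that makes the tube volume a polynomial. For polytopes the limit of second
    differences is too weak: it is their exact vanishing for some positive angle that contradicts
    the curvature of an inner ball. The critical lines come from direction spaces of affine hulls of
    projected vertices; recording which of these spaces contain a normal leaves finitely many
    possibilities. *)

Definition mx_display : Type -> measure_display. Proof. exact. Qed.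

Section MatrixMeasurable.
Variable R : realType.

(** Generating by coordinates makes measurability of a matrix-valued map a coordinatewise question;
    [open_measurable_mx] recovers the Borel sets. *)
Definition mx_cylinder m n : set (set 'M[R]_(m, n)) :=
  [set A | exists i j (B : set R), measurable B /\ A = (fun M : 'M[R]_(m, n) => M i j) @^-1` B].

Definition mx_measurable m n : set (set 'M[R]_(m, n)) := <<s @mx_cylinder m n >>.

Lemma mx_measurable0 m n : @mx_measurable m n set0.
Proof. exact: sigma_algebra0. Qed.

Lemma mx_measurableC m n A : @mx_measurable m n A -> mx_measurable (~` A).
Proof. by move=> mA; rewrite -setTD; exact: sigma_algebraCD. Qed.

Lemma mx_measurable_bigcup m n (F : (set 'M[R]_(m, n))^nat) :
  (forall i, mx_measurable (F i)) -> mx_measurable (\bigcup_i F i).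
Proof. exact: sigma_algebra_bigcup. Qed.

HB.instance Definition _ m n := @isMeasurable.Build (mx_display R) 'M[R]_(m, n)
  (@mx_measurable m n) (@mx_measurable0 m n) (@mx_measurableC m n)
  (@mx_measurable_bigcup m n).

Lemma measurable_coord m n i j D :
  measurable_fun D (fun M : 'M[R]_(m, n) => M i j).
Proof.
move=> mD Y mY; apply: measurableI => //.
by apply: sub_gen_smallest; exists i, j, Y.
Qed.

Lemma measurable_fun_mx d (T : measurableType d) m n (D : set T)
    (f : T -> 'M[R]_(m, n)) :
  (forall i j, measurable_fun D (fun x => f x i j)) -> measurable_fun D f.
Proof.
move=> mf mD; apply: (@measurability _ _ _ _ _ _ (@mx_cylinder m n)) => //.
by move=> _ [_ [i [j [B [mB ->]]]] <-]; exact: mf.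
Qed.

Lemma measurable_row_mx d (T : measurableType d) m n (D : set T)
    (f : T -> 'rV[R]_m) (g : T -> 'rV[R]_n) :
  measurable_fun D f -> measurable_fun D g ->
  measurable_fun D (fun x => row_mx (f x) (g x)).
Proof.
move=> mf mg; apply: measurable_fun_mx => i j.
rewrite (_ : (fun x => _) = fun x => match fintype.split j with
  | inl k => f x i k | inr k => g x i k end); last first.
  by apply/funext => x; rewrite mxE.
case: (fintype.split j) => k.
  by apply: (measurableT_comp (@measurable_coord _ _ i k setT)).
by apply: (measurableT_comp (@measurable_coord _ _ i k setT)).
Qed.

Lemma measurable_const_row d (T : measurableType d) (D : set T) (f : T -> R) :
  measurable_fun D f -> measurable_fun D (fun x => \row_(_ < 1) f x).
Proof.
move=> mf; apply: measurable_fun_mx => i j.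
by rewrite (_ : (fun x => _) = f)//; apply/funext => x; rewrite mxE.
Qed.

Lemma measurable_mulmx d (T : measurableType d) m n p (D : set T)
    (f : T -> 'M[R]_(m, n)) (M : 'M[R]_(n, p)) :
  measurable_fun D f -> measurable_fun D (fun x => f x *m M).
Proof.
move=> mf; apply: measurable_fun_mx => i j.
rewrite (_ : (fun x => _) = fun x => \sum_k f x i k * M k j); last first.
  by apply/funext => x; rewrite mxE.
apply: measurable_sum => k; apply: measurable_funM => //.
exact: (measurableT_comp (@measurable_coord _ _ i k setT)).
Qed.

Lemma measurable_addmx d (T : measurableType d) m n (D : set T)
    (f g : T -> 'M[R]_(m, n)) :
  measurable_fun D f -> measurable_fun D g ->
  measurable_fun D (fun x => f x + g x).
Proof.
move=> mf mg; apply: measurable_fun_mx => i j.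
rewrite (_ : (fun x => _) = fun x => f x i j + g x i j); last first.
  by apply/funext => x; rewrite mxE.
by apply: measurable_funD;
  exact: (measurableT_comp (@measurable_coord _ _ i j setT)).
Qed.

Lemma measurable_scalemx d (T : measurableType d) m n (D : set T)
    (a : T -> R) (f : T -> 'M[R]_(m, n)) :
  measurable_fun D a -> measurable_fun D f ->
  measurable_fun D (fun x => a x *: f x).
Proof.
move=> ma mf; apply: measurable_fun_mx => i j.
rewrite (_ : (fun x => _) = fun x => a x * f x i j); last first.
  by apply/funext => x; rewrite mxE.
apply: measurable_funM => //.
exact: (measurableT_comp (@measurable_coord _ _ i j setT)).
Qed.

Lemma measurable_lsubmx d (T : measurableType d) m n (D : set T)
    (f : T -> 'rV[R]_(m + n)) :
  measurable_fun D f -> measurable_fun D (fun x => lsubmx (f x)).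
Proof.
move=> mf; apply: measurable_fun_mx => i j.
rewrite (_ : (fun x => _) = fun x => f x i (lshift n j)); last first.
  by apply/funext => x; rewrite mxE.
exact: (measurableT_comp (@measurable_coord _ _ i _ setT)).
Qed.

Lemma measurable_rsubmx d (T : measurableType d) m n (D : set T)
    (f : T -> 'rV[R]_(m + n)) :
  measurable_fun D f -> measurable_fun D (fun x => rsubmx (f x)).
Proof.
move=> mf; apply: measurable_fun_mx => i j.
rewrite (_ : (fun x => _) = fun x => f x i (rshift m j)); last first.
  by apply/funext => x; rewrite mxE.
exact: (measurableT_comp (@measurable_coord _ _ i _ setT)).
Qed.

End MatrixMeasurable.

(** * Borel sets of matrices, and iterated integrals as integrals against one measure *)

Section Borel.
Variable R : realType.
Local Notation leb := (@lebesgue_measure R).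

Lemma mx_ballP m n (x : 'M[R]_(m, n)) e y :
  ball x e y <-> 0 < e /\ forall i j, `|x i j - y i j| < e.
Proof. by []. Qed.

Lemma measurable_mx_ball m n (x : 'M[R]_(m, n)) e : measurable (ball x e).
Proof.
have [e0|e0] := leP e 0.
  rewrite (_ : ball x e = set0)//; apply/seteqP; split => // y [+ _].
  by rewrite ltNge e0.
rewrite (_ : ball x e =
  \bigcap_(i in [set: 'I_m]) \bigcap_(j in [set: 'I_n])
    ((fun M => M i j) @^-1` ball (x i j) e)).
  apply: fin_bigcap_measurable => // i _; apply: fin_bigcap_measurable => // j _.
  rewrite -[X in measurable X]setTI; apply: measurable_coord => //.
  exact: measurable_ball.
apply/seteqP; split=> [y [_ xy] i _ j _|y xy]; first exact: xy.
by split => // i j; exact: xy.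
Qed.

(** Balls with rational centre and radius [1/(k+1)] form a countable base, enumerated by [pickle];
    those not inside [A] are replaced by [set0]. *)
Lemma open_measurable_mx m n (A : set 'M[R]_(m, n)) : open A -> measurable A.
Proof.
move=> oA.
pose C (p : 'M[rat]_(m, n) * nat) : set 'M[R]_(m, n) :=
  let B := ball (map_mx ratr p.1 : 'M[R]_(m, n)) (p.2.+1%:R^-1) in
  if `[< B `<=` A >] then B else set0.
have mC p : measurable (C p).
  by rewrite /C; case: ifP => // _; exact: measurable_mx_ball.
rewrite (_ : A = \bigcup_i oapp C set0 (unpickle i)); last first.
  apply/seteqP; split=> [y Ay|y [i _]]; last first.
    case: (unpickle i) => //= p; rewrite /C.
    by case: ifPn => // /asboolP BA; exact: BA.
  have /nbhs_ballP[e /= e0 yeA] : nbhs y A by exact: open_nbhs_nbhs.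
  have [k ke] : exists k : nat, k.+1%:R^-1 < e / 2.
    by have [k kP] := ltr_add_invr (divr_gt0 e0 (ltr0Sn R 1));
       exists k; rewrite add0r in kP.
  have k0 : 0 < k.+1%:R^-1 :> R by rewrite invr_gt0.
  have /choice[f fP] : forall ij : 'I_m * 'I_n, exists q : rat,
      `|ratr q - y ij.1 ij.2| < k.+1%:R^-1 :> R.
    move=> [i j] /=.
    have /rat_in_itvoo[q] : y i j - k.+1%:R^-1 < y i j + k.+1%:R^-1.
      by rewrite ltrBlDr -addrA ltrDl addr_gt0.
    by rewrite in_itv/= => /andP[q1 q2]; exists q; rewrite ltr_distl q1 q2.
  pose p := (\matrix_(i, j) f (i, j), k).
  exists (pickle p) => //=; rewrite pickleK /= /C.
  have pE i j : (map_mx ratr p.1 : 'M[R]_(m, n)) i j = ratr (f (i, j)).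
    by rewrite !mxE.
  rewrite ifT; first by split => // i j; rewrite pE; exact: fP (i, j).
  apply/asboolP => z [_ zP]; apply: yeA; split => // i j.
  change (`|y i j - (z : 'M[R]_(m, n)) i j| < e).
  rewrite (le_lt_trans (ler_distD (ratr (f (i, j))) _ _))//.
  rewrite (splitr e) ltrD//.
    by rewrite distrC (lt_trans (fP (i, j)))//.
  by have := zP i j; rewrite pE => /lt_trans; exact.
apply: bigcupT_measurable => i; case: (unpickle i) => //=.
Qed.

Lemma closed_measurable_mx m n (A : set 'M[R]_(m, n)) :
  closed A -> measurable A.
Proof.
move=> cA; rewrite -[A]setCK; apply: measurableC; apply: open_measurable_mx.
exact: closed_openC.
Qed.

Lemma compact_measurable_mx m n (A : set 'M[R]_(m, n)) :
  compact A -> measurable A.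
Proof.
move=> cA; apply: closed_measurable_mx.
by apply: compact_closed => //; exact: (@norm_hausdorff R 'M[R]_(m, n)).
Qed.

Definition consr n (p : measurableTypeR R * 'rV[R]_n) : 'rV[R]_n.+1 :=
  row_mx (\row_(_ < 1) p.1) p.2.

Lemma measurable_consr n : measurable_fun setT (@consr n).
Proof.
apply: (@measurable_row_mx R _ _ 1 n); last exact: measurable_snd.
apply: measurable_const_row; exact: measurable_fst.
Qed.

Lemma measurable_consr_r n (x : measurableTypeR R) :
  measurable_fun setT (fun v : 'rV[R]_n => consr (x, v)).
Proof.
by apply: (measurableT_comp (@measurable_consr n)); exact: pair1_measurable.
Qed.

Lemma measurable_consr_l n (v : 'rV[R]_n) :
  measurable_fun setT (fun x : measurableTypeR R => consr (x, v)).
Proof.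
by apply: (measurableT_comp (@measurable_consr n)); exact: pair2_measurable.
Qed.

Lemma consrK n (x : 'rV[R]_(1 + n)) : consr (x 0 0, rsubmx x) = x.
Proof.
rewrite /consr /= -[RHS]hsubmxK; congr (@row_mx _ _ 1 n _ _).
by apply/rowP => i; rewrite ord1 !mxE; congr (x _ _); apply/val_inj.
Qed.

Lemma consr0 n (x : measurableTypeR R) (v : 'rV[R]_n) :
  (consr (x, v) : 'rV[R]_(1 + n)) 0 0 = x.
Proof. by rewrite /consr mxE; case: splitP => //= j _; rewrite mxE. Qed.

Lemma rsub_consr n (x : measurableTypeR R) (v : 'rV[R]_n) :
  rsubmx (consr (x, v) : 'rV[R]_(1 + n)) = v.
Proof. by rewrite /consr /= row_mxKr. Qed.

(** One Lebesgue coordinate in front of [m], as in the recursive clause of [ninteg]. *)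
Definition cons_measure n (m : {sigma_finite_measure set 'rV[R]_n -> \bar R})
  : set 'rV[R]_n.+1 -> \bar R := pushforward (leb \x m)%E (@consr n).

HB.instance Definition _ n m := Measure.copy (@cons_measure n m)
  (measure_function_pushforward__canonical__measure_function_Measure
     (leb \x m)%E (@measurable_consr n)).

Lemma cons_measure_sigma_finite n m : sigma_finite setT (@cons_measure n m).
Proof.
have /sigma_finiteP[F [TF ndF Foo]] := sigma_finiteT leb.
have /sigma_finiteP[G [TG ndG Goo]] := sigma_finiteT m.
exists (fun k => (fun x : 'rV[R]_(1 + n) => x 0 0) @^-1` F k `&`
                 (fun x : 'rV[R]_(1 + n) => rsubmx x) @^-1` G k).
  apply/esym; rewrite -subTset => x _.
  have [k _ Fk] : (\bigcup_i F i) (x 0 0) by rewrite -TF.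
  have [l _ Gl] : (\bigcup_i G i) (rsubmx (x : 'rV[R]_(1 + n))) by rewrite -TG.
  exists (maxn k l) => //; split.
    by have /subsetPset := ndF _ _ (leq_maxl k l); apply.
  by have /subsetPset := ndG _ _ (leq_maxr k l); apply.
move=> k; have [mF Fy] := Foo k; have [mG Gy] := Goo k; split.
  apply: measurableI; rewrite -[X in measurable X]setTI.
    by apply: measurable_coord.
  exact: (measurable_rsubmx (m := 1) (f := fun x : 'rV[R]_(1 + n) => x)).
rewrite /cons_measure /pushforward.
rewrite (_ : _ @^-1` _ = F k `*` G k).
  by rewrite product_measure1E// lte_mul_pinfty// ge0_fin_numE.
by apply/seteqP; split=> -[x v] /=; rewrite consr0 rsub_consr.
Qed.

HB.instance Definition _ n m := Measure_isSigmaFinite.Build _ _ _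
  (@cons_measure n m) (cons_measure_sigma_finite m).

(** [ninteg] is only an iterated integral. One sigma-finite measure behind it, a Dirac mass in
    dimension 0 extended by [cons_measure], gives access to Tonelli, null sets and dominated
    convergence. *)
Lemma ex_leb n : exists mu : {sigma_finite_measure set 'rV[R]_n -> \bar R},
  forall f, (forall x, 0 <= f x)%E -> measurable_fun setT f ->
  ninteg f = (\int[mu]_x f x)%E.
Proof.
elim: n => [|n [mu IH]].
  exists \d_(0 : 'rV[R]_0) => f f0 mf.
  by rewrite integral_dirac//= diracT mul1e.
exists (cons_measure mu) => f f0 mf.
rewrite [RHS](@ge0_integral_pushforward _ _ _ _ _ _ (@measurable_consr n)
  [the measure _ _ of (leb \x mu)%E])// preimage_setT.
rewrite (@fubini_tonelli1 _ _ _ _ R leb mu (f \o @consr n)); last 2 first.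

- by apply: (measurableT_comp mf); exact: measurable_consr.
- by move=> x; exact: f0.
rewrite /=; apply: eq_integral => x _; rewrite /fubini_F /= IH//.
apply: (measurableT_comp mf).
exact: measurable_consr_r.
Qed.

Definition mu n : {sigma_finite_measure set 'rV[R]_n -> \bar R} :=
  sval (cid (@ex_leb n)).

Lemma nintegE n (f : 'rV[R]_n -> \bar R) : (forall x, 0 <= f x)%E ->
  measurable_fun setT f -> ninteg f = (\int[mu n]_x f x)%E.
Proof. by rewrite /mu; case: cid => /= m; exact. Qed.

Lemma volnE n (A : set 'rV[R]_n) : measurable A -> voln A = mu n A.
Proof.
move=> mA; rewrite /voln nintegE ?integral_indic ?setIT//.
exact/measurable_EFinP/measurable_indic.
Qed.

Lemma nintegS n (f : 'rV[R]_n.+1 -> \bar R) : (forall x, 0 <= f x)%E ->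
  measurable_fun setT f ->
  (\int[mu n.+1]_x f x = \int[leb]_x \int[mu n]_v f (consr (x, v)))%E.
Proof.
move=> f0 mf; rewrite -nintegE//=; apply: eq_integral => x _.
rewrite nintegE//; apply: (measurableT_comp mf).
exact: measurable_consr_r.
Qed.

Lemma nintegSC n (f : 'rV[R]_n.+1 -> \bar R) : (forall x, 0 <= f x)%E ->
  measurable_fun setT f ->
  (\int[mu n.+1]_x f x = \int[mu n]_v \int[leb]_x f (consr (x, v)))%E.
Proof.
move=> f0 mf; rewrite nintegS//.
apply: (@fubini_tonelli _ _ _ _ R leb (mu n) (fun p => f (consr p))) => //.
by apply: (measurableT_comp mf); exact: measurable_consr.
Qed.

End Borel.

(** * Linear change of variables *)

Section LinearChange.
Variable R : realType.
Local Notation leb := (@lebesgue_measure R).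
Local Notation Rm := (measurableTypeR R).

(** The rescaled image of Lebesgue measure under the affine map agrees with Lebesgue measure on the
    intervals []x, y]], and this determines it. For negative [a] the preimage of such an interval is
    open at its other end. *)
Lemma leb_affine (a b : R) (f : Rm -> \bar R) : a != 0 ->
  (forall x, 0 <= f x)%E -> measurable_fun setT f ->
  (`|a|%:E * \int[leb]_x f (a * x + b)%R = \int[leb]_x f x)%E.
Proof.
move=> a0 f0 mf.
pose phi (x : Rm) : Rm := a * x + b.
have mphi : measurable_fun setT phi.
  by apply: (@measurable_funD _ Rm R setT (fun x => a * x) (cst b)) => //;
    exact: (@mulrl_measurable R setT a).
pose m0 := measure_function_pushforward__canonical__measure_function_Measure leb mphi.
have a0' : 0 <= `|a| by [].
pose m1 := mscale (NngNum a0') m0.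
have E A : measurable A -> leb A = m1 A.
  move=> mA; apply: lebesgue_measure_unique => // _ [[x y] _ <-] /=.
  rewrite /m1 /mscale /= /pushforward.
  have [a_gt0|a_lt0|/eqP] := ltgtP 0 a; last by rewrite eq_sym (negbTE a0).
    have -> : phi @^-1` `]x, y] = `](x - b) / a, (y - b) / a]%classic.
      apply/seteqP; split=> z /=; rewrite !in_itv /= /phi ltr_pdivrMr//
        ler_pdivlMr// ltrBlDr lerBrDr (mulrC z); exact.
    rewrite !lebesgue_measure_itv/= !lte_fin ltr_pM2r ?invr_gt0// ltrD2r.
    case: ifPn; last by rewrite mule0.
    rewrite -!EFinD -EFinM gtr0_norm// => _; congr EFin.
    by field.
  have -> : phi @^-1` `]x, y] = `[(y - b) / a, (x - b) / a[%classic.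
    apply/seteqP; split=> z /=; rewrite !in_itv /= /phi ltr_ndivlMr//
        ler_ndivrMr// ltrBlDr lerBrDr (mulrC z) andbC; exact.
  rewrite !lebesgue_measure_itv/= !lte_fin ltr_nM2r ?invr_lt0// ltrD2r.
  case: ifPn; last by rewrite mule0.
  rewrite -!EFinD -EFinM ltr0_norm// => _; congr EFin.
  by field.
rewrite [RHS](@eq_measure_integral _ _ _ _ m1); last first.
  by move=> A mA _; exact: E.
rewrite ge0_integral_mscale//; congr (_ * _)%E.
by rewrite (ge0_integral_pushforward mphi leb)//.
Qed.

Lemma integral_mu0 (f : 'rV[R]_0 -> \bar R) : (forall x, 0 <= f x)%E ->
  measurable_fun setT f -> (\int[mu R 0]_x f x = f (0 : 'rV[R]_0)%R)%E.
Proof. by move=> f0 mf; rewrite -nintegE. Qed.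

Lemma measurable_row_mx2 a b :
  measurable_fun setT (fun p : 'rV[R]_a * 'rV[R]_b => row_mx p.1 p.2).
Proof.
by apply: measurable_row_mx; [exact: measurable_fst|exact: measurable_snd].
Qed.

Lemma measurable_row_mxr a b (x : 'rV[R]_a) :
  measurable_fun setT (fun v : 'rV[R]_b => row_mx x v).
Proof. by apply: measurable_row_mx. Qed.

Lemma measurable_row_mxl a b (v : 'rV[R]_b) :
  measurable_fun setT (fun x : 'rV[R]_a => row_mx x v).
Proof. by apply: measurable_row_mx. Qed.

Lemma integral_mu_row a b (f : 'rV[R]_(a + b) -> \bar R) :
  (forall x, 0 <= f x)%E -> measurable_fun setT f ->
  (\int[mu R (a + b)]_x f x = \int[mu R a]_x \int[mu R b]_v f (row_mx x v))%E.
Proof.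
have mg c (f' : 'rV[R]_(c + b) -> \bar R) : (forall x, 0 <= f' x)%E ->
    measurable_fun setT f' ->
    measurable_fun setT (fun x => \int[mu R b]_v f' (row_mx x v))%E.
  move=> f0 mf.
  apply: (@measurable_fun_fubini_tonelli_F _ _ _ _ R (mu R b)
    (fun p : 'rV[R]_c * 'rV[R]_b => f' (row_mx p.1 p.2))) => //.
  apply: (measurableT_comp mf); exact: measurable_row_mx2.
elim: a f => [|a IH] f f0 mf.
  rewrite integral_mu0; last 2 first.
  - by move=> x; exact: integral_ge0.
  - exact: mg.
  by apply: eq_integral => v _; rewrite row_thin_mx.
rewrite [RHS]nintegS; last 2 first.
- by move=> x; exact: integral_ge0.
- exact: mg.
rewrite nintegS; [|exact: f0|exact: mf]; apply: eq_integral => x _.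
rewrite (IH (fun w => f (consr (x, w)))); [|by move=> w; exact: f0|]; last first.
  by apply: (measurableT_comp mf); exact: measurable_consr_r.
apply: eq_integral => y _; apply: eq_integral => v _.
by rewrite /consr /= row_mxA castmx_id.
Qed.

Lemma integral_mu_rowC a b (f : 'rV[R]_(a + b) -> \bar R) :
  (forall x, 0 <= f x)%E -> measurable_fun setT f ->
  (\int[mu R (a + b)]_x f x = \int[mu R b]_v \int[mu R a]_x f (row_mx x v))%E.
Proof.
move=> f0 mf; rewrite integral_mu_row//.
apply: (@fubini_tonelli _ _ _ _ R (mu R a) (mu R b)
  (fun p : 'rV[R]_a * 'rV[R]_b => f (row_mx p.1 p.2))) => //.
by apply: (measurableT_comp mf); exact: measurable_row_mx2.
Qed.

Lemma integral_mu_shift n (t : 'rV[R]_n) (f : 'rV[R]_n -> \bar R) :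
  (forall x, 0 <= f x)%E -> measurable_fun setT f ->
  (\int[mu R n]_x f (x + t)%R = \int[mu R n]_x f x)%E.
Proof.
elim: n t f => [|n IH] t f f0 mf.
  rewrite !integral_mu0//; first by rewrite (_ : 0 + t = 0)//; apply/rowP => -[].
  by apply: (measurableT_comp mf); apply: measurable_addmx.
have mf' : measurable_fun setT (fun x : 'rV[R]_n.+1 => f (x + t)).
  by apply: (measurableT_comp mf); apply: measurable_addmx.
rewrite nintegS; [|by move=> x; exact: f0|exact: mf'].
rewrite [RHS]nintegS; [|exact: f0|exact: mf].
have mF : measurable_fun [set: Rm] (fun x => \int[mu R n]_v f (consr (x, v)))%E.
  apply: (@measurable_fun_fubini_tonelli_F _ _ _ _ R (mu R n)
    (fun p => f (consr p))) => //.
  by apply: (measurableT_comp mf); exact: measurable_consr.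
rewrite -[RHS](@leb_affine 1 (t 0 0))//; last first.
  by move=> x; exact: integral_ge0.
rewrite normr1 mul1e; apply: eq_integral => x _; rewrite mul1r.
rewrite -[RHS](IH (rsubmx (t : 'rV[R]_(1 + n))))//; last first.
  by apply: (measurableT_comp mf); exact: measurable_consr_r.
apply: eq_integral => v _; congr f.
by rewrite -[in LHS](consrK (t : 'rV[R]_(1 + n))) /consr /=
  (@add_row_mx _ 1 1 n); congr (@row_mx _ 1 1 n _ _); apply/rowP => i; rewrite !mxE.
Qed.

(** Quantified over nonnegative functions rather than sets, so that it passes directly to products
    of matrices. *)
Definition linear_change n (M : 'M[R]_n) :=
  forall f : 'rV[R]_n -> \bar R, (forall x, 0 <= f x)%E ->
  measurable_fun setT f ->
  (`|\det M|%:E * \int[mu R n]_x f (x *m M) = \int[mu R n]_x f x)%E.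

Lemma linear_changeM n (M N : 'M[R]_n) :
  linear_change M -> linear_change N -> linear_change (M *m N).
Proof.
move=> hM hN f f0 mf; rewrite det_mulmx normrM mulrC EFinM -muleA.
under eq_integral do rewrite mulmxA.
rewrite (hM (fun x => f (x *m N))) ?hN//.
by apply: (measurableT_comp mf); apply: measurable_mulmx.
Qed.

(** For a fixed first coordinate the map is [S] followed by a translation; what remains is a
    one-dimensional scaling by [a]. *)
Lemma linear_change_upper n (a : 'M[R]_1) (b : 'rV[R]_n) (S : 'M[R]_n) :
  a 0 0 != 0 -> linear_change S ->
  linear_change (block_mx a b 0 S : 'M[R]_(1 + n)).
Proof.
move=> a0 hS f f0 mf.
rewrite (@det_ublock _ 1 n) normrM [a]mx11_scalar det_scalar1 -mx11_scalar.
rewrite EFinM -muleA.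
have mf' : measurable_fun setT (fun x : 'rV[R]_(1 + n) => f (x *m block_mx a b 0 S)).
  by apply: (measurableT_comp mf); apply: measurable_mulmx.
rewrite (@nintegS R n (fun x => f (x *m (block_mx a b 0 S : 'M[R]_(1 + n)))));
  [|by move=> x; exact: f0|exact: mf'].
rewrite [RHS]nintegS; [|exact: f0|exact: mf].
have mF : measurable_fun [set: Rm] (fun x => \int[mu R n]_v f (consr (x, v)))%E.
  apply: (@measurable_fun_fubini_tonelli_F _ _ _ _ R (mu R n)
    (fun p => f (consr p))) => //.
  by apply: (measurableT_comp mf); exact: measurable_consr.
rewrite -[RHS](@leb_affine (a 0 0) 0)//; last first.
  by move=> x; exact: integral_ge0.
congr (_ * _)%E; rewrite -ge0_integralZl//; last 2 first.
- apply: (@measurable_fun_fubini_tonelli_F _ _ _ _ R (mu R n)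
    (fun p => f (consr p *m (block_mx a b 0 S : 'M[R]_(1 + n))))) => //.
  by apply: (measurableT_comp mf'); exact: measurable_consr.
- by move=> x _; exact: integral_ge0.
apply: eq_integral => x _; rewrite addr0.
have mfx y : measurable_fun setT (fun v : 'rV[R]_n => f (consr (y, v))).
  by apply: (measurableT_comp mf); exact: measurable_consr_r.
rewrite -[RHS](@integral_mu_shift _ (x *: b))//.
rewrite -[RHS]hS//; last first.
  by apply: (measurableT_comp (mfx _)); apply: measurable_addmx.
congr (_ * _)%E; apply: eq_integral => v _; congr f.
rewrite /consr /= (@mul_row_block _ 1 1 n 1 n) mulmx0 addr0.
congr (@row_mx _ 1 1 n _ _).
  by apply/rowP => i; rewrite !ord1 !mxE big_ord1 mxE mulrC.
rewrite addrC; congr (_ + _).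
by apply/rowP => i; rewrite !mxE big_ord1 mxE.
Qed.

(** Here only the first coordinate moves, by a translation depending on the others, so it is
    integrated innermost. *)
Lemma linear_change_lower n (c : 'cV[R]_n) :
  linear_change (block_mx 1%:M 0 c 1%:M : 'M[R]_(1 + n)).
Proof.
move=> f f0 mf.
rewrite (@det_lblock _ 1 n) !det1 mulr1 normr1 mul1e.
have mf' : measurable_fun setT
   (fun x : 'rV[R]_(1 + n) => f (x *m block_mx 1%:M 0 c 1%:M)).
  by apply: (measurableT_comp mf); apply: measurable_mulmx.
rewrite (@nintegSC R n
  (fun x => f (x *m (block_mx 1%:M 0 c 1%:M : 'M[R]_(1 + n)))));
  [|by move=> x; exact: f0|exact: mf'].
rewrite [RHS]nintegSC; [|exact: f0|exact: mf].
apply: eq_integral => v _.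
rewrite -[RHS](@leb_affine 1 ((v *m c) 0 0))//; last first.
  by apply: (measurableT_comp mf); exact: measurable_consr_l.
rewrite normr1 mul1e; apply: eq_integral => x _; congr f.
rewrite /consr /= (@mul_row_block _ 1 1 n 1 n) !mulmx1 mulmx0 add0r mul1r.
by congr (@row_mx _ 1 1 n _ _); apply/rowP => i; rewrite !ord1 !mxE.
Qed.

Lemma linear_change1 n : linear_change (1%:M : 'M[R]_n).
Proof.
move=> f f0 mf; rewrite det1 normr1 mul1e.
by apply: eq_integral => x _; rewrite mulmx1.
Qed.

(** Gaussian elimination: a matrix with nonzero corner is a lower times an upper block triangular
    matrix, and one row operation makes the corner nonzero. *)
Lemma linear_changeP n (M : 'M[R]_n) : M \in unitmx -> linear_change M.
Proof.
elim: n M => [|n IH] M Mu.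
  by rewrite (_ : M = 1%:M); [exact: linear_change1|apply/matrixP => -[]].
suff base (N : 'M[R]_(1 + n)) : N \in unitmx -> N 0 0 != 0 -> linear_change N.
  have [M00|] := eqVneq (M 0 0) 0; last exact: base.
  have [i Mi] : exists i : 'I_n, M (rshift 1 i) 0 != 0.
    apply/existsP; rewrite -negb_forall; apply/negP => /forallP M0.
    move: Mu; rewrite unitmxE (expand_det_col _ 0) big1 ?unitr0// => i _.
    rewrite (_ : M i 0 = 0) ?mul0r//.
    case: (@splitP 1 n i) => k ik.
      by rewrite (_ : i = 0)//; apply/val_inj => /=; rewrite ik; case: k {ik} => -[].
    by have /eqP <- := M0 k; congr (M _ _); apply/val_inj.
  pose r : 'rV[R]_n := delta_mx 0 i.
  (* The inner product adds row [i] to the first row, which puts a nonzero entry in the corner; the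
     outer factor undoes it. *)
  have M_E : M = (block_mx 1%:M (- r) 0 1%:M : 'M[R]_(1 + n)) *m
      ((block_mx 1%:M r 0 1%:M : 'M[R]_(1 + n)) *m M).
    rewrite mulmxA mulmx_block !mulmx1 !mul1mx !mulmx0 !mul0mx !addr0 add0r.
    by rewrite subrr -scalar_mx_block mul1mx.
  rewrite M_E; apply: linear_changeM.
    by apply: linear_change_upper; rewrite ?mxE ?oner_eq0//; exact: linear_change1.
  apply: base.
    rewrite unitmx_mul Mu andbT unitmxE (@det_ublock _ 1 n) !det1 mulr1.
    exact: unitr1.
  rewrite -[in X in _ *m X](@submxK _ 1 n 1 n M) (@mulmx_block _ 1 n 1 n 1 n) !mul1mx.
  rewrite [X in _ X X](_ : (0 : 'I_(1 + n)) = lshift n (0 : 'I_1)); last exact/val_inj.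
  rewrite block_mxEul -rowE !mxE.
  rewrite (_ : lshift n (0 : 'I_1) = 0 :> 'I_(1 + n)); last exact/val_inj.
  by rewrite M00 add0r.
move=> Nu N00.
pose a := ulsubmx N; pose b := ursubmx N; pose c := dlsubmx N.
have l0 : lshift n (0 : 'I_1) = (0 : 'I_(1 + n)) by exact/val_inj.
have aE : a 0 0 = N 0 0 by rewrite /a !mxE l0.
pose c' := (a 0 0)^-1 *: c.
(* The Schur complement of the corner entry. *)
pose S := drsubmx N - c' *m b.
have NE : N = (block_mx 1%:M 0 c' 1%:M : 'M[R]_(1 + n)) *m block_mx a b 0 S.
  rewrite mulmx_block !mul1mx !mul0mx !addr0 /S [c' *m b + _]addrC subrK.
  rewrite [a in c' *m a]mx11_scalar mul_mx_scalar scalerA divff ?aE// scale1r.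
  by rewrite submxK.
have Su : S \in unitmx.
  move: Nu; rewrite NE unitmx_mul => /andP[_].
  by rewrite !unitmxE (@det_ublock _ 1 n) unitrM => /andP[].
rewrite NE; apply: linear_changeM; first exact: linear_change_lower.
by apply: linear_change_upper; [rewrite aE|exact: IH].
Qed.

End LinearChange.

(** * Null sets, slices and orthonormal frames *)

Section SetMeasure.
Variable R : realType.
Local Notation leb := (@lebesgue_measure R).
Local Notation Rm := (measurableTypeR R).
Local Notation mu := (mu R).

Lemma measurable_preimage_fun d d' (T : measurableType d) (T' : measurableType d')
    (f : T -> T') (A : set T') :
  measurable_fun setT f -> measurable A -> measurable [set x | A (f x)].
Proof. by move=> mf mA; rewrite -[X in measurable X]setTI; exact: mf. Qed.

Lemma measurable_ind d (T : measurableType d) (A : set T) :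
  measurable A -> measurable_fun setT (fun x => (\1_A x)%:E : \bar R).
Proof. by move=> mA; exact/measurable_EFinP/measurable_indic. Qed.

Lemma measure_ind d (T : measurableType d) (m : {measure set T -> \bar R})
    (A : set T) : measurable A -> m A = (\int[m]_x (\1_A x)%:E)%E.
Proof. by move=> mA; rewrite integral_indic// setIT. Qed.

Lemma indic_pre (T T' : Type) (f : T -> T') (A : set T') x :
  \1_A (f x) = \1_[set y | A (f y)] x :> R.
Proof. by rewrite !indicE; congr (_%:R); apply/asbool_equiv_eq. Qed.

Lemma mu_linear n (T : 'M[R]_n) A : T \in unitmx -> measurable A ->
  (`|\det T|%:E * mu n [set x | A (x *m T)] = mu n A)%E.
Proof.
move=> uT mA; rewrite [RHS]measure_ind// -(linear_changeP uT)//; last first.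
  exact: measurable_ind.
rewrite measure_ind//; last first.
  by apply: measurable_preimage_fun => //; apply: measurable_mulmx.
Qed.

Lemma mu_orth n (T : 'M[R]_n) A : T *m T^T = 1%:M -> measurable A ->
  mu n [set x | A (x *m T)] = mu n A.
Proof.
move=> TT mA; have uT : T \in unitmx by case: (mulmx1_unit TT).
rewrite -(mu_linear uT mA).
suff -> : `|\det T| = 1 by rewrite mul1e.
have : `|\det T| ^+ 2 = 1.
  by rewrite -normrX expr2 -{2}det_tr -det_mulmx TT det1 normr1.
by move=> /eqP; rewrite sqrp_eq1// => /eqP.
Qed.

Lemma mu_scale n (a : R) (A : set 'rV[R]_n) : a != 0 -> measurable A ->
  ((`|a| ^+ n)%:E * mu n [set x : 'rV[R]_n | A (a *: x)%R] = mu n A)%E.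
Proof.
move=> a0 mA; have uT : (a%:M : 'M[R]_n) \in unitmx.
  by rewrite unitmxE det_scalar unitrX// unitfE.
rewrite -(mu_linear uT mA) det_scalar normrX; congr (_ * mu n _)%E.
by apply/seteqP; split=> x /=; rewrite mul_mx_scalar.
Qed.

Lemma mu_shift n (t : 'rV[R]_n) A : measurable A ->
  mu n [set x | A (x + t)] = mu n A.
Proof.
move=> mA; rewrite [RHS]measure_ind// -(@integral_mu_shift _ _ t)//; last first.
  exact: measurable_ind.
rewrite (measure_ind (mu n)); last first.
  by apply: measurable_preimage_fun => //; apply: measurable_addmx.
by apply: eq_integral => x _; rewrite (indic_pre (fun x => x + t)).
Qed.

Lemma measurable_slice a b (A : set 'rV[R]_(a + b)) (x : 'rV[R]_a) :
  measurable A -> measurable [set v | A (row_mx x v)].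
Proof. by apply: measurable_preimage_fun; exact: measurable_row_mxr. Qed.

Lemma measurable_sliceC a b (A : set 'rV[R]_(a + b)) (v : 'rV[R]_b) :
  measurable A -> measurable [set x | A (row_mx x v)].
Proof. by apply: measurable_preimage_fun; exact: measurable_row_mxl. Qed.

Lemma measurable_mu_slice a b (A : set 'rV[R]_(a + b)) : measurable A ->
  measurable_fun setT (fun x => mu b [set v | A (row_mx x v)]).
Proof.
move=> mA.
have mB : measurable [set p : 'rV[R]_a * 'rV[R]_b | A (row_mx p.1 p.2)].
  by apply: measurable_preimage_fun => //; exact: measurable_row_mx2.
rewrite (_ : (fun x => _) = mu b \o xsection [set p | A (row_mx p.1 p.2)]).
  exact: measurable_fun_xsection.
by apply/funext => x /=; congr (mu b _); apply/seteqP; split => v /=;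
  rewrite xsectionE /=.
Qed.

Lemma measurable_mu_sliceC a b (A : set 'rV[R]_(a + b)) : measurable A ->
  measurable_fun setT (fun v => mu a [set x | A (row_mx x v)]).
Proof.
move=> mA.
have mB : measurable [set p : 'rV[R]_a * 'rV[R]_b | A (row_mx p.1 p.2)].
  by apply: measurable_preimage_fun => //; exact: measurable_row_mx2.
rewrite (_ : (fun x => _) = mu a \o ysection [set p | A (row_mx p.1 p.2)]).
  exact: measurable_fun_ysection.
by apply/funext => x /=; congr (mu a _); apply/seteqP; split => v /=;
  rewrite ysectionE /=.
Qed.

Lemma mu_row a b (A : set 'rV[R]_(a + b)) : measurable A ->
  mu (a + b) A = (\int[mu a]_x mu b [set v | A (row_mx x v)])%E.
Proof.
move=> mA; rewrite measure_ind// integral_mu_row//; last exact: measurable_ind.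
apply: eq_integral => x _; rewrite measure_ind; last exact: measurable_slice.
by apply: eq_integral => v _; rewrite indic_pre.
Qed.

Lemma mu_rowC a b (A : set 'rV[R]_(a + b)) : measurable A ->
  mu (a + b) A = (\int[mu b]_v mu a [set x | A (row_mx x v)])%E.
Proof.
move=> mA; rewrite measure_ind// integral_mu_rowC//; last exact: measurable_ind.
apply: eq_integral => x _; rewrite measure_ind; last exact: measurable_sliceC.
by apply: eq_integral => v _; rewrite (indic_pre (fun v => row_mx v x)).
Qed.

Lemma measurable_cons_slice n (A : set 'rV[R]_n.+1) (v : 'rV[R]_n) :
  measurable A -> measurable [set x : Rm | A (consr (x, v))].
Proof. by apply: measurable_preimage_fun; exact: measurable_consr_l. Qed.

Lemma measurable_leb_slice n (A : set 'rV[R]_n.+1) : measurable A ->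
  measurable_fun setT (fun v => leb [set x | A (consr (x, v))]).
Proof.
move=> mA.
have mB : measurable [set p : Rm * 'rV[R]_n | A (consr p)].
  by apply: measurable_preimage_fun => //; exact: measurable_consr.
rewrite (_ : (fun x => _) = leb \o ysection [set p | A (consr p)]).
  exact: measurable_fun_ysection.
by apply/funext => x /=; congr (leb _); apply/seteqP; split => v /=;
  rewrite ysectionE /=.
Qed.

Lemma mu_cons n (A : set 'rV[R]_n.+1) : measurable A ->
  mu n.+1 A = (\int[mu n]_v leb [set x | A (consr (x, v))])%E.
Proof.
move=> mA; rewrite measure_ind// nintegSC//; last exact: measurable_ind.
apply: eq_integral => v _.
rewrite [RHS]measure_ind; last exact: measurable_cons_slice.
by apply: eq_integral => x _; rewrite (indic_pre (fun x => consr (x, v))).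
Qed.

Lemma measurable_box k (M : R) :
  measurable [set x : 'rV[R]_k | forall i, `|x 0 i| <= M].
Proof.
rewrite (_ : mkset _ = \bigcap_(i in [set: 'I_k])
    ((fun x : 'rV[R]_k => x 0 i) @^-1` `[- M, M])).
  apply: fin_bigcap_measurable => // i _.
  by rewrite -[X in measurable X]setTI; apply: measurable_coord.
apply/seteqP; split=> x /= xM i; last first.
  by have := xM i I; rewrite /= in_itv/= -ler_norml.
by move=> _ /=; rewrite in_itv/= -ler_norml.
Qed.

Lemma mu_box n (M : R) : 0 <= M ->
  mu n [set x | forall i, `|x 0 i| <= M] = ((2 * M) ^+ n)%:E.
Proof.
move=> M0; have mbox k := @measurable_box k M.
elim: n => [|n IH].
  transitivity (mu 0 setT).
    by congr (mu 0 _); apply/seteqP; split => // x _ [].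
  rewrite measure_ind// integral_mu0//; last exact: measurable_ind.
  by rewrite indicE in_setT expr0.
rewrite mu_cons//.
pose B := [set x : 'rV[R]_n | forall i, `|x 0 i| <= M].
transitivity (\int[mu n]_v ((2 * M)%:E * (\1_B v)%:E))%E.
  apply: eq_integral => v _; rewrite indicE.
  have E x : (forall i, `|(consr (x, v)) 0 i| <= M) <-> `|x| <= M /\ B v.
    split=> [xv|[xM Bv] i].
      split; first by have := xv 0; rewrite (@consr0 R n x v).
      move=> i; have := xv (rshift 1 i); by rewrite /consr /= (@row_mxEr _ 1 1 n).
    rewrite /consr mxE; case: splitP => k _; first by rewrite mxE.
    exact: Bv.
  have [/set_mem Bv|/negP Bv] := boolP (v \in B).
    rewrite mule1 (_ : mkset _ = `[- M, M]%classic).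
      rewrite lebesgue_measure_itv/= lte_fin; case: ltP => h.
        by rewrite -EFinD; congr EFin; lra.
      by congr EFin; lra.
    apply/seteqP; split=> x /=; rewrite in_itv/= -ler_norml.
      by move=> /E[].
    by move=> xM; apply/E.
  rewrite mule0 (_ : mkset _ = set0) ?measure0//.
  by apply/seteqP; split => // x /E[_ /mem_set].
rewrite ge0_integralZl//; last 2 first.
- by apply: measurable_ind; exact: mbox.
- by rewrite lee_fin mulr_ge0.
rewrite integral_indic//; last exact: mbox.
by rewrite exprS [RHS]EFinM; congr (_ * _)%E; rewrite setIT; exact: IH.
Qed.

Lemma le_mx_norm n (x : 'rV[R]_n) i : `|x 0 i| <= `|x|.
Proof.
rewrite [leRHS]/Num.norm /= mx_normrE.
by apply/bigmax_geP; right => /=; exists (0, i).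
Qed.

Lemma mu_bounded n (A : set 'rV[R]_n) (M : R) : measurable A ->
  (forall x, A x -> `|x| <= M) -> (mu n A < +oo)%E.
Proof.
move=> mA AM; have [->|/set0P[x0 Ax0]] := eqVneq A set0; first by rewrite measure0.
have M0 : 0 <= M by rewrite (le_trans _ (AM _ Ax0)).
apply: (@le_lt_trans _ _ (mu n [set x | forall i, `|x 0 i| <= M])).
  apply: le_measure; rewrite ?inE//; first exact: measurable_box.
  by move=> x Ax i; apply: le_trans (AM _ Ax); exact: le_mx_norm.
by rewrite mu_box// ltry.
Qed.

Lemma compact_norm_le n (A : set 'rV[R]_n) : compact A ->
  exists M : R, 0 < M /\ forall x, A x -> `|x| <= M.
Proof.
move=> /compact_bounded[M [Mr AM]].
exists (`|M| + 1); split; first by rewrite ltr_wpDl.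
by apply: AM; rewrite (le_lt_trans (ler_norm _))// ltrDl.
Qed.

Lemma mu_compact n (A : set 'rV[R]_n) : compact A -> (mu n A < +oo)%E.
Proof.
move=> cA; have [M [_ AM]] := compact_norm_le cA.
by apply: mu_bounded AM; exact: compact_measurable_mx.
Qed.

Lemma mu_open_gt0 n (A : set 'rV[R]_n) : measurable A -> A° !=set0 ->
  (0 < mu n A)%E.
Proof.
move=> mA [x /nbhs_ballP[e /= e0 xeA]].
rewrite -(mu_shift x)//.
apply: (@lt_le_trans _ _ (mu n [set y | forall i, `|y 0 i| <= e / 2])).
  by rewrite mu_box ?divr_ge0 ?ltW// lte_fin exprn_gt0// mulr_gt0// divr_gt0.
apply: le_measure; rewrite ?inE; first exact: measurable_box.
  by apply: measurable_preimage_fun => //; apply: measurable_addmx.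
move=> y /= ye; apply: xeA; split => // i j; rewrite !ord1 mxE.
change (`|x 0 j - (y 0 j + x 0 j)| < e).
rewrite opprD addrCA subrr addr0 normrN (le_lt_trans (ye j))//.
by rewrite ltr_pdivrMr// ltr_pMr// ltr1n.
Qed.

(** Averaging the measure of the translates of [S] by [l a], [l] in [0, 1], gives [mu S] back;
    Tonelli turns the average into an integral of the linear measures of line sections. No basis
    containing [a] has to be chosen. *)
Lemma mu_null_line n (S : set 'rV[R]_n) (a : 'rV[R]_n) : measurable S ->
  (forall v, leb [set l : Rm | (0 <= l <= 1)%R /\ S (v + l *: a)%R] = 0%E) ->
  mu n S = 0%E.
Proof.
move=> mS S0.
pose X : set (Rm * 'rV[R]_n) := [set p | (0 <= p.1 <= 1) /\ S (p.2 + p.1 *: a)].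
have mX : measurable X.
  apply: measurableI.
    rewrite [X in measurable X](_ : _ = [set p : Rm * 'rV[R]_n | `[0, 1]%classic p.1]).
      by apply: measurable_preimage_fun; [exact: measurable_fst|].
    by apply/seteqP; split => p /=; rewrite in_itv/=.
  apply: measurable_preimage_fun => //.
  apply: measurable_addmx; first exact: measurable_snd.
  by apply: measurable_scalemx => //; exact: measurable_fst.
have := @fubini_tonelli _ _ _ _ R leb (mu n) (fun p => (\1_X p)%:E) (measurable_ind mX).
move=> /(_ (fun x => ltac:(by rewrite lee_fin))) E.
transitivity (\int[leb]_x \int[mu n]_v (\1_X (x, v))%:E)%E; last first.
  rewrite E; apply: integral0_eq => v _; rewrite -[RHS](S0 v).
  rewrite (measure_ind leb); last first.
    rewrite (_ : mkset _ = [set l : Rm | X (l, v)])//.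
    by apply: measurable_preimage_fun => //; exact: pair2_measurable.
  by apply: eq_integral => l _; rewrite (indic_pre (fun l => (l, v))).
transitivity (\int[leb]_x ((\1_(`[0%R, 1%R]%classic : set Rm) x)%:E * mu n S))%E.
  rewrite ge0_integralZr//; last exact: measurable_ind.
  rewrite [X in (_ = X * _)%E](_ : _ = 1%E) ?mul1e// integral_indic// setIT.
  have : leb (`[0%R, 1%R]%classic : set R) = 1%E.
    by rewrite lebesgue_measure_itv/= lte01 -EFinD subr0.
  exact.
apply: eq_integral => l _; rewrite indicE.
have [/set_mem /=|/negP] := boolP (l \in (`[0, 1]%classic : set Rm)).
  rewrite in_itv/= => l01; rewrite mul1e -(mu_shift (l *: a))//.
  rewrite measure_ind//; last first.
    by apply: measurable_preimage_fun => //; apply: measurable_addmx.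
  apply: eq_integral => v _; congr (_%:E); rewrite !indicE; congr (_%:R).
  by congr nat_of_bool; apply/idP/idP => /set_mem h; apply/mem_set => //; case: h.
rewrite inE/= in_itv/= => l01; rewrite mul0e integral0_eq// => v _.
by rewrite indicE memNset//; case.
Qed.

(** The reverse Fatou lemma for sets inside a set of finite measure. It carries both limit
    arguments: finite nets tending to a body, and rescaled tubes of growing radius. *)
Lemma mu_limsup n (F : (set 'rV[R]_n)^nat) (A B : set 'rV[R]_n) (c : \bar R) :
  (forall k, measurable (F k)) -> measurable A -> measurable B ->
  (mu n B < +oo)%E -> (forall k, F k `<=` B) ->
  (forall x, (forall N, exists2 k, (N <= k)%N & F k x) -> A x) ->
  (forall k, c <= mu n (F k))%E -> (c <= mu n A)%E.
Proof.
move=> mF mA mB Boo FB FA cF.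
apply: (@le_trans _ _ (mu n (lim_sup_set F))); last first.
  apply: le_measure; rewrite ?inE//.
    by apply: bigcap_measurable => // k _; exact: bigcup_measurable.
  by move=> x Fx; apply: FA => N; have [k /= Nk Fk] := Fx N I; exists k.
have cvF : (mu n (\bigcup_(k >= N) F k) @[N --> \oo] --> mu n (lim_sup_set F))%E.
  apply: lim_sup_set_cvg => //.
  apply: le_lt_trans Boo; apply: le_measure; rewrite ?inE//.
    exact: bigcup_measurable.
  by move=> x [k _ Fkx]; exact: FB Fkx.
rewrite -(cvg_lim _ cvF)//; apply: lime_ge; first by apply/cvg_ex; eexists; exact: cvF.
apply: nearW => k; apply: le_trans (cF k) _.
apply: le_measure; rewrite ?inE//; first exact: bigcup_measurable.
by move=> x Fkx; exists k => /=.
Qed.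

(** The condition [n = m + j] is kept out, so that parts of a frame are frames again
    ([frame_colP]). *)
Definition frame m j n (W : 'M[R]_(m, n)) (U : 'M[R]_(j, n)) : Prop :=
  [/\ W *m W^T = 1%:M, U *m U^T = 1%:M & W *m U^T = 0].

Lemma frameC m j n (W : 'M[R]_(m, n)) (U : 'M[R]_(j, n)) :
  frame W U -> frame U W.
Proof.
move=> [WW UU WU]; split => //; apply: (can_inj trmxK).
by rewrite trmx_mul trmxK WU trmx0.
Qed.

Lemma frame_full m j n (W : 'M[R]_(m, n)) (U : 'M[R]_(j, n)) :
  n = (m + j)%N -> frame W U -> W^T *m W + U^T *m U = 1%:M.
Proof.
move=> nE fr; case: (fr) => WW UU WU; have [_ _ UW] := frameC fr; subst n.
have M1 : col_mx W U *m (col_mx W U)^T = 1%:M.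
  by rewrite tr_col_mx mul_col_row WW UU WU UW -scalar_mx_block.
by have := mulmx1C M1; rewrite tr_col_mx mul_row_col.
Qed.

Lemma frame_decomp m j n (W : 'M[R]_(m, n)) (U : 'M[R]_(j, n)) (x : 'rV[R]_n) :
  n = (m + j)%N -> frame W U -> x *m W^T *m W + x *m U^T *m U = x.
Proof.
by move=> nE fr; rewrite -!mulmxA -mulmxDr (frame_full nE fr) mulmx1.
Qed.

Lemma measurable_frame_fun m j n (W : 'M[R]_(m, n)) (U : 'M[R]_(j, n))
    (t : 'rV[R]_j) :
  measurable_fun setT (fun y : 'rV[R]_m => y *m W + t *m U).
Proof. by apply: measurable_addmx => //; exact: measurable_mulmx. Qed.

Lemma mu_frame m j n (W : 'M[R]_(m, n)) (U : 'M[R]_(j, n)) (A : set 'rV[R]_n) :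
  n = (m + j)%N -> frame W U -> measurable A ->
  mu n A = (\int[mu j]_t mu m [set y | A (y *m W + t *m U)%R])%E.
Proof.
move=> nE fr mA; case: (fr) => WW UU WU; have [_ _ UW] := frameC fr; subst n.
have M1 : col_mx W U *m (col_mx W U)^T = 1%:M.
  by rewrite tr_col_mx mul_col_row WW UU WU UW -scalar_mx_block.
rewrite -(mu_orth M1 mA) mu_rowC; last first.
  by apply: measurable_preimage_fun => //; apply: measurable_mulmx.
by apply: eq_integral => t _; congr (mu m _); apply/seteqP; split => y /=;
  rewrite mul_row_col.
Qed.

Lemma measurable_mu_frame m j n (W : 'M[R]_(m, n)) (U : 'M[R]_(j, n))
  (A : set 'rV[R]_n) : measurable A ->
  measurable_fun setT (fun t => mu m [set y | A (y *m W + t *m U)%R]).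
Proof.
move=> mA; have := @measurable_mu_sliceC m j [set x | A (x *m col_mx W U)].
move=> /(_ _)/wrap[].
  by apply: measurable_preimage_fun => //; apply: measurable_mulmx.
apply: eq_measurable_fun => t _; congr (mu m _); apply/seteqP; split => y /=;
  by rewrite mul_row_col.
Qed.

End SetMeasure.

(** * Euclidean geometry and compactness *)

Section Euclid.
Variable R : realType.
Implicit Types (m n p : nat).

Lemma dotvE n (x y : 'rV[R]_n) : dotv x y = \sum_i x 0 i * y 0 i.
Proof. by rewrite /dotv mxE; apply: eq_bigr => i _; rewrite mxE. Qed.

Lemma dotvC n (x y : 'rV[R]_n) : dotv x y = dotv y x.
Proof. by rewrite !dotvE; apply: eq_bigr => i _; rewrite mulrC. Qed.

Lemma dotvDl n (x y z : 'rV[R]_n) : dotv (x + y) z = dotv x z + dotv y z.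
Proof. by rewrite /dotv mulmxDl mxE. Qed.

Lemma dotvDr n (x y z : 'rV[R]_n) : dotv x (y + z) = dotv x y + dotv x z.
Proof. by rewrite dotvC dotvDl !(dotvC _ x). Qed.

Lemma dotvZl n a (x y : 'rV[R]_n) : dotv (a *: x) y = a * dotv x y.
Proof. by rewrite /dotv -scalemxAl mxE. Qed.

Lemma dotvZr n a (x y : 'rV[R]_n) : dotv x (a *: y) = a * dotv x y.
Proof. by rewrite dotvC dotvZl dotvC. Qed.

Lemma dotvNl n (x y : 'rV[R]_n) : dotv (- x) y = - dotv x y.
Proof. by rewrite -scaleN1r dotvZl mulN1r. Qed.

Lemma dotvNr n (x y : 'rV[R]_n) : dotv x (- y) = - dotv x y.
Proof. by rewrite dotvC dotvNl dotvC. Qed.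

Lemma dotvBl n (x y z : 'rV[R]_n) : dotv (x - y) z = dotv x z - dotv y z.
Proof. by rewrite dotvDl dotvNl. Qed.

Lemma dotvBr n (x y z : 'rV[R]_n) : dotv x (y - z) = dotv x y - dotv x z.
Proof. by rewrite dotvDr dotvNr. Qed.

Lemma dotv0l n (x : 'rV[R]_n) : dotv 0 x = 0.
Proof. by rewrite /dotv mul0mx mxE. Qed.

Lemma dotv0r n (x : 'rV[R]_n) : dotv x 0 = 0.
Proof. by rewrite dotvC dotv0l. Qed.

Lemma dotv_suml n I (r : seq I) (P : pred I) (f : I -> 'rV[R]_n) (z : 'rV[R]_n) :
  dotv (\sum_(i <- r | P i) f i) z = \sum_(i <- r | P i) dotv (f i) z.
Proof.
elim/big_rec2: _ => [|i y x _ <-]; first exact: dotv0l.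
by rewrite dotvDl.
Qed.

Definition dotvD := (dotvDl, dotvDr, dotvBl, dotvBr, dotvZl, dotvZr, dotvNl, dotvNr).

Lemma dotv_mulmx m n (x : 'rV[R]_m) (A : 'M[R]_(m, n)) (y : 'rV[R]_n) :
  dotv (x *m A) y = dotv x (y *m A^T).
Proof. by rewrite /dotv trmx_mul trmxK mulmxA. Qed.

Lemma mul_trmx_dotv n (x y : 'rV[R]_n) : x *m y^T = (dotv x y)%:M.
Proof. by rewrite [LHS]mx11_scalar. Qed.

Lemma dotv_ge0 n (x : 'rV[R]_n) : 0 <= dotv x x.
Proof. by rewrite dotvE sumr_ge0// => i _; rewrite -expr2 sqr_ge0. Qed.

Lemma dotv_eq0 n (x : 'rV[R]_n) : (dotv x x == 0) = (x == 0).
Proof.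
apply/eqP/eqP => [|->]; last by rewrite dotv0l.
rewrite dotvE => /eqP; rewrite psumr_eq0; last first.
  by move=> i _; rewrite -expr2 sqr_ge0.
move=> /allP h; apply/rowP => i; rewrite mxE.
by have /= := h i (mem_index_enum _); rewrite -expr2 sqrf_eq0 => /eqP.
Qed.

Lemma dotv_gt0 n (x : 'rV[R]_n) : (0 < dotv x x) = (x != 0).
Proof. by rewrite lt_neqAle dotv_ge0 andbT eq_sym dotv_eq0. Qed.

Lemma enorm_ge0 n (x : 'rV[R]_n) : 0 <= enorm x.
Proof. exact: sqrtr_ge0. Qed.

Lemma enorm_sq n (x : 'rV[R]_n) : enorm x ^+ 2 = dotv x x.
Proof. by rewrite /enorm sqr_sqrtr// dotv_ge0. Qed.

Lemma enorm_eq0 n (x : 'rV[R]_n) : (enorm x == 0) = (x == 0).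
Proof. by rewrite -dotv_eq0 -enorm_sq sqrf_eq0. Qed.

Lemma enorm_gt0 n (x : 'rV[R]_n) : (0 < enorm x) = (x != 0).
Proof. by rewrite lt_neqAle enorm_ge0 andbT eq_sym enorm_eq0. Qed.

Lemma enorm0 n : enorm (0 : 'rV[R]_n) = 0.
Proof. by apply/eqP; rewrite enorm_eq0. Qed.

Lemma enormZ n a (x : 'rV[R]_n) : enorm (a *: x) = `|a| * enorm x.
Proof.
by rewrite /enorm dotvZl dotvZr mulrA -expr2 sqrtrM ?sqr_ge0// sqrtr_sqr.
Qed.

Lemma enormN n (x : 'rV[R]_n) : enorm (- x) = enorm x.
Proof. by rewrite -scaleN1r enormZ normrN normr1 mul1r. Qed.

Lemma cauchy_schwarz_sq n (x y : 'rV[R]_n) :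
  dotv x y ^+ 2 <= dotv x x * dotv y y.
Proof.
have [->|y0] := eqVneq y 0; first by rewrite !dotv0r expr2 !mulr0.
have yy : 0 < dotv y y by rewrite dotv_gt0.
have := dotv_ge0 (dotv y y *: x - dotv x y *: y).
rewrite !dotvD (dotvC y x) => h.
rewrite -(ler_pM2l yy).
have -> : dotv y y * (dotv x y ^+ 2) = dotv x y * dotv x y * dotv y y by ring.
nra.
Qed.

Lemma cauchy_schwarz n (x y : 'rV[R]_n) : dotv x y <= enorm x * enorm y.
Proof.
rewrite (le_trans (ler_norm _))// -sqrtr_sqr /enorm -sqrtrM ?dotv_ge0//.
by rewrite ler_wsqrtr// cauchy_schwarz_sq.
Qed.

Lemma ler_enormD n (x y : 'rV[R]_n) : enorm (x + y) <= enorm x + enorm y.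
Proof.
rewrite -(@ler_pXn2r _ 2)//; last 2 first.
- by rewrite nnegrE enorm_ge0.
- by rewrite nnegrE addr_ge0// enorm_ge0.
rewrite enorm_sq sqrrD !enorm_sq !dotvD (dotvC y x).
have := cauchy_schwarz x y; lra.
Qed.

Lemma enorm_ge_norm n (x : 'rV[R]_n) : `|x| <= enorm x.
Proof.
have [->|x0] := eqVneq x 0; first by rewrite normr0 enorm_ge0.
rewrite [leLHS]/Num.norm /= mx_normrE; apply/bigmax_leP; split => /=.
  exact: enorm_ge0.
move=> [i j] _ /=; rewrite ord1 -sqrtr_sqr /enorm ler_wsqrtr// dotvE.
rewrite (bigD1 j)//= -expr2 lerDl sumr_ge0// => k _.
by rewrite -expr2 sqr_ge0.
Qed.

Lemma enorm_le_norm n (x : 'rV[R]_n) : enorm x <= n%:R * `|x|.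
Proof.
have nx : 0 <= n%:R * `|x| by rewrite mulr_ge0.
rewrite -(@ler_pXn2r _ 2)// ?nnegrE ?enorm_ge0// enorm_sq dotvE.
case: n x nx => [|n] x nx; first by rewrite big_ord0 mul0r expr2 mul0r.
apply: (@le_trans _ _ (\sum_(i < n.+1) `|x| ^+ 2)).
  apply: ler_sum => i _; rewrite -expr2.
  rewrite -[x 0 i ^+ 2]ger0_norm ?sqr_ge0// normrX ler_pXn2r// ?nnegrE//.
  exact: le_mx_norm.
rewrite sumr_const card_ord exprMn -(mulr_natl (`|x| ^+ 2)) ler_wpM2r ?sqr_ge0//.
by rewrite -natrX ler_nat -{1}(expn1 n.+1) leq_pexp2l.
Qed.

Section Continuity.
Context {T : Type} {F : set_system T} {FF : Filter F}.

Lemma cvg_sumr k (f : 'I_k -> T -> R) (l : 'I_k -> R) :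
  (forall i, f i t @[t --> F] --> l i) ->
  \sum_i f i t @[t --> F] --> \sum_i l i.
Proof.
elim: k f l => [|k IH] f l fl.
  under eq_fun do rewrite big_ord0.
  by rewrite big_ord0; exact: cvg_cst.
under eq_fun do rewrite big_ord_recl.
rewrite big_ord_recl; apply: cvgD; first exact: fl.
by apply: IH => i; exact: fl.
Qed.

Lemma cvg_mx m n (f : T -> 'M[R]_(m, n)) (M : 'M[R]_(m, n)) :
  (forall i j, f t i j @[t --> F] --> M i j) -> f t @[t --> F] --> M.
Proof.
move=> fM; apply/cvg_ballP => e e0.
have h : \forall t \near F, forall ij : 'I_m * 'I_n, ball (M ij.1 ij.2) e (f t ij.1 ij.2).
  apply: filter_forall => -[i j] /=.
  by have /cvg_ballP/(_ e e0) := fM i j.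
by apply: filterS h => t ht; split => // i j; exact: ht (i, j).
Qed.

Lemma cvg_coord m n (f : T -> 'M[R]_(m, n)) (M : 'M[R]_(m, n)) i j :
  f t @[t --> F] --> M -> f t i j @[t --> F] --> M i j.
Proof.
by move=> fM; apply: (@cvg_comp _ _ _ f (fun N : 'M[R]_(m, n) => N i j) _ _ _ fM);
  exact: coord_continuous.
Qed.

Lemma cvg_mulmx m n p (f : T -> 'M[R]_(m, n)) (g : T -> 'M[R]_(n, p))
    (M : 'M[R]_(m, n)) (N : 'M[R]_(n, p)) :
  f t @[t --> F] --> M -> g t @[t --> F] --> N ->
  f t *m g t @[t --> F] --> M *m N.
Proof.
move=> fM gN; apply: cvg_mx => i j; under eq_fun do rewrite mxE.
by rewrite mxE; apply: cvg_sumr => k; apply: cvgM; exact: cvg_coord.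
Qed.

Lemma cvg_dotv n (f g : T -> 'rV[R]_n) (x y : 'rV[R]_n) :
  f t @[t --> F] --> x -> g t @[t --> F] --> y ->
  dotv (f t) (g t) @[t --> F] --> dotv x y.
Proof.
move=> fx gy; under eq_fun do rewrite dotvE.
by rewrite dotvE; apply: cvg_sumr => k; apply: cvgM; exact: cvg_coord.
Qed.

Lemma cvg_row_mx m n p (f : T -> 'M[R]_(m, n)) (g : T -> 'M[R]_(m, p))
    (M : 'M[R]_(m, n)) (N : 'M[R]_(m, p)) :
  f t @[t --> F] --> M -> g t @[t --> F] --> N ->
  row_mx (f t) (g t) @[t --> F] --> row_mx M N.
Proof.
move=> fM gN; apply: cvg_mx => i j; under eq_fun do rewrite mxE.
by rewrite mxE; case: (fintype.split j) => k; exact: cvg_coord.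
Qed.

Lemma cvg_lsubmx m n p (f : T -> 'M[R]_(m, n + p))
    (M : 'M[R]_(m, n + p)) :
  f t @[t --> F] --> M -> lsubmx (f t) @[t --> F] --> lsubmx M.
Proof.
move=> fM; apply: cvg_mx => i j; under eq_fun do rewrite mxE.
by rewrite mxE; exact: cvg_coord.
Qed.

Lemma cvg_rsubmx m n p (f : T -> 'M[R]_(m, n + p))
    (M : 'M[R]_(m, n + p)) :
  f t @[t --> F] --> M -> rsubmx (f t) @[t --> F] --> rsubmx M.
Proof.
move=> fM; apply: cvg_mx => i j; under eq_fun do rewrite mxE.
by rewrite mxE; exact: cvg_coord.
Qed.

End Continuity.

Section ContinuousMaps.
Variable T : topologicalType.

Lemma cont_id : continuous (fun x : T => x).
Proof. by move=> x A. Qed.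

Lemma cont_mulmx m n p (f : T -> 'M[R]_(m, n)) (g : T -> 'M[R]_(n, p)) :
  continuous f -> continuous g -> continuous (fun t => f t *m g t).
Proof. by move=> cf cg x; exact: (@cvg_mulmx _ (nbhs x) _ _ _ _ _ _ _ _ (cf x) (cg x)). Qed.

Lemma cont_mulmxr m n p (f : T -> 'M[R]_(m, n)) (A : 'M[R]_(n, p)) :
  continuous f -> continuous (fun t => f t *m A).
Proof. by move=> cf; apply: cont_mulmx => //; exact: cst_continuous. Qed.

Lemma cont_dotv n (f g : T -> 'rV[R]_n) :
  continuous f -> continuous g -> continuous (fun t => dotv (f t) (g t)).
Proof. by move=> cf cg x; exact: (@cvg_dotv _ (nbhs x) _ _ _ _ _ _ (cf x) (cg x)). Qed.

Lemma cont_row_mx m n p (f : T -> 'M[R]_(m, n)) (g : T -> 'M[R]_(m, p)) :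
  continuous f -> continuous g -> continuous (fun t => row_mx (f t) (g t)).
Proof. by move=> cf cg x; exact: (@cvg_row_mx _ (nbhs x) _ _ _ _ _ _ _ _ (cf x) (cg x)). Qed.

Lemma cont_lsubmx m n p (f : T -> 'M[R]_(m, n + p)) :
  continuous f -> continuous (fun t => lsubmx (f t)).
Proof. by move=> cf x; exact: (@cvg_lsubmx _ (nbhs x) _ _ _ _ _ _ (cf x)). Qed.

Lemma cont_rsubmx m n p (f : T -> 'M[R]_(m, n + p)) :
  continuous f -> continuous (fun t => rsubmx (f t)).
Proof. by move=> cf x; exact: (@cvg_rsubmx _ (nbhs x) _ _ _ _ _ _ (cf x)). Qed.

Lemma cont_coord m n (f : T -> 'M[R]_(m, n)) i j :
  continuous f -> continuous (fun t => f t i j).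
Proof. by move=> cf x; exact: (@cvg_coord _ (nbhs x) _ _ _ _ i j (cf x)). Qed.

Lemma cont_add m n (f g : T -> 'M[R]_(m, n)) :
  continuous f -> continuous g -> continuous (fun t => f t + g t).
Proof. by move=> cf cg x; apply: cvgD; [exact: cf|exact: cg]. Qed.

Lemma cont_sub m n (f g : T -> 'M[R]_(m, n)) :
  continuous f -> continuous g -> continuous (fun t => f t - g t).
Proof. by move=> cf cg x; apply: cvgB; [exact: cf|exact: cg]. Qed.

Lemma cont_scale m n (a : T -> R) (f : T -> 'M[R]_(m, n)) :
  continuous a -> continuous f -> continuous (fun t => a t *: f t).
Proof. by move=> ca cf x; apply: cvgZ; [exact: ca|exact: cf]. Qed.

Lemma cont_enorm n (f : T -> 'rV[R]_n) :
  continuous f -> continuous (fun t => enorm (f t)).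
Proof.
move=> cf x; apply: (@continuous_comp _ _ _ (fun t => dotv (f t) (f t)) Num.sqrt).
  exact: (cont_dotv cf cf).
exact: sqrt_continuous.
Qed.

End ContinuousMaps.

Lemma continuous_dotvl n (u : 'rV[R]_n) : continuous (fun x => dotv x u).
Proof. by apply: cont_dotv; [exact: cont_id|exact: cst_continuous]. Qed.

Lemma continuous_mulmxr m n p (A : 'M[R]_(n, p)) :
  continuous (fun x : 'M[R]_(m, n) => x *m A).
Proof. by apply: cont_mulmxr; exact: cont_id. Qed.

Lemma closed_preim (T U : topologicalType) (f : T -> U) (A : set U) :
  continuous f -> closed A -> closed [set x | A (f x)].
Proof. by move=> cf cA; move/continuous_closedP: cf => /(_ _ cA). Qed.

Lemma closed_leR (T : topologicalType) (f g : T -> R) :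
  continuous f -> continuous g -> closed [set x | f x <= g x].
Proof.
move=> cf cg.
rewrite (_ : mkset _ = [set x | [set y : R | 0 <= y] (g x - f x)]).
  apply: closed_preim; last exact: closed_ge.
  by move=> x; apply: cvgB; [exact: cg|exact: cf].
by apply/seteqP; split => x /=; rewrite subr_ge0.
Qed.

Lemma closed_forall (T : topologicalType) I (D : set I) (A : I -> set T) :
  (forall i, D i -> closed (A i)) -> closed [set x | forall i, D i -> A i x].
Proof.
move=> cA; rewrite (_ : mkset _ = \bigcap_(i in D) A i)//.
exact: closed_bigI.
Qed.

(** Projection along a compact factor preserves closedness. Most sets below are given by an
    existential over a body or a ball, and this is how they become measurable. *)
Lemma closed_exists_compact n (T : topologicalType) (K : set 'rV[R]_n)
    (C : set ('rV[R]_n * T)) : compact K -> closed C ->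
  closed [set y | exists2 x, K x & C (x, y)].
Proof.
move=> cK cC; rewrite -openC openE => y0 /= ny0.
have /compact_near_coveringP/(_ T (nbhs y0) (fun y x => ~ C (x, y))) := cK.
case/(_ _ _)/wrap.
  move=> x Kx; have nC : ~ C (x, y0) by move=> Cxy; apply: ny0; exists x.
  have /open_nbhs_nbhs : open_nbhs (x, y0) (~` C).
    by split => //; exact: closed_openC.
  by move=> [[A B] [nA nB] AB]; exists (A, B) => // -[a b] Aab; exact: AB.
by apply: filterS => y h [x Kx Cxy]; exact: h Kx Cxy.
Qed.

Lemma compact_argmax n (K : set 'rV[R]_n) (f : 'rV[R]_n -> R) :
  compact K -> K !=set0 -> continuous f ->
  exists2 x, K x & forall y, K y -> f y <= f x.
Proof.
move=> cK K0 cf.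
have [x /set_mem Kx xmax] := @EVT_max_rV R n f K K0 cK (continuous_subspaceT cf).
by exists x => // y Ky; apply: xmax; exact: mem_set.
Qed.

Lemma closed_bounded_compact n (K C : set 'rV[R]_n) :
  compact K -> closed C -> C `<=` K -> compact C.
Proof. by move=> cK cC CK; exact: subclosed_compact cC cK CK. Qed.

Lemma compact_img n p (K : set 'rV[R]_n) (f : 'rV[R]_n -> 'rV[R]_p) :
  compact K -> continuous f -> compact [set y | exists2 x, K x & y = f x].
Proof.
move=> cK cf; rewrite (_ : mkset _ = f @` K).
  by apply: continuous_compact => //; exact: continuous_subspaceT.
by apply/seteqP; split => y [x Kx]; [move=> ->|move=> <-]; exists x.
Qed.

(** The support set, the same set as [G] in [has_face_parallel]; for [u = 0] it is all of [K]. *)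
Definition face n (K : set 'rV[R]_n) (u : 'rV[R]_n) : set 'rV[R]_n :=
  [set x | K x /\ forall y, K y -> dotv y u <= dotv x u].

Lemma compact_face n (K : set 'rV[R]_n) u : compact K -> compact (face K u).
Proof.
move=> cK.
have clK : closed K by apply: compact_closed => //; exact: (@norm_hausdorff R 'rV[R]_n).
apply: (closed_bounded_compact cK); last by move=> x [].
apply: closedI => //; apply: closed_forall => y Ky.
apply: (@closed_leR _ (fun=> dotv y u) (fun x => dotv x u)).
  exact: cst_continuous.
exact: continuous_dotvl.
Qed.

Lemma face_nonempty n (K : set 'rV[R]_n) u :
  compact K -> K !=set0 -> face K u !=set0.
Proof.
move=> cK K0; have [x Kx xm] := compact_argmax cK K0 (@continuous_dotvl n u).
by exists x.
Qed.

Lemma convex_face n (K : set 'rV[R]_n) u : convex_set K -> convex_set (face K u).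
Proof.
move=> cK x y t [Kx xm] [Ky ym] t01; split; first exact: cK.
move=> z Kz; rewrite dotvDl !dotvZl.
have := xm _ Kz; have := ym _ Kz; case/andP: t01 => t0 t1; nra.
Qed.

Lemma faceZ n (K : set 'rV[R]_n) u (a : R) : 0 < a -> face K (a *: u) = face K u.
Proof.
move=> a0; apply/seteqP; split => x [Kx xm]; split => // y Ky; have := xm y Ky;
  by rewrite !dotvZr ler_pM2l.
Qed.

Definition supp n (K : set 'rV[R]_n) (c : 'rV[R]_n) : R := sup [set dotv x c | x in K].

Lemma suppE n (K : set 'rV[R]_n) c x : face K c x -> supp K c = dotv x c.
Proof.
move=> [Kx xm]; apply/eqP; rewrite eq_le; apply/andP; split.
  by apply: ge_sup; [exists (dotv x c), x|move=> _ [y Ky <-]; exact: xm].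
apply: ub_le_sup; last by exists x.
by exists (dotv x c) => _ [y Ky <-]; exact: xm.
Qed.

Lemma supp_ge n (K : set 'rV[R]_n) c x : compact K -> K x -> dotv x c <= supp K c.
Proof.
move=> cK Kx; have [y fy] : face K c !=set0 by apply: face_nonempty => //; exists x.
by rewrite (suppE fy); case: fy => _; exact.
Qed.

Lemma supp_att n (K : set 'rV[R]_n) c : compact K -> K !=set0 ->
  exists2 x, K x & supp K c = dotv x c.
Proof.
move=> cK K0; have [x fx] := face_nonempty c cK K0.
by exists x; [case: fx|exact: suppE].
Qed.

(** Not divided by the length of [c]: this homogeneity lets unnormalised rotated vectors be used,
    see [mu_img_scale]. *)
Definition width n (K : set 'rV[R]_n) (c : 'rV[R]_n) : R := supp K c + supp K (- c).

Lemma leb_width n (K : set 'rV[R]_n) c : compact K -> convex_set K -> K !=set0 ->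
  @lebesgue_measure R [set a | exists2 x, K x & a = dotv x c] = (width K c)%:E.
Proof.
move=> cK vK K0.
have [x Kx xE] := supp_att c cK K0; have [y Ky yE] := supp_att (- c) cK K0.
have yx : dotv y c <= dotv x c by rewrite -xE; exact: supp_ge.
rewrite (_ : mkset _ = `[dotv y c, dotv x c]%classic).
  rewrite lebesgue_measure_itv/= lte_fin /width xE yE dotvNr.
  by case: ltP => h; rewrite -?EFinD//; congr EFin; lra.
apply/seteqP; split => [_ [z Kz ->]|a] /=; rewrite in_itv/=.
  rewrite -xE (supp_ge _ cK)// andbT.
  by have := supp_ge (- c) cK Kz; rewrite yE !dotvNr lerN2.
move=> /andP[ya ax]; have [e|ne] := eqVneq (dotv y c) (dotv x c).
  by exists x => //; lra.
have d0 : 0 < dotv x c - dotv y c by rewrite subr_gt0 lt_neqAle ne.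
pose t := (a - dotv y c) / (dotv x c - dotv y c).
exists (t *: x + (1 - t) *: y).
  apply: vK => //; apply/andP; split; first by rewrite divr_ge0 ?subr_ge0// ltW.
  by rewrite ler_pdivrMr// mul1r lerD2r.
by rewrite !dotvD /t; field; rewrite gt_eqF.
Qed.

Lemma mulmx_eq0_perp m n (x : 'rV[R]_n) (A : 'M[R]_(m, n)) :
  (x *m A^T == 0) = [forall i, dotv x (row i A) == 0].
Proof.
apply/eqP/forallP => [h i|h].
  have /rowP/(_ i) := h; rewrite !mxE => hi; rewrite dotvE -[X in _ == X]hi.
  by apply/eqP; apply: eq_bigr => k _; rewrite !mxE.
apply/rowP => i; rewrite !mxE; have /eqP hi := h i; rewrite -[RHS]hi dotvE.
by apply: eq_bigr => k _; rewrite !mxE.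
Qed.

Lemma orthonormal_rank m n (W : 'M[R]_(m, n)) : W *m W^T = 1%:M -> \rank W = m.
Proof.
move=> WW; apply/eqP; rewrite eqn_leq rank_leq_row /=.
by rewrite -{1}(@mxrank1 R m) -WW mxrankM_maxl.
Qed.

(** Gram-Schmidt by induction on the rank: normalise a nonzero row and continue in its orthogonal
    complement inside the row space. *)
Lemma ex_orthonormal r k n (A : 'M[R]_(k, n)) : \rank A = r ->
  exists W : 'M[R]_(r, n), W *m W^T = 1%:M /\ (W == A)%MS.
Proof.
elim: r k A => [|r IH] k A rA.
  exists 0; split; first by apply/matrixP => -[].
  by move/eqP: rA; rewrite mxrank_eq0 => /eqP ->; rewrite !sub0mx.
have [i Ai] : exists i, row i A != 0.
  apply/existsP; rewrite -negb_forall; apply/negP => /forallP h.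
  suff A0 : A = 0 by move: rA; rewrite A0 mxrank0.
  by apply/row_matrixP => i; rewrite row0; apply/eqP/h.
pose a := row i A; pose w := (enorm a)^-1 *: a.
have a0 : enorm a != 0 by rewrite enorm_eq0.
have ww : dotv w w = 1.
  by rewrite /w dotvZl dotvZr -enorm_sq; field.
have wA : (w <= A)%MS by rewrite /w scalemx_sub// row_sub.
pose B := (A :&: kermx w^T)%MS.
have rB : \rank B = r.
  have := mxrank_mul_ker A w^T; rewrite rA.
  have -> : \rank (A *m w^T) = 1%N.
    apply/eqP; rewrite eqn_leq rank_leq_col /= lt0n mxrank_eq0.
    apply: contraTneq wA => Aw0; apply/negP => /submxP[D wE].
    have : w *m w^T = 0 by rewrite {1}wE -mulmxA Aw0 mulmx0.
    by rewrite mul_trmx_dotv ww => /matrixP/(_ 0 0)/eqP; rewrite !mxE oner_eq0.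
  by rewrite add1n => -[].
have [W [WW WB]] := IH _ B rB.
have Ww : W *m w^T = 0.
  apply/sub_kermxP; rewrite (eqmxP WB); exact: capmxSr.
have wW : w *m W^T = 0 by apply: (can_inj trmxK); rewrite trmx_mul trmxK Ww trmx0.
have C1 : col_mx w W *m (col_mx w W)^T = 1%:M.
  by rewrite tr_col_mx mul_col_row WW Ww wW mul_trmx_dotv ww -(@scalar_mx_block _ 1 r).
exists (col_mx w W); split => //.
have sub : (col_mx w W <= A)%MS.
  by rewrite col_mx_sub wA (eqmxP WB); exact: capmxSl.
by rewrite sub /= -(geq_leqif (mxrank_leqif_sup sub)) rA (orthonormal_rank C1).
Qed.

Lemma ex_frame m j n (W : 'M[R]_(m, n)) : n = (m + j)%N -> W *m W^T = 1%:M ->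
  exists U : 'M[R]_(j, n), frame W U.
Proof.
move=> nE WW.
have rk : \rank (kermx W^T) = j.
  by rewrite mxrank_ker mxrank_tr (orthonormal_rank WW) nE addKn.
have [U [UU UK]] := ex_orthonormal rk.
exists U; apply: frameC; split => //.
by apply/sub_kermxP; rewrite (eqmxP UK).
Qed.

End Euclid.

(** * Volumes of projections and their second differences *)

Section Kink.
Variable R : realType.
Local Notation leb := (@lebesgue_measure R).
Local Notation Rm := (measurableTypeR R).
Local Notation mu := (mu R).
Implicit Types (m n k : nat).

Lemma supp_mid n (X : set 'rV[R]_n) u v : compact X -> X !=set0 ->
  2 * supp X u <= supp X (u + v) + supp X (u - v).
Proof.
move=> cX X0; have [x Xx ->] := supp_att u cX X0.
have := supp_ge (u + v) cX Xx; have := supp_ge (u - v) cX Xx.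
rewrite !dotvD; lra.
Qed.

Lemma supp_lip n (X : set 'rV[R]_n) u v (s B : R) : compact X -> X !=set0 ->
  (forall x, X x -> `|dotv x v| <= B) ->
  `|supp X (u + s *: v) - supp X u| <= `|s| * B.
Proof.
move=> cX X0 XB.
have [x Xx xE] := supp_att u cX X0.
have [y Xy yE] := supp_att (u + s *: v) cX X0.
have xy := supp_ge (u + s *: v) cX Xx; have yx := supp_ge u cX Xy.
have bx : `|s * dotv x v| <= `|s| * B by rewrite normrM ler_wpM2l// XB.
have bY : `|s * dotv y v| <= `|s| * B by rewrite normrM ler_wpM2l// XB.
move: xy yx bx bY; rewrite yE xE !dotvD !ler_norml.
by move=> ? ? /andP[? ?] /andP[? ?]; apply/andP; split; lra.
Qed.

Lemma cvg_invS : k.+1%:R^-1 @[k --> \oo] --> (0 : R).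
Proof. exact: cvg_harmonic. Qed.

Lemma near_invS_lt (e : R) : 0 < e -> \forall k \near \oo, k.+1%:R^-1 < e.
Proof.
move=> e0; have /cvgrPdist_lt/(_ _ e0) := cvg_invS.
apply: filterS => k; rewrite sub0r normrN ger0_norm// invr_ge0//.
Qed.

Lemma dotv_bounded n (X : set 'rV[R]_n) v : compact X ->
  exists2 B : R, 0 < B & forall x, X x -> `|dotv x v| <= B.
Proof.
move=> cX; have [M [M0 XM]] := compact_norm_le cX.
exists (n%:R * M * enorm v + 1).
  by rewrite ltr_wpDl// mulr_ge0 ?enorm_ge0// mulr_ge0// ltW.
move=> x Xx.
have h y : enorm y = enorm x -> dotv y v <= n%:R * M * enorm v + 1.
  move=> yx; rewrite (le_trans (cauchy_schwarz _ _))// yx ler_wpDr//.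
  rewrite ler_wpM2r ?enorm_ge0// (le_trans (enorm_le_norm _))//.
  by rewrite ler_wpM2l// XM.
by rewrite ler_norml lerNl -dotvNl !h// enormN.
Qed.

(** The directional derivative of a support function is the support function of the face: maximisers
    for the perturbed direction approach the face. The lower bound comes from testing with a point
    of the face. *)
Lemma supp_deriv n (X : set 'rV[R]_n) u v : compact X -> X !=set0 ->
  (supp X (u + k.+1%:R^-1 *: v) - supp X u) / k.+1%:R^-1 @[k --> \oo]
   --> supp (face X u) v.
Proof.
move=> cX X0; set l := supp (face X u) v.
have cF := compact_face (u := u) cX; have F0 := face_nonempty u cX X0.
have [B B0 XB] := dotv_bounded v cX.
have [y Fy yE] := supp_att v cF F0.
have yu : supp X u = dotv y u by exact: suppE.
apply/cvgrPdist_le => e e0.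
(* Compactness makes the bound uniform: near a point of the face continuity suffices, and near any
   other point there are no maximisers for large [k]. *)
have key : \forall k \near \oo, X `<=` [set x |
    face X (u + k.+1%:R^-1 *: v) x -> dotv x v <= l + e].
  have /compact_near_coveringP/(_ nat \oo (fun k x =>
    face X (u + k.+1%:R^-1 *: v) x -> dotv x v <= l + e)) := cX.
  apply => x Xx.
  have [xu|xu] := eqVneq (dotv x u) (supp X u).
    have Fx : face X u x by split => // z Xz; rewrite xu; exact: supp_ge.
    have xv : dotv x v < l + e.
      by rewrite (le_lt_trans (supp_ge v cF Fx))// ltrDl.
    have : \forall x' \near x, dotv x' v < l + e.
      exact: (cvgr_lt _ (@continuous_dotvl R n v x)).
    move=> h; exists ([set x' | dotv x' v < l + e], setT) => /=.
      by split => //; exact: filterT.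
    by move=> [a k] [/= /ltW].
  have dlt : 0 < (supp X u - dotv x u) / 2.
    by rewrite divr_gt0// subr_gt0 lt_neqAle xu supp_ge.
  set dl := (supp X u - dotv x u) / 2 in dlt.
  have h1 : \forall x' \near x, dotv x' u < supp X u - dl.
    apply: (cvgr_lt _ (@continuous_dotvl R n u x)); move: dlt; rewrite /dl; lra.
  (* A point at least [dl] below the maximum for [u] gains at most [2 B s] over [y] from the
     perturbation [s v], so it is no maximiser once [2 B s < dl]. *)
  have h2 : \forall k \near \oo, (k.+1%:R^-1 : R) < dl / (2 * B).
    by apply: near_invS_lt; rewrite divr_gt0// mulr_gt0.
  exists ([set x' | dotv x' u < supp X u - dl],
          [set k : nat | (k.+1%:R^-1 : R) < dl / (2 * B)]) => //=.
  move=> [a k] [/= ha hk] [Xa am]; exfalso.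
  have [Xy _] := Fy; have := am y Xy; rewrite !dotvD -yu.
  have s0 : 0 < k.+1%:R^-1 :> R by rewrite invr_gt0.
  have := XB _ Xy; have := XB _ Xa; rewrite !ler_norml => /andP[a1 a2] /andP[y1 y2].
  move: hk; rewrite ltr_pdivlMr ?mulr_gt0// => hk.
  move: s0 hk; set s := k.+1%:R^-1; move=> s0 hk.
  nra.
near=> k.
have s0 : 0 < k.+1%:R^-1 :> R by rewrite invr_gt0.
set s := k.+1%:R^-1 in s0 *.
have [x Fx] := face_nonempty (u + s *: v) cX X0.
have Xx : X x by case: Fx.
have xv : dotv x v <= l + e.
  by have : X `<=` [set x | face X (u + k.+1%:R^-1 *: v) x -> dotv x v <= l + e];
    [near: k | move=> /(_ x Xx Fx)].
have sE := suppE Fx; have xu := supp_ge u cX Xx.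
have Xy : X y by case: Fy.
have yc := supp_ge (u + s *: v) cX Xy.
rewrite distrC ger0_norm.
  rewrite lerBlDl ler_pdivrMr// sE !dotvD; nra.
rewrite subr_ge0 ler_pdivlMr// /l yE yu.
move: yc; rewrite !dotvD; lra.
Unshelve. all: by end_near. Qed.

(** When [A] has orthonormal rows: the orthogonal projection onto its row space, in coordinates. *)
Definition img k n (P : set 'rV[R]_n) (A : 'M[R]_(k, n)) : set 'rV[R]_k :=
  [set y | exists2 x, P x & y = x *m A^T].

Lemma compact_imgmx k n (P : set 'rV[R]_n) (A : 'M[R]_(k, n)) :
  compact P -> compact (img P A).
Proof. by move=> cP; apply: compact_img => //; exact: continuous_mulmxr. Qed.

Definition fib k n (P : set 'rV[R]_n) (e : 'M[R]_(k, n)) (z : 'rV[R]_k) :=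
  [set x | P x /\ x *m e^T = z].

Lemma compact_fib k n (P : set 'rV[R]_n) (e : 'M[R]_(k, n)) z :
  compact P -> compact (fib P e z).
Proof.
move=> cP; have clP : closed P.
  by apply: compact_closed => //; exact: (@norm_hausdorff R 'rV[R]_n).
apply: (closed_bounded_compact cP); last by move=> x [].
apply: closedI => //.
apply: (@closed_preim _ _ (fun x : 'rV[R]_n => x *m e^T) [set z]).
  exact: continuous_mulmxr.
apply: accessible_closed_set1; apply: hausdorff_accessible.
exact: (@norm_hausdorff R 'rV[R]_k).
Qed.

Lemma convex_fib k n (P : set 'rV[R]_n) (e : 'M[R]_(k, n)) z :
  convex_set P -> convex_set (fib P e z).
Proof.
move=> vP x y t [Px xz] [Py yz] t01; split; first exact: vP.
by rewrite mulmxDl -!scalemxAl xz yz -scalerDl addrC subrK scale1r.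
Qed.

Lemma mul_col_tr k n (x c : 'rV[R]_n) (e : 'M[R]_(k, n)) :
  x *m (col_mx c e)^T = consr (dotv x c, x *m e^T).
Proof.
rewrite tr_col_mx mul_mx_row /consr /=; congr (@row_mx _ 1 1 k _ _).
by apply/rowP => i; rewrite !ord1 [RHS]mxE.
Qed.

Lemma consr_inj2 k (a b : Rm) (z w : 'rV[R]_k) :
  consr (a, z) = consr (b, w) -> a = b /\ z = w.
Proof.
move=> E; split; first by rewrite -(consr0 a z) E consr0.
by rewrite -(rsub_consr a z) E rsub_consr.
Qed.

Lemma img_slice k n (P : set 'rV[R]_n) (c : 'rV[R]_n) (e : 'M[R]_(k, n)) (z : 'rV[R]_k) :
  [set a : Rm | img P (col_mx c e) (consr (a, z))] =
  [set a | exists2 x, fib P e z x & a = dotv x c].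
Proof.
apply/seteqP; split => a /= [x].
  by move=> Px; rewrite mul_col_tr => /consr_inj2[-> ->]; exists x.
by move=> [Px xz] ->; exists x => //; rewrite mul_col_tr xz.
Qed.

(** Off the projection the fiber is empty, and 0 is the measure of the empty slice in
    [leb_img_slice]. *)
Definition fibwidth k n (P : set 'rV[R]_n) (e : 'M[R]_(k, n))
    (c : 'rV[R]_n) (z : 'rV[R]_k) : R :=
  if z \in img P e then width (fib P e z) c else 0.

Lemma fib_nonempty k n (P : set 'rV[R]_n) (e : 'M[R]_(k, n)) z :
  img P e z -> fib P e z !=set0.
Proof. by move=> [x Px ->]; exists x. Qed.

Section Body.
Variables (k n : nat) (P : set 'rV[R]_n) (e : 'M[R]_(k, n)).
Hypotheses (cP : compact P) (vP : convex_set P).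
Implicit Types (c u v : 'rV[R]_n) (z : 'rV[R]_k).

Lemma leb_img_slice c z :
  leb [set a : Rm | img P (col_mx c e) (consr (a, z))] = (fibwidth P e c z)%:E.
Proof.
rewrite img_slice /fibwidth; case: ifPn => [/set_mem zP|/negP zP].
  rewrite leb_width//; [exact: compact_fib|exact: convex_fib|exact: fib_nonempty].
rewrite (_ : mkset _ = set0) ?measure0//; apply/seteqP; split => // a [x [Px xz] _].
by apply: zP; apply/mem_set; exists x.
Qed.

Lemma measurable_img m (A : 'M[R]_(m, n)) : measurable (img P A).
Proof. by apply: compact_measurable_mx; exact: compact_imgmx. Qed.

Lemma measurable_fibwidth c :
  measurable_fun setT (fun z => (fibwidth P e c z)%:E).
Proof.
rewrite (_ : (fun z => _) =
  fun z => leb [set a : Rm | img P (col_mx c e) (consr (a, z))]).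
  by apply: measurable_leb_slice; exact: measurable_img.
by apply/funext => z; rewrite leb_img_slice.
Qed.

Lemma fibwidth_ge0 c z : 0 <= fibwidth P e c z.
Proof. by rewrite -lee_fin -leb_img_slice. Qed.

Lemma mu_img c : mu k.+1 (img P (col_mx c e)) =
  (\int[mu k]_z (fibwidth P e c z)%:E)%E.
Proof.
rewrite mu_cons; last exact: measurable_img.
by apply: eq_integral => z _; rewrite leb_img_slice.
Qed.

Lemma mu_img_fin m (A : 'M[R]_(m, n)) : mu m (img P A) \is a fin_num.
Proof. by rewrite ge0_fin_numE//; apply: mu_compact; exact: compact_imgmx. Qed.

(** Nonnegative because a width is convex in its direction; its integral is the second difference of
    the projected volumes ([integral_fibdiff]). *)
Definition fibdiff u v (s : R) z : R :=
  fibwidth P e (u + s *: v) z + fibwidth P e (u - s *: v) z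
    - 2 * fibwidth P e u z.

Lemma fibdiff_ge0 u v s z : 0 <= fibdiff u v s z.
Proof.
rewrite /fibdiff /fibwidth; case: ifPn => [/set_mem zP|_]; last by rewrite mulr0 !addr0 subr0.
have cz := compact_fib (e := e) (z := z) cP; have z0 := fib_nonempty zP.
have := supp_mid u (s *: v) cz z0; have := supp_mid (- u) (s *: v) cz z0.
rewrite /width !opprD opprK; lra.
Qed.

Lemma measurable_fibdiff u v s : measurable_fun setT (fun z => (fibdiff u v s z)%:E).
Proof.
have mw c : measurable_fun setT (fibwidth P e c).
  by apply/measurable_EFinP; exact: measurable_fibwidth.
apply/measurable_EFinP; apply: measurable_funB; first exact: measurable_funD.
by apply: measurable_funM => //.
Qed.

Lemma integral_fibdiff u v s :
  (\int[mu k]_z (fibdiff u v s z)%:E =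
   (fine (mu k.+1 (img P (col_mx (u + s *: v) e))) +
    fine (mu k.+1 (img P (col_mx (u - s *: v) e))) -
    2 * fine (mu k.+1 (img P (col_mx u e))))%:E)%E.
Proof.
rewrite EFinB EFinD EFinM !fineK ?mu_img_fin//.
have F0 : (2%:E * mu k.+1 (img P (col_mx u e)) \is a fin_num)%E.
  by rewrite fin_numM ?mu_img_fin.
(* The subtracted volume is moved to the other side, so that only integrals of nonnegative functions
   are added. *)
rewrite -(addeK (\int[mu k]_z (fibdiff u v s z)%:E)%E F0); congr (_ - _)%E.
rewrite !mu_img -ge0_integralZl//; last 2 first.
- exact: measurable_fibwidth.
- by move=> z _; rewrite lee_fin fibwidth_ge0.
rewrite -!ge0_integralD//; do ?[exact: measurable_fibwidth|exact: measurable_fibdiff].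
- by apply: eq_integral => z _; rewrite -EFinM -!EFinD /fibdiff subrK.
- by move=> z _; rewrite lee_fin fibwidth_ge0.
- by move=> z _; rewrite lee_fin fibwidth_ge0.
- by move=> z _; rewrite lee_fin fibdiff_ge0.
- by move=> z _; rewrite -EFinM lee_fin mulr_ge0// fibwidth_ge0.
- by apply/measurable_EFinP; apply: measurable_funM => //;
    apply/measurable_EFinP; exact: measurable_fibwidth.
Qed.

(** Shadows, in the coordinates [v] and [e], of the points of [P] that are highest in direction [u]
    within their fiber over [e]. Its volume is the jump computed in [kink]. *)
Definition lineset u v : set 'rV[R]_k.+1 :=
  [set y | exists2 x, P x /\ y = x *m (col_mx v e)^T &
    forall x', P x' -> x' *m e^T = x *m e^T -> dotv x' u <= dotv x u].

Lemma lineset_slice u v z : [set a : Rm | lineset u v (consr (a, z))] =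
  [set a | exists2 x, face (fib P e z) u x & a = dotv x v].
Proof.
apply/seteqP; split => a /= [x].
  move=> [Px]; rewrite mul_col_tr => /consr_inj2[-> zE] xm; exists x => //.
  by split => [//|x' [Px' x'z]]; apply: xm; rewrite // x'z zE.
move=> [[Px xz] xm] ->; exists x; first by split => //; rewrite mul_col_tr xz.
by move=> x' Px' x'x; apply: xm; split => //; rewrite x'x.
Qed.

Definition facewidth u v z : R :=
  if z \in img P e then width (face (fib P e z) u) v else 0.

Lemma leb_lineset u v z :
  leb [set a : Rm | lineset u v (consr (a, z))] = (facewidth u v z)%:E.
Proof.
rewrite lineset_slice /facewidth; case: ifPn => [/set_mem zP|/negP zP].
  rewrite leb_width//.
  - exact/compact_face/compact_fib.
  - exact/convex_face/convex_fib.
  - by apply: face_nonempty; [exact: compact_fib|exact: fib_nonempty].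
rewrite (_ : mkset _ = set0) ?measure0//.
apply/seteqP; split => // a [x [[Px xz] _] _].
by apply: zP; apply/mem_set; exists x.
Qed.

Lemma mu_lineset u v : measurable (lineset u v) ->
  mu k.+1 (lineset u v) = (\int[mu k]_z (facewidth u v z)%:E)%E.
Proof.
move=> mL; rewrite mu_cons//.
by apply: eq_integral => z _; rewrite leb_lineset.
Qed.

Lemma measurable_facewidth u v : measurable (lineset u v) ->
  measurable_fun setT (fun z => (facewidth u v z)%:E).
Proof.
move=> mL; rewrite (_ : (fun z => _) =
  fun z => leb [set a : Rm | lineset u v (consr (a, z))]).
  exact: measurable_leb_slice.
by apply/funext => z; rewrite leb_lineset.
Qed.

Lemma lineset_sub u v : lineset u v `<=` img P (col_mx v e).
Proof. by move=> y [x [Px ->] _]; exists x. Qed.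

Lemma mu_lineset_fin u v : measurable (lineset u v) ->
  mu k.+1 (lineset u v) \is a fin_num.
Proof.
move=> mL; rewrite ge0_fin_numE//.
apply: (@le_lt_trans _ _ (mu k.+1 (img P (col_mx v e)))); last first.
  by apply: mu_compact; exact: compact_imgmx.
by apply: le_measure; rewrite ?inE//; [exact: measurable_img|exact: lineset_sub].
Qed.

Lemma facewidth_ge0 u v z : 0 <= facewidth u v z.
Proof. by rewrite -lee_fin -leb_lineset. Qed.

(** A width is a sum of two support functions, so four directional derivatives occur, in the
    directions [v] and [-v] at [u] and at [-u]; those at the same point add up to the width of a
    face. *)
Lemma cvg_fibdiff u v z :
  fibdiff u v l.+1%:R^-1 z / l.+1%:R^-1 @[l --> \oo] -->
  facewidth u v z + facewidth (- u) v z.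
Proof.
rewrite /fibdiff /fibwidth /facewidth; case: ifPn => [/set_mem zP|_]; last first.
  rewrite addr0; under eq_fun do rewrite mulr0 subr0 mul0r.
  exact: cvg_cst.
have cz := compact_fib (e := e) (z := z) cP; have z0 := fib_nonempty zP.
pose X := fib P e z.
pose D a b (l : nat) := (supp X (a + l.+1%:R^-1 *: b) - supp X a) / (l.+1%:R^-1 : R).
have E l : (width X (u + l.+1%:R^-1 *: v) + width X (u - l.+1%:R^-1 *: v) -
    2 * width X u) / (l.+1%:R^-1 : R) = (D u v l + D u (- v) l) +
    (D (- u) v l + D (- u) (- v) l).
  rewrite /D /width !scalerN !opprD !opprK; ring.
under eq_fun do rewrite E.
rewrite /width; apply: cvgD.
  by apply: cvgD; exact: supp_deriv.
by apply: cvgD; exact: supp_deriv.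
Qed.

(* Fibrewise this is [supp_deriv]; dominated convergence passes to the integral. *)
Lemma kink u v : measurable (lineset u v) -> measurable (lineset (- u) v) ->
  (fine (mu k.+1 (img P (col_mx (u + l.+1%:R^-1 *: v) e))) +
   fine (mu k.+1 (img P (col_mx (u - l.+1%:R^-1 *: v) e))) -
   2 * fine (mu k.+1 (img P (col_mx u e)))) / l.+1%:R^-1 @[l --> \oo] -->
  fine (mu k.+1 (lineset u v)) + fine (mu k.+1 (lineset (- u) v)).
Proof.
move=> mL mL'.
have [B B0 PB] := dotv_bounded v cP.
pose D := img P e.
have mD : measurable D by exact: measurable_img.
pose f_ (l : nat) z : \bar R := (fibdiff u v l.+1%:R^-1 z / l.+1%:R^-1)%:E.
pose f z : \bar R := (facewidth u v z + facewidth (- u) v z)%:E.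
have mf_ l : measurable_fun setT (f_ l).
  apply/measurable_EFinP; apply: measurable_funM => //.
  by apply/measurable_EFinP; exact: measurable_fibdiff.
have mf : measurable_fun setT f.
  by apply/measurable_EFinP; apply: measurable_funD; apply/measurable_EFinP;
    exact: measurable_facewidth.
have offD (h : 'rV[R]_k -> \bar R) : (forall z, ~ D z -> h z = 0%E) ->
    (\int[mu k]_z h z = \int[mu k]_(z in D) h z)%E.
  move=> h0; rewrite [RHS]integral_mkcond; apply: eq_integral => z _.
  by rewrite patchE; case: ifPn => // /negP zD; apply: h0 => /mem_set.
(* Each of the four support functions in the second difference changes by at most [s B], by
   [supp_lip]. The integrals are restricted to the compact [D], on which a constant is
   integrable. *)
have := @dominated_convergence _ _ R (mu k) D mD f_ f (cst (4 * B)%:E).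
case.
- by move=> l; exact: measurable_funS (mf_ l).
- exact: measurable_funS mf.
- apply: aeW => z _; apply: cvg_EFin; first by apply: nearW.
  exact: cvg_fibdiff.
- rewrite (_ : cst _ = EFin \o cst (4 * B))//; apply: measurable_bounded_integrable => //.
    by apply: mu_compact; exact: compact_imgmx.
  by exists (4 * B); split; [exact: num_real|move=> M /ltW ? z _ /=; rewrite ger0_norm// mulr_ge0// ltW].
- apply: aeW => z l Dz; rewrite /f_ abse_EFin lee_fin.
  have s0 : 0 < l.+1%:R^-1 :> R by rewrite invr_gt0.
  set s := l.+1%:R^-1 in s0 *.
  rewrite ger0_norm; last by rewrite divr_ge0 ?fibdiff_ge0// ltW.
  rewrite ler_pdivrMr// /fibdiff /fibwidth mem_set//.
  have cz := compact_fib (e := e) (z := z) cP; have z0 := fib_nonempty Dz.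
  have zB x : fib P e z x -> `|dotv x v| <= B by move=> [Px _]; exact: PB.
  have zB' x : fib P e z x -> `|dotv x (- v)| <= B.
    by move=> h; rewrite dotvNr normrN; exact: zB.
  have := supp_lip u s cz z0 zB; have := supp_lip u s cz z0 zB'.
  have := supp_lip (- u) s cz z0 zB; have := supp_lip (- u) s cz z0 zB'.
  rewrite /width !scalerN !opprD !opprK !ler_norml (gtr0_norm s0).
  by move=> /andP[_ ?] /andP[_ ?] /andP[_ ?] /andP[_ ?]; lra.
move=> _ _.
rewrite -offD; last first.
  by move=> z zD; rewrite /f /facewidth memNset// addr0.
have E l : (\int[mu k]_(z in D) f_ l z)%E =
   ((fine (mu k.+1 (img P (col_mx (u + l.+1%:R^-1 *: v) e))) +
   fine (mu k.+1 (img P (col_mx (u - l.+1%:R^-1 *: v) e))) -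
   2 * fine (mu k.+1 (img P (col_mx u e)))) / l.+1%:R^-1)%:E.
  rewrite -offD; last first.
    by move=> z zD; rewrite /f_ /fibdiff /fibwidth memNset// mulr0 subr0 addr0 mul0r.
  rewrite /f_; under eq_integral do rewrite mulrC EFinM.
  rewrite (ge0_integralZl (mu k) measurableT (measurable_fibdiff u v l.+1%:R^-1));
    [|by move=> z _; rewrite lee_fin fibdiff_ge0|by rewrite lee_fin invrK].
  by rewrite integral_fibdiff -EFinM mulrC.
rewrite (_ : [sequence _]_n = fun l => ((fine (mu k.+1 (img P (col_mx (u + l.+1%:R^-1 *: v) e))) +
   fine (mu k.+1 (img P (col_mx (u - l.+1%:R^-1 *: v) e))) -
   2 * fine (mu k.+1 (img P (col_mx u e)))) / l.+1%:R^-1)%:E); last first.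
  by apply/funext => l; exact: E.
have fL1 := mu_lineset_fin mL; have fL2 := mu_lineset_fin mL'.
have -> : (\int[mu k]_z f z)%E =
    (fine (mu k.+1 (lineset u v)) + fine (mu k.+1 (lineset (- u) v)))%:E.
  rewrite EFinD !fineK// !mu_lineset// -ge0_integralD//.
  - by move=> z _; rewrite lee_fin facewidth_ge0.
  - exact: measurable_facewidth.
  - by move=> z _; rewrite lee_fin facewidth_ge0.
  - exact: measurable_facewidth.
by move=> /fine_cvgP[].
Qed.

End Body.
End Kink.

(** * Almost everywhere constancy of the face volumes *)

Section LineSets.
Variable R : realType.
Local Notation leb := (@lebesgue_measure R).
Local Notation Rm := (measurableTypeR R).
Local Notation mu := (mu R).

Lemma compact_box n (M : R) : compact [set x : 'rV[R]_n | forall i, `|x 0 i| <= M].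
Proof.
rewrite (_ : mkset _ = [set x : 'rV[R]_n | forall i, `[- M, M]%classic (x ord0 i)]).
  by apply: (@rV_compact _ n (fun=> `[- M, M]%classic)) => _; exact: segment_compact.
by apply/seteqP; split => x h i; have := h i; rewrite /= in_itv/= -ler_norml.
Qed.

(** This form is invariant under exchanging the bodies together with the two halves of the frame
    ([proj_eqC]), so whatever is shown for one body holds for the other. *)
Definition proj_eq m j n (P Q : set 'rV[R]_n) := forall (W : 'M[R]_(m, n))
  (U : 'M[R]_(j, n)), frame W U -> mu j (img P U) = mu m (img Q W).

Lemma proj_eqC m j n (P Q : set 'rV[R]_n) : proj_eq m j P Q -> proj_eq j m Q P.
Proof. by move=> h W U /frameC/h ->. Qed.

(** Shadows on [U] of points whose height [w] is greatest over the whole line through the shadow in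
    direction [v]. It contains [Mset] for every [v], and has the same measure for almost every [v]
    ([ae_Mline]). *)
Definition Mline j n (P : set 'rV[R]_n) (U : 'M[R]_(j, n)) (w : 'rV[R]_n)
    (v : 'rV[R]_j) : set 'rV[R]_j :=
  [set t | exists2 x, P x /\ t = x *m U^T & forall x' l, P x' ->
    x' *m U^T = t + l *: v -> dotv x' w <= dotv x w].

Definition Mset j n (P : set 'rV[R]_n) (U : 'M[R]_(j, n)) (w : 'rV[R]_n)
    : set 'rV[R]_j := img (face P w) U.

Lemma suppZ n (X : set 'rV[R]_n) c (a : R) : compact X -> X !=set0 -> 0 < a ->
  supp X (a *: c) = a * supp X c.
Proof.
move=> cX X0 a0; have [x fx] := face_nonempty c cX X0.
have fx' : face X (a *: c) x by rewrite faceZ.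
by rewrite (suppE fx') (suppE fx) dotvZr.
Qed.

Section Meas.
Variables (j n : nat) (P : set 'rV[R]_n) (U : 'M[R]_(j, n)) (w : 'rV[R]_n).
Hypotheses (cP : compact P) (vP : convex_set P).

Let C (q : R) : set 'rV[R]_j := img [set x | P x /\ q <= dotv x w] U.

Let closedC q : closed (C q).
Proof.
apply: compact_closed; first exact: (@norm_hausdorff R 'rV[R]_j).
apply: compact_imgmx; apply: (closed_bounded_compact cP); last by move=> x [].
apply: closedI.
  by apply: compact_closed => //; exact: (@norm_hausdorff R 'rV[R]_n).
apply: (@closed_leR _ _ (fun=> q) (fun x => dotv x w)); first exact: cst_continuous.
exact: continuous_dotvl.
Qed.

(** Pairs (t, v) such that some [t + l v] with [|l| <= N] is the shadow of a point of height at
    least [q]. The scalar [l] is a row vector of length 1 in order to apply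
    [closed_exists_compact]. *)
Let G (q : R) (N : nat) : set 'rV[R]_(j + j) :=
  [set y | exists2 l : 'rV[R]_1, (forall i, `|l 0 i| <= N%:R) &
     C q (lsubmx y + l 0 0 *: rsubmx y)].

Let closedG q N : closed (G q N).
Proof.
apply: (@closed_exists_compact R 1 'rV[R]_(j + j)
  [set l : 'rV[R]_1 | forall i, `|l 0 i| <= N%:R]
  [set p : 'rV[R]_1 * 'rV[R]_(j + j) | C q (lsubmx p.2 + p.1 0 0 *: rsubmx p.2)]).
  exact: compact_box.
apply: closed_preim; last exact: closedC.
have c1 : continuous (fun p : 'rV[R]_1 * 'rV[R]_(j + j) => p.1) by move=> p; exact: cvg_fst.
have c2 : continuous (fun p : 'rV[R]_1 * 'rV[R]_(j + j) => p.2) by move=> p; exact: cvg_snd.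
apply: cont_add; first exact: cont_lsubmx.
by apply: cont_scale; [exact: cont_coord|exact: cont_rsubmx].
Qed.

(** Joint measurability in (t, v), needed for Fubini. A shadow [t] fails exactly if some rational
    height [q] is not reached over [t] but is reached elsewhere on the line, at bounded distance;
    this is a countable union. *)
Lemma measurable_Mline2 :
  measurable [set y : 'rV[R]_(j + j) | Mline P U w (rsubmx y) (lsubmx y)].
Proof.
rewrite (_ : mkset _ = [set y | img P U (lsubmx y)] `\`
  \bigcup_(q : rat) \bigcup_(N : nat)
    ([set y | ~ C (ratr q) (lsubmx y)] `&` G (ratr q) N)).
  apply: measurableD.
    apply: measurable_preimage_fun.
      exact: (measurable_lsubmx (f := fun y : 'rV[R]_(j + j) => y)).
    exact: measurable_img.
  apply: bigcupT_measurable_rat => q; apply: bigcupT_measurable => N.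
  apply: measurableI; last by apply: closed_measurable_mx; exact: closedG.
  apply: measurableC; apply: measurable_preimage_fun.
    exact: (measurable_lsubmx (f := fun y : 'rV[R]_(j + j) => y)).
  by apply: closed_measurable_mx; exact: closedC.
apply/seteqP; split => y /=.
  move=> [x [Px tE] xm]; split; first by exists x.
  move=> [q _ [N _ [/= nC [l _ [x' [Px' qx'] x'E]]]]]; apply: nC.
  exists x => //; split => //; apply: le_trans qx' _.
  by apply: (xm _ (l 0 0)) => //; rewrite x'E.
move=> [[x0 Px0 x0E] nU].
have F0 : fib P U (lsubmx y) !=set0 by exists x0.
have [x [Px xE] xm] := compact_argmax (compact_fib (e := U) (z := lsubmx y) cP) F0
  (@continuous_dotvl R n w).
exists x => // x' l Px' x'E; rewrite leNgt; apply/negP => lt.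
have [q] := rat_in_itvoo lt; rewrite in_itv/= => /andP[q1 q2].
apply: nU; exists q => //; exists (Num.bound `|l|) => //; split => /=.
  move=> [x2 [Px2 qx2] x2E].
  by have := xm x2 (conj Px2 (esym x2E)); rewrite leNgt (lt_le_trans q1 qx2).
exists (\row_(_ < 1) l); first by move=> i; rewrite mxE ltW// archi_boundP.
by exists x'; rewrite ?mxE//; split => //; exact: ltW.
Qed.

Lemma measurable_Mline v : measurable (Mline P U w v).
Proof.
have := @measurable_sliceC R j j _ v measurable_Mline2.
rewrite (_ : mkset _ = Mline P U w v)//.
by apply/seteqP; split => t /=; rewrite row_mxKl row_mxKr.
Qed.

Lemma compact_Mset : compact (Mset P U w).
Proof. by apply: compact_imgmx; exact: compact_face. Qed.

Lemma measurable_Mset : measurable (Mset P U w).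
Proof. by apply: compact_measurable_mx; exact: compact_Mset. Qed.

Lemma sub_Mset_Mline v : Mset P U w `<=` Mline P U w v.
Proof. by move=> t [x [Px xm] tE]; exists x => // x' l Px' _; exact: xm. Qed.

(** Two such points on one line are both highest over that line, so their heights agree, and a
    convex combination has this height too. *)
Lemma Mline_convex v t l1 l2 l : Mline P U w v (t + l1 *: v) ->
  Mline P U w v (t + l2 *: v) -> l1 <= l <= l2 -> Mline P U w v (t + l *: v).
Proof.
move=> [x1 [Px1 x1E] m1] [x2 [Px2 x2E] m2] /andP[l1l ll2].
have sh a b c : a + b *: v + c *: v = a + (b + c) *: v by rewrite scalerDl addrA.
have e12 : dotv x2 w <= dotv x1 w.
  by apply: (m1 _ (l2 - l1)) => //; rewrite sh -x2E; congr (_ + _ *: _); ring.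
have e21 : dotv x1 w <= dotv x2 w.
  by apply: (m2 _ (l1 - l2)) => //; rewrite sh -x1E; congr (_ + _ *: _); ring.
have [e|ne] := eqVneq l1 l2.
  have -> : l = l1 by lra.
  by exists x1.
have d0 : 0 < l2 - l1 by rewrite subr_gt0 lt_neqAle ne (le_trans l1l).
pose a := (l2 - l) / (l2 - l1).
exists (a *: x1 + (1 - a) *: x2).
  split.
    apply: vP => //; rewrite divr_ge0 ?subr_ge0//=; last exact: (le_trans l1l).
    by rewrite ler_pdivrMr// mul1r lerD2l lerN2.
  rewrite mulmxDl -!scalemxAl -x1E -x2E !scalerDr addrACA -scalerDl.
  rewrite [a + _]addrC subrK scale1r !scalerA -scalerDl; congr (_ + _ *: _).
  by rewrite /a; field; rewrite gt_eqF.
move=> x' k Px' x'E; rewrite !dotvD.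
have := m1 x' (k + l - l1) Px'; rewrite sh x'E sh.
have -> : l1 + (k + l - l1) = l + k by ring.
move=> /(_ erefl); have -> : dotv x2 w = dotv x1 w by lra.
nra.
Qed.

Let X := [set y : 'rV[R]_(j + j) | Mline P U w (rsubmx y) (lsubmx y)].
(** The shadow [t] can be moved by [1/(k+1)] in both directions along [v] without leaving
    [Mline]. *)
Let A (k : nat) := [set y : 'rV[R]_(j + j) |
  Mline P U w (rsubmx y) (lsubmx y + k.+1%:R^-1 *: rsubmx y) /\
  Mline P U w (rsubmx y) (lsubmx y - k.+1%:R^-1 *: rsubmx y)].

Let measurableA k : measurable (A k).
Proof.
have ms (s : R) : measurable [set y : 'rV[R]_(j + j) |
    Mline P U w (rsubmx y) (lsubmx y + s *: rsubmx y)].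
  rewrite (_ : mkset _ = [set y : 'rV[R]_(j + j) |
      X (row_mx (lsubmx y + s *: rsubmx y) (rsubmx y))]).
    apply: measurable_preimage_fun; last exact: measurable_Mline2.
    have ml := measurable_lsubmx (D := setT) (f := fun y : 'rV[R]_(j + j) => y)
      (@measurable_id _ _ setT).
    have mr := measurable_rsubmx (D := setT) (f := fun y : 'rV[R]_(j + j) => y)
      (@measurable_id _ _ setT).
    apply: measurable_row_mx => //; apply: measurable_addmx => //.
    exact: measurable_scalemx.
  by apply/seteqP; split => y; rewrite /X /= row_mxKl row_mxKr.
apply: measurableI; first exact: ms.
rewrite [X in measurable X](_ : _ = [set y : 'rV[R]_(j + j) |
    Mline P U w (rsubmx y) (lsubmx y + (- k.+1%:R^-1) *: rsubmx y)]).
  exact: ms.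
by apply/seteqP; split => y /=; rewrite scaleNr.
Qed.

(** The excess of [Mline] over [Mset] is split into endpoints of line sections ([Xend]) and inner
    points of line sections ([Xint]). *)
Let Xend := X `\` \bigcup_k A k.
Let Xint := X `&` (\bigcup_k A k) `&` [set y | ~ Mset P U w (lsubmx y)].

Let measurableXend : measurable Xend.
Proof.
by apply: measurableD; [exact: measurable_Mline2|exact: bigcupT_measurable].
Qed.

Let measurableXint : measurable Xint.
Proof.
apply: measurableI.
  by apply: measurableI; [exact: measurable_Mline2|exact: bigcupT_measurable].
apply: measurableC; apply: measurable_preimage_fun; last exact: measurable_Mset.
exact: (measurable_lsubmx (f := fun y : 'rV[R]_(j + j) => y)).
Qed.

(** For fixed [v], a line parallel to [v] meets [Mline] in an interval, which has at most two
    endpoints. *)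
Let Xend0 : mu (j + j) Xend = 0%E.
Proof.
rewrite mu_rowC//; apply: integral0_eq => v _.
apply: (@mu_null_line R _ _ v); first exact: measurable_sliceC.
move=> t; apply: countable_lebesgue_measure0.
pose S := [set l : R | Mline P U w v (t + l *: v)].
apply: (@sub_countable _ _ _ ([set l | S l /\ forall l', S l' -> l <= l'] `|`
   [set l | S l /\ forall l', S l' -> l' <= l])); last first.
  apply: finite_set_countable; rewrite finite_setU; split.
    have [[a [Sa am]]|nx] := pselect (exists a, S a /\ forall l', S l' -> a <= l').
      apply: (@sub_finite_set _ _ [set a]) => // l [Sl lm] /=.
      by apply/eqP; rewrite eq_le lm//= am.
    apply: (@sub_finite_set _ _ set0) => // l [Sl lm].
    by apply: nx; exists l.
  have [[a [Sa am]]|nx] := pselect (exists a, S a /\ forall l', S l' -> l' <= a).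
    apply: (@sub_finite_set _ _ [set a]) => // l [Sl lm] /=.
    by apply/eqP; rewrite eq_le lm//= am.
  apply: (@sub_finite_set _ _ set0) => // l [Sl lm].
  by apply: nx; exists l.
apply: subset_card_le => l [_ [Xl nA]].
move: Xl; rewrite /X /= row_mxKl row_mxKr => Sl.
apply: contrapT => /not_orP[n1 n2].
have [l1 Sl1 l1l] : exists2 l1, S l1 & l1 < l.
  apply: contrapT => h; apply: n1; split => // l' Sl'.
  by rewrite leNgt; apply/negP => ?; apply: h; exists l'.
have [l2 Sl2 ll2] : exists2 l2, S l2 & l < l2.
  apply: contrapT => h; apply: n2; split => // l' Sl'.
  by rewrite leNgt; apply/negP => ?; apply: h; exists l'.
pose d : R := Num.min (l - l1) (l2 - l).
have d0 : 0 < d by rewrite lt_min !subr_gt0 l1l ll2.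
have [k kd] : exists k : nat, k.+1%:R^-1 < d.
  by have [k kP] := ltr_add_invr d0; exists k; rewrite add0r in kP.
have k0 : 0 < k.+1%:R^-1 :> R by rewrite invr_gt0.
move: kd; rewrite lt_min => /andP[kd1 kd2].
apply: nA; exists k => //; rewrite /A /= row_mxKl row_mxKr.
rewrite -!addrA -scalerDl -scalerBl.
clear d d0; move: k0 kd1 kd2; set s := k.+1%:R^-1 => k0 kd1 kd2.
by split; apply: (Mline_convex Sl1 Sl2); apply/andP; split; lra.
Qed.

(** Here [t] is fixed and the direction moves parallel to [xm *m U^T - t], where [xm] is highest in
    [P]. At most one direction on such a line can be exceptional: two of them would produce a point
    over [t] higher than the highest one. *)
Let Xint0 : P !=set0 -> mu (j + j) Xint = 0%E.
Proof.
move=> P0; rewrite mu_row//; apply: integral0_eq => t _.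
have [xm [Pxm xmax]] := face_nonempty w cP P0.
apply: (@mu_null_line R _ _ (xm *m U^T - t)); first exact: measurable_slice.
move=> v0; apply: countable_lebesgue_measure0; apply: finite_set_countable.
set Z := mkset _.
suff uniq : forall l1 l2, Z l1 -> Z l2 -> l1 = l2.
  have [[l Zl]|nZ] := pselect (exists l, Z l).
    by apply: (@sub_finite_set _ _ [set l]) => // l' Zl'; exact: uniq.
  by apply: (@sub_finite_set _ _ set0) => // l Zl; apply: nZ; exists l.
have key l1 l2 : Z l1 -> Z l2 -> l1 < l2 -> False.
  move=> [_ [[X1 [k1 _ A1]] nM]] [_ [[X2 [k2 _ A2]] _]] l12.
  move: X1 A1 A2 nM; rewrite /X /A /= !row_mxKl !row_mxKr.
  set v1 := v0 + l1 *: _; set v2 := v0 + l2 *: _.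
  move=> [x0 [Px0 tE] x0m] [[x1 [Px1 x1E] m1] _] [_ [x2 [Px2 x2E] m2]] nM.
  set s1 := k1.+1%:R^-1 in x1E m1; set s2 := k2.+1%:R^-1 in x2E m2.
  have s10 : 0 < s1 by rewrite invr_gt0.
  have s20 : 0 < s2 by rewrite invr_gt0.
  pose M := dotv x0 w.
  have x1M : M <= dotv x1 w.
    by apply: (m1 _ (- s1)) => //; rewrite -tE scaleNr addrK.
  have x2M : M <= dotv x2 w.
    by apply: (m2 _ s2) => //; rewrite -tE subrK.
  have Mlt : M < dotv xm w.
    rewrite ltNge; apply/negP => Mle; apply: nM; exists x0 => //; split => // y Py.
    exact: (le_trans (xmax _ Py)).
  (* The weights [a] and [1 - a] cancel the common part of [s1 v1] and [- s2 v2]; what remains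
     places the shadow of [y] at distance [d], in units of [xm *m U^T - t], beyond [t] as seen from
     [xm]. *)
  pose d := s1 * s2 / (s1 + s2) * (l2 - l1).
  have s12 : 0 < s1 + s2 by exact: addr_gt0.
  have d0 : 0 < d by rewrite mulr_gt0 ?subr_gt0// divr_gt0// mulr_gt0.
  pose a := s2 / (s1 + s2).
  have a01 : 0 <= a <= 1.
    apply/andP; split; first by rewrite divr_ge0// ltW.
    by rewrite ler_pdivrMr// mul1r lerDr ltW.
  pose y := a *: x1 + (1 - a) *: x2.
  have Py : P y by exact: vP.
  have d1 : 0 < 1 + d by rewrite addr_gt0.
  (* With this weight the segment from [y] to [xm] passes over [t]. *)
  pose b := (1 + d)^-1.
  have b01 : 0 <= b <= 1.
    by apply/andP; split; [rewrite invr_ge0 ltW|rewrite invf_le1// lerDl ltW].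
  pose x' := b *: y + (1 - b) *: xm.
  have Px' : P x' by exact: vP.
  have yE : y *m U^T = t - d *: (xm *m U^T - t).
    rewrite mulmxDl -!scalemxAl -x1E -x2E /v1 /v2.
    move: (xm *m U^T - t) => aa.
    apply/rowP => i; rewrite !mxE /d /a; field; exact: lt0r_neq0.
  have := x0m x' 0 Px'; rewrite scale0r addr0.
  have -> : x' *m U^T = t.
    rewrite mulmxDl -!scalemxAl yE.
    move: (xm *m U^T) => aa.
    by apply/rowP => i; rewrite !mxE /b; field; exact: lt0r_neq0.
  move=> /(_ erefl).
  have yM : M <= dotv y w by rewrite !dotvD; case/andP: a01 => ? ?; nra.
  rewrite /x' dotvDl !dotvZl => h.
  have b0 : 0 < b by rewrite invr_gt0.
  have b1 : b < 1 by rewrite invf_lt1// ltrDl.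
  have h1 : 0 <= b * (dotv y w - M) by rewrite mulr_ge0 ?subr_ge0// ltW.
  have h2 : 0 < (1 - b) * (dotv xm w - M) by rewrite mulr_gt0 ?subr_gt0.
  by move: h h1 h2; rewrite -/M -/y; clearbody M b y; lra.
by move=> l1 l2 Z1 Z2; case: (ltgtP l1 l2) => // h; [case: (key _ _ Z1 Z2 h)|case: (key _ _ Z2 Z1 h)].
Qed.

(** The excess is null in the space of pairs (t, v), so by Tonelli almost every section at fixed [v]
    is null. *)
Lemma ae_Mline : P !=set0 ->
  {ae mu j, forall v, mu j (Mline P U w v) = mu j (Mset P U w)}.
Proof.
move=> P0.
pose X0 := X `&` [set y | ~ Mset P U w (lsubmx y)].
have mX0 : measurable X0.
  apply: measurableI; first exact: measurable_Mline2.
  apply: measurableC; apply: measurable_preimage_fun; last exact: measurable_Mset.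
  exact: (measurable_lsubmx (f := fun y : 'rV[R]_(j + j) => y)).
have X00 : mu (j + j) X0 = 0%E.
  apply/eqP; rewrite eq_le measure_ge0 andbT.
  have -> : (0 = mu (j + j) Xend + mu (j + j) Xint)%E by rewrite Xend0 Xint0// adde0.
  apply: (@le_trans _ _ (mu (j + j) (Xend `|` Xint))); last exact: measureU2.
  apply: le_measure; rewrite ?inE//; first exact: measurableU.
  move=> y [Xy nM]; have [Ay|nA] := pselect ((\bigcup_k A k) y); last by left.
  by right.
pose f v := mu j [set t | X0 (row_mx t v)].
have mf : measurable_fun setT f by exact: measurable_mu_sliceC.
have : (\int[mu j]_v `|f v| = 0)%E.
  transitivity (\int[mu j]_v f v)%E; first by apply: eq_integral => v _; rewrite gee0_abs.
  by rewrite -[RHS]X00 mu_rowC.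
move=> /(ae_eq_integral_abs (mu j) measurableT mf).
apply: filterS => v /(_ I) fv0.
have E : Mline P U w v = Mset P U w `|` [set t | X0 (row_mx t v)].
  apply/seteqP; split => t; rewrite /X0 /X /= row_mxKl row_mxKr.
    by move=> h; have [?|?] := pselect (Mset P U w t); [left|right].
  by move=> [|[]//]; exact: sub_Mset_Mline.
rewrite E measureU//; last 3 first.
- exact: measurable_Mset.
- exact: measurable_sliceC.
- by apply/seteqP; split => // t [Mt]; rewrite /X0 /= row_mxKl => -[_].
by rewrite -[RHS]adde0; congr (_ + _)%E.
Qed.

End Meas.

(** * Comparison of the two bodies through rotations *)

Section Star.
Variables (m j n : nat).
Implicit Types (P Q : set 'rV[R]_n).

Lemma frame_colP p q k l (a : 'M[R]_(p, n)) (A : 'M[R]_(q, n)) (b : 'M[R]_(k, n))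
    (B : 'M[R]_(l, n)) : frame (col_mx a A) (col_mx b B) <->
  [/\ frame a A, frame b B & [/\ a *m b^T = 0, a *m B^T = 0, A *m b^T = 0
    & A *m B^T = 0]].
Proof.
have z0 r s (M : 'M[R]_(r, n)) (N : 'M[R]_(s, n)) : M *m N^T = 0 -> N *m M^T = 0.
  by move=> h; apply: (can_inj trmxK); rewrite trmx_mul trmxK h trmx0.
split.
  move=> []; rewrite !tr_col_mx !mul_col_row scalar_mx_block => /eq_block_mx[aa aA Aa AA].
  rewrite scalar_mx_block => /eq_block_mx[bb bB Bb BB].
  rewrite -[RHS]block_mx0 => /eq_block_mx[ab aB Ab AB].
  by split.
move=> [[aa AA aA] [bb BB bB] [ab aB Ab AB]].
have Aa := z0 _ _ _ _ aA; have Bb := z0 _ _ _ _ bB.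
by split; rewrite !tr_col_mx !mul_col_row ?aa ?aA ?Aa ?AA ?bb ?bB ?Bb ?BB ?ab ?aB ?Ab ?AB
  -?scalar_mx_block ?block_mx0.
Qed.

Lemma mu_img_scale k P (e : 'M[R]_(k, n)) (c : 'rV[R]_n) (a : R) :
  compact P -> convex_set P -> 0 < a ->
  (mu k.+1 (img P (col_mx (a *: c) e)) = a%:E * mu k.+1 (img P (col_mx c e)))%E.
Proof.
move=> cP vP a0; rewrite !mu_img//.
rewrite -(ge0_integralZl (mu k) measurableT (measurable_fibwidth e cP vP c));
  [|by move=> z _; rewrite lee_fin fibwidth_ge0|by rewrite lee_fin ltW].
apply: eq_integral => z _; rewrite -EFinM /fibwidth.
case: ifPn => [/set_mem zP|_]; last by rewrite mulr0.
have cz := compact_fib (e := e) (z := z) cP; have z0 := fib_nonempty zP.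
by rewrite /width -scalerN !suppZ// mulrDr.
Qed.

(** Divided by [N], the length of both rotated vectors, they form a frame together with [e1] and
    [e2]. Both volumes then carry the factor [N^-1], which cancels. *)
Lemma rotated_img k l P Q (u v : 'rV[R]_n) (e1 : 'M[R]_(k, n)) (e2 : 'M[R]_(l, n))
    (s : R) : compact P -> convex_set P -> compact Q -> convex_set Q ->
  proj_eq k.+1 l.+1 P Q -> frame (col_mx u e1) (col_mx v e2) ->
  mu l.+1 (img P (col_mx (u + s *: v) e2)) = mu k.+1 (img Q (col_mx (v - s *: u) e1)).
Proof.
move=> cP vP cQ vQ PQ /frame_colP[[uu e11 ue1] [vv e22 ve2] [uv ue2 e1v e12]].
have vu : v *m u^T = 0.
  by apply: (can_inj trmxK); rewrite trmx_mul trmxK uv trmx0.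
have N0 : 0 < 1 + s ^+ 2 by rewrite ltr_wpDr// sqr_ge0.
pose N := Num.sqrt (1 + s ^+ 2).
have Np : 0 < N by rewrite sqrtr_gt0.
have NN : N^-1 * N^-1 * (1 + s ^+ 2) = 1.
  rewrite -invfM -expr2 sqr_sqrtr ?ltW// mulVf// gt_eqF//.
have h1 : (N^-1 *: (u + s *: v)) *m (N^-1 *: (u + s *: v))^T = 1%:M.
  rewrite linearZ /= -scalemxAl -scalemxAr scalerA linearD linearZ /= mulmxDl !mulmxDr.
  rewrite -!scalemxAl -!scalemxAr uu vv uv vu !scaler0 addr0 add0r scalerA.
  by rewrite -[X in X + _]scale1r -scalerDl scalerA -expr2 NN scale1r.
have h2 : (N^-1 *: (v - s *: u)) *m (N^-1 *: (v - s *: u))^T = 1%:M.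
  rewrite -scaleNr linearZ /= -scalemxAl -scalemxAr scalerA linearD linearZ /=.
  rewrite mulmxDl !mulmxDr -!scalemxAl -!scalemxAr uu vv uv vu !scaler0 addr0 add0r.
  by rewrite scalerA -[X in X + _]scale1r -scalerDl scalerA mulrNN -expr2 NN scale1r.
have h12 : (N^-1 *: (v - s *: u)) *m (N^-1 *: (u + s *: v))^T = 0.
  rewrite -scaleNr linearZ /= -scalemxAl -scalemxAr scalerA linearD linearZ /=.
  rewrite mulmxDl !mulmxDr -!scalemxAl -!scalemxAr uu vv uv vu !scaler0 addr0 add0r.
  by rewrite -scalerDl subrr scale0r scaler0.
have ve1 : v *m e1^T = 0.
  by apply: (can_inj trmxK); rewrite trmx_mul trmxK e1v trmx0.
have fr : frame (col_mx (N^-1 *: (v - s *: u)) e1) (col_mx (N^-1 *: (u + s *: v)) e2).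
  apply/frame_colP; split.
  - split => //; rewrite -scalemxAl mulmxBl -scalemxAl ue1 ve1.
    by rewrite scaler0 subrr scaler0.
  - split => //; rewrite -scalemxAl mulmxDl -scalemxAl ue2 ve2.
    by rewrite scaler0 addr0 scaler0.
  - split => //.
    + rewrite -scalemxAl mulmxBl -scalemxAl ue2 ve2.
      by rewrite scaler0 subrr scaler0.
    + rewrite linearZ /= -scalemxAr linearD linearZ /= mulmxDr -scalemxAr e1v.
      have -> : e1 *m u^T = 0.
        by apply: (can_inj trmxK); rewrite trmx_mul trmxK ue1 trmx0.
      by rewrite scaler0 addr0 scaler0.
have := PQ _ _ fr.
rewrite !mu_img_scale ?invr_gt0// => h.
have fl := mu_img_fin cP (col_mx (u + s *: v) e2).
have fk := mu_img_fin cQ (col_mx (v - s *: u) e1).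
move: h; rewrite -(fineK fl) -(fineK fk) -!EFinM => -[] h; congr EFin.
by apply: (mulfI _ h); rewrite invr_eq0 gt_eqF.
Qed.

Lemma lineset_opp k P (u v : 'rV[R]_n) (e : 'M[R]_(k, n)) :
  origin_symmetric P -> lineset P e (- u) v = [set y | lineset P e u v (- y)].
Proof.
move=> sP; have opp (w : 'rV[R]_n) y : lineset P e (- w) v y -> lineset P e w v (- y).
  move=> [x [Px ->] xm]; exists (- x).
    by split; [exact: sP|rewrite mulNmx].
  move=> x' Px'; rewrite mulNmx => x'E; have := xm (- x') (sP _ Px').
  by rewrite mulNmx x'E opprK => /(_ erefl); rewrite !dotvD !opprK.
apply/seteqP; split => y /= h; first exact: opp.
by rewrite -[y]opprK; apply: opp; rewrite opprK.
Qed.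

Lemma Mline_lineset k P (u v : 'rV[R]_n) (e : 'M[R]_(k, n)) :
  Mline P (col_mx v e) u (consr (1, 0)) = lineset P e u v.
Proof.
have sh x' x l : x' *m (col_mx v e)^T = x *m (col_mx v e)^T + l *: consr (1, 0) ->
    x' *m e^T = x *m e^T.
  rewrite !mul_col_tr => /(congr1 (fun y : 'rV[R]_(1 + k) => rsubmx y)).
  by rewrite linearD linearZ /= !rsub_consr scaler0 addr0.
apply/seteqP; split => y [x [Px yE] xm]; exists x => // x'.
  move=> Px' x'E; apply: (xm _ (dotv x' v - dotv x v)) => //.
  rewrite yE !mul_col_tr x'E /consr /= (@scale_row_mx _ 1 1 k) (@add_row_mx _ 1 1 k).
  congr (@row_mx _ 1 1 k _ _); last by rewrite scaler0 addr0.
  by apply/rowP => i; rewrite !mxE mulr1 addrC subrK.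
by move=> l Px' x'E; apply: xm => //; apply: (sh _ _ l); rewrite x'E yE.
Qed.

Lemma measurable_lineset k P (u v : 'rV[R]_n) (e : 'M[R]_(k, n)) :
  compact P -> measurable (lineset P e u v).
Proof. by move=> cP; rewrite -Mline_lineset; exact: measurable_Mline. Qed.

(** The second differences of the two sides agree for every [s], hence so do their limits from
    [kink]. By central symmetry the line sets for [u] and [-u] have equal volume, so each limit is
    twice a single volume. *)
Lemma lineset_eq k l P Q (u v : 'rV[R]_n) (e1 : 'M[R]_(k, n)) (e2 : 'M[R]_(l, n)) :
  compact P -> convex_set P -> origin_symmetric P ->
  compact Q -> convex_set Q -> origin_symmetric Q ->
  proj_eq k.+1 l.+1 P Q -> frame (col_mx u e1) (col_mx v e2) ->
  mu l.+1 (lineset P e2 u v) = mu k.+1 (lineset Q e1 v u).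
Proof.
move=> cP vP sP cQ vQ sQ PQ fr.
have mP w : measurable (lineset P e2 w v) by exact: measurable_lineset.
have mQ w : measurable (lineset Q e1 w u) by exact: measurable_lineset.
have sym k' X (e : 'M[R]_(k', n)) w z : compact X -> origin_symmetric X ->
    mu k'.+1 (lineset X e (- w) z) = mu k'.+1 (lineset X e w z).
  move=> cX sX; have mL := measurable_lineset w z e cX.
  rewrite lineset_opp//.
  have n1 : (-1 : R) != 0 by rewrite oppr_eq0 oner_eq0.
  have := mu_scale n1 mL; rewrite normrN normr1 expr1n mul1e => <-.
  by congr (mu _ _); apply/seteqP; split => y /=; rewrite scaleN1r.
have kP := kink cP vP (mP u) (mP (- u)).
have kQ := kink cQ vQ (mQ v) (mQ (- v)).
rewrite !sym// in kP kQ.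
have E : (fun s : nat => (fine (mu l.+1 (img P (col_mx (u + s.+1%:R^-1 *: v) e2))) +
   fine (mu l.+1 (img P (col_mx (u - s.+1%:R^-1 *: v) e2))) -
   2 * fine (mu l.+1 (img P (col_mx u e2)))) / (s.+1%:R^-1 : R)) =
   (fun s : nat => (fine (mu k.+1 (img Q (col_mx (v + s.+1%:R^-1 *: u) e1))) +
   fine (mu k.+1 (img Q (col_mx (v - s.+1%:R^-1 *: u) e1))) -
   2 * fine (mu k.+1 (img Q (col_mx v e1)))) / (s.+1%:R^-1 : R)).
  apply/funext => s; congr (_ / _); congr (_ - 2 * fine _).
    (* Rotating one way for [P] is rotating the opposite way for [Q], so the two outer terms change
       places. *)
    rewrite addrC; congr (fine _ + fine _); last exact: rotated_img.
    have := rotated_img (- s.+1%:R^-1) cP vP cQ vQ PQ fr.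
    by rewrite !scaleNr opprK.
  have := rotated_img 0 cP vP cQ vQ PQ fr.
  by rewrite !scale0r addr0 subr0.
move: kP; rewrite E => kP.
have := cvg_unique (@norm_hausdorff R R^o) kP kQ.
move=> h; have fp := mu_lineset_fin cP (mP u); have fq := mu_lineset_fin cQ (mQ v).
rewrite -(fineK fp) -(fineK fq); congr EFin.
have {}h := h (fmap_proper_filter _ eventually_filter).
by move: h; lra.
Qed.

Lemma Mline_rot k P (U : 'M[R]_(k, n)) w (O : 'M[R]_k) v : O *m O^T = 1%:M ->
  Mline P (O *m U) w (v *m O^T) = [set t | Mline P U w v (t *m O)].
Proof.
move=> OO; have OO' := mulmx1C OO.
apply/seteqP; split => t [x [Px tE] xm]; exists x => //.
- by split => //; rewrite tE trmx_mul -!mulmxA OO' mulmx1.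
- move=> x' l Px' x'E; apply: (xm _ l) => //.
  by rewrite trmx_mul mulmxA x'E mulmxDl -mulmxA OO mulmx1 -scalemxAl.
- by split => //; rewrite trmx_mul mulmxA -tE -mulmxA OO mulmx1.
- move=> x' l Px' x'E; apply: (xm _ l) => //.
  have := congr1 (fun y => y *m O) x'E.
  by rewrite trmx_mul -!mulmxA OO' mulmx1 => ->; rewrite mulmxDl -scalemxAl -mulmxA OO' mulmx1.
Qed.

(** Rotating the coordinates on [U] until [v] is the first basis vector preserves volume and turns
    [Mline] into [lineset]. *)
Lemma mu_Mline_unit k P (U : 'M[R]_(k.+1, n)) w (v : 'rV[R]_k.+1) :
  compact P -> v *m v^T = 1%:M ->
  exists (T : 'M[R]_k.+1) (e : 'M[R]_(k, n)), [/\ T *m T^T = 1%:M, T *m U = col_mx (v *m U) e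
    & mu k.+1 (Mline P U w v) = mu k.+1 (lineset P e w (v *m U))].
Proof.
move=> cP vv; have [T' [_ OO vO]] := @ex_frame R 1 k k.+1 v erefl vv.
have OOv : T' *m v^T = 0.
  by apply: (can_inj trmxK); rewrite trmx_mul trmxK vO trmx0.
pose T : 'M[R]_k.+1 := col_mx v T'.
have O1 : T *m T^T = 1%:M.
  rewrite /T (@tr_col_mx _ 1 k) (@mul_col_row _ 1 k k.+1 1 k) vv OO vO OOv.
  by rewrite -(@scalar_mx_block _ 1 k).
have OU : T *m U = col_mx (v *m U) (T' *m U) by rewrite -(@mul_col_mx _ 1 k).
exists T, (T' *m U); split => //.
rewrite -Mline_lineset -OU.
have <- : v *m T^T = consr (1, 0).
  rewrite /T (@tr_col_mx _ 1 k) (@mul_mx_row _ 1 _ 1 k) vv vO /consr /=.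
  by congr (@row_mx _ 1 1 k _ _); apply/rowP => i; rewrite !mxE !ord1.
by rewrite Mline_rot// mu_orth//; exact: measurable_Mline.
Qed.

Lemma MlineZw k P (U : 'M[R]_(k, n)) w v (a : R) : 0 < a ->
  Mline P U (a *: w) v = Mline P U w v.
Proof.
move=> a0; apply/seteqP; split => t [x xE xm]; exists x => // x' l Px' x'E.
  by have := xm x' l Px' x'E; rewrite !dotvZr ler_pM2l.
by rewrite !dotvZr ler_pM2l//; exact: (xm x' l).
Qed.

Lemma MlineZv k P (U : 'M[R]_(k, n)) w v (a : R) : a != 0 ->
  Mline P U w (a *: v) = Mline P U w v.
Proof.
move=> a0; apply/seteqP; split => t [x xE xm]; exists x => // x' l Px' x'E.
  by apply: (xm x' (l / a)) => //; rewrite scalerA mulfVK.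
by apply: (xm x' (l * a)) => //; rewrite -scalerA.
Qed.

Lemma unit_normalize k (u : 'rV[R]_k) : u != 0 ->
  0 < (enorm u)^-1 /\ ((enorm u)^-1 *: u) *m ((enorm u)^-1 *: u)^T = 1%:M.
Proof.
move=> u0; have d0 : 0 < dotv u u by rewrite dotv_gt0.
have e0 : 0 < enorm u by rewrite sqrtr_gt0.
split; first by rewrite invr_gt0.
apply/matrixP => a b; rewrite !ord1 [RHS]mxE eqxx -/(dotv _ _).
rewrite dotvZl dotvZr mulrA -invfM -expr2 sqr_sqrtr ?ltW// mulVf// gt_eqF//.
Qed.

(** Lengths of [u] and [v] do not matter to [Mline], and rotations inside the row spaces of [W] and
    [U] make them the first vectors of a frame, where [lineset_eq] applies. *)
Lemma Mline_eq P Q (W : 'M[R]_(m.+1, n)) (U : 'M[R]_(j.+1, n)) u v :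
  compact P -> convex_set P -> origin_symmetric P ->
  compact Q -> convex_set Q -> origin_symmetric Q ->
  proj_eq m.+1 j.+1 P Q -> frame W U -> u != 0 -> v != 0 ->
  mu j.+1 (Mline P U (u *m W) v) = mu m.+1 (Mline Q W (v *m U) u).
Proof.
move=> cP vP sP cQ vQ sQ PQ [WW UU WU] u0 v0.
have [au nu] := unit_normalize u0; have [av nv] := unit_normalize v0.
rewrite -(MlineZw _ _ _ _ au) -(MlineZv _ _ _ _ (lt0r_neq0 av)).
rewrite -(MlineZw _ _ (v *m U) _ av) -(MlineZv _ _ _ u (lt0r_neq0 au)).
rewrite 2!scalemxAl.
move: nu nv; set u1 := _ *: u; set v1 := _ *: v => nu nv.
have [T [e2 [OO OU ->]]] := mu_Mline_unit U (u1 *m W) cP nv.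
have [T2 [e1 [OO2 OW ->]]] := mu_Mline_unit W (v1 *m U) cQ nu.
apply: lineset_eq => //; rewrite -OU -OW; split.
- by rewrite trmx_mul mulmxA -[T2 *m W *m W^T]mulmxA WW mulmx1.
- by rewrite trmx_mul mulmxA -[T *m U *m U^T]mulmxA UU mulmx1.
- by rewrite trmx_mul mulmxA -[T2 *m W *m U^T]mulmxA WU mulmx0 mul0mx.
Qed.

End Star.

Lemma ae_neq0 k : {ae mu k.+1, forall v : 'rV[R]_k.+1, v != 0}.
Proof.
exists [set 0]; split.
- by apply: closed_measurable_mx; exact: (accessible_closed_set1 (hausdorff_accessible (@norm_hausdorff R 'rV[R]_k.+1))).
- apply: (@mu_null_line R _ _ (const_mx 1)).
    by apply: closed_measurable_mx; exact: (accessible_closed_set1 (hausdorff_accessible (@norm_hausdorff R 'rV[R]_k.+1))).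
  move=> v; apply: countable_lebesgue_measure0; apply: finite_set_countable.
  apply: (@sub_finite_set _ _ [set - v 0 0]) => // l [_ /= h].
  have := congr1 (fun y : 'rV[R]_k.+1 => y 0 0) h; rewrite !mxE mulr1.
  by move/eqP; rewrite addrC addr_eq0 => /eqP.
- by move=> v /= /negP; rewrite negbK => /eqP.
Qed.

Lemma ae_ex k (A : set 'rV[R]_k) : {ae mu k, forall v, A v} -> exists v, A v.
Proof.
move=> [N [mN N0 AN]]; apply: contrapT => nA.
have NT : N = setT by apply/seteqP; split => // v _; apply: AN => Av; apply: nA; exists v.
have := @mu_open_gt0 R k setT measurableT.
rewrite -[in X in (_ < X)%E]NT N0 ltxx => h; suff: false by [].
by apply: h; exists 0; exact: filterT.
Qed.

(** Let [c] be the infimum of [f] and [c'] that of [g] over nonzero vectors. Along a sequence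
    approaching [c] only countably many null sets are discarded, so [g <= c] almost everywhere;
    likewise [f <= c']. One point of validity of each bound gives [c = c']. *)
Lemma ae_common_value m j (f : 'rV[R]_m.+1 -> \bar R) (g : 'rV[R]_j.+1 -> \bar R) :
  (forall u, 0 <= f u)%E -> (forall v, 0 <= g v)%E ->
  (forall u, f u < +oo)%E ->
  (forall u, u != 0 -> {ae mu j.+1, forall v, (g v <= f u)%E}) ->
  (forall v, v != 0 -> {ae mu m.+1, forall u, (f u <= g v)%E}) ->
  exists c : R, [/\ {ae mu m.+1, forall u, f u = c%:E},
    {ae mu j.+1, forall v, g v = c%:E}, forall u, u != 0 -> (c%:E <= f u)%E &
    forall v, v != 0 -> (c%:E <= g v)%E].
Proof.
move=> f0 g0 foo gf fg.
pose c := ereal_inf [set f u | u in [set u | u != 0]].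
pose c' := ereal_inf [set g u | u in [set u | u != 0]].
have gen p q (F : 'rV[R]_p.+1 -> \bar R) (G : 'rV[R]_q.+1 -> \bar R) (a : \bar R) :
   (forall u, u != 0 -> {ae mu q.+1, forall v, (G v <= F u)%E}) ->
   ereal_inf [set F u | u in [set u | u != 0]] = a -> (0 <= a)%E ->
   {ae mu q.+1, forall v, (G v <= a)%E}.
  move=> GF aE a0; have [->|/eqP aoo] := eqVneq a +oo%E.
    by apply: filterE => v; exact: leey.
  have afin : a \is a fin_num.
    by rewrite ge0_fin_numE// ltey; apply/eqP.
  have ex (k : nat) : exists u, u != 0 /\ (F u < a + (k.+1%:R^-1)%:E)%E.
    have k0 : 0 < k.+1%:R^-1 :> R by rewrite invr_gt0.
    have := lb_ereal_inf_adherent (S := [set F u | u in [set u | u != 0]]) k0.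
    by rewrite aE => /(_ afin)[_ [u /= u0 <-] ?]; exists u.
  have [u_ uP] := choice ex.
  have : {ae mu q.+1, forall v, forall k, (G v <= F (u_ k))%E}.
    by apply: ae_foralln => k; apply: GF; case: (uP k).
  apply: filterS => v hv; apply/lee_addgt0Pr => e e0.
  have [k] := ltr_add_invr e0; rewrite add0r => ke.
  apply: (le_trans (hv k)); apply: (le_trans (ltW (uP k).2)).
  by rewrite leeD2l// lee_fin ltW.
have c0 : (0 <= c)%E by apply: le_ereal_inf_tmp => _ [u _ <-].
have c'0 : (0 <= c')%E by apply: le_ereal_inf_tmp => _ [u _ <-].
have gc := gen _ _ _ _ _ gf erefl c0.
have fc := gen _ _ _ _ _ fg erefl c'0.
have cc' : (c <= c')%E.
  have [u [u0 h]] := ae_ex (filterI (@ae_neq0 m) fc).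
  by apply: le_trans h; apply: ereal_inf_lbound; exists u.
have c'c : (c' <= c)%E.
  have [u [u0 h]] := ae_ex (filterI (@ae_neq0 j) gc).
  by apply: le_trans h; apply: ereal_inf_lbound; exists u.
have E : c = c' by apply/eqP; rewrite eq_le cc' c'c.
have flb u : u != 0 -> (c <= f u)%E by move=> u0; apply: ereal_inf_lbound; exists u.
have glb u : u != 0 -> (c <= g u)%E by move=> u0; rewrite E; apply: ereal_inf_lbound; exists u.
have cfin : c \is a fin_num.
  rewrite ge0_fin_numE//; apply: le_lt_trans (foo (const_mx 1)); apply: flb.
  apply/eqP => /(congr1 (fun y : 'rV[R]_m.+1 => y 0 0)); rewrite !mxE.
  by apply/eqP; exact: oner_neq0.
exists (fine c); rewrite fineK//; split => //.
- apply: filterS2 (@ae_neq0 m) fc => u u0 h.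
  by apply/eqP; rewrite eq_le flb// E h.
- apply: filterS2 (@ae_neq0 j) gc => u u0 h.
  by apply/eqP; rewrite eq_le glb// h.
Qed.

(** In [half], [ae_Mline] gives equality of [Mline] and [Mset] in volume on one side, and
    [sub_Mset_Mline] gives inclusion on the other; exchanging the bodies yields the reverse
    inequality. *)
Lemma ae_const_Mset m j n (P Q : set 'rV[R]_n) (W : 'M[R]_(m.+1, n)) (U : 'M[R]_(j.+1, n)) :
  compact P -> convex_set P -> P !=set0 -> origin_symmetric P ->
  compact Q -> convex_set Q -> Q !=set0 -> origin_symmetric Q ->
  proj_eq m.+1 j.+1 P Q -> frame W U ->
  exists c : R, [/\ {ae mu m.+1, forall u, mu j.+1 (Mset P U (u *m W)) = c%:E},
    {ae mu j.+1, forall v, mu m.+1 (Mset Q W (v *m U)) = c%:E},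
    forall u, u != 0 -> (c%:E <= mu j.+1 (Mset P U (u *m W)))%E &
    forall v, v != 0 -> (c%:E <= mu m.+1 (Mset Q W (v *m U)))%E].
Proof.
move=> cP vP P0 sP cQ vQ Q0 sQ PQ fr.
have half m' j' (A B : set 'rV[R]_n) (W' : 'M[R]_(m'.+1, n)) (U' : 'M[R]_(j'.+1, n)) :
  compact A -> convex_set A -> A !=set0 -> origin_symmetric A ->
  compact B -> convex_set B -> origin_symmetric B ->
  proj_eq m'.+1 j'.+1 A B -> frame W' U' -> forall u, u != 0 ->
  {ae mu j'.+1, forall v, (mu m'.+1 (Mset B W' (v *m U')) <= mu j'.+1 (Mset A U' (u *m W')))%E}.
  move=> cA vA A0 sA cB vB sB AB fr' u u0.
  apply: filterS2 (@ae_neq0 j') (ae_Mline U' (u *m W') cA vA A0) => v v0 <-.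
  rewrite (Mline_eq cA vA sA cB vB sB AB)//; apply: le_measure; rewrite ?inE.
  - exact: measurable_Mset.
  - exact: measurable_Mline.
  - exact: sub_Mset_Mline.
apply: ae_common_value => //.
- by move=> u; apply: mu_compact; exact: compact_Mset.
- by move=> u u0; apply: half.
- by move=> v v0; apply: half => //; [exact: proj_eqC|exact: frameC].
Qed.

End LineSets.

(** * Right derivatives and sets of normals *)

Section Calculus.
Variable R : realType.

(** Real induction. The bound [|g s - g 0| <= eps s] holds up to some supremum [T], left continuity
    extends it to [T], and the vanishing right derivative pushes it beyond [T] unless [T = b]. *)
Lemma right_deriv0_const (g : R -> R) :
  (forall r, 0 <= r -> forall eps : R, 0 < eps ->
    exists2 d : R, 0 < d & forall e, 0 < e < d -> `|g (r + e) - g r| <= eps * e) ->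
  (forall r, 0 < r -> forall eps : R, 0 < eps ->
    exists2 d : R, 0 < d & forall e, 0 < e < d -> `|g r - g (r - e)| <= eps) ->
  forall r, 0 <= r -> g r = g 0.
Proof.
move=> rd lc b b0.
have key (eps : R) : 0 < eps -> `|g b - g 0| <= eps * b.
  move=> eps0.
  pose S := [set t | 0 <= t <= b /\ forall s, 0 <= s <= t -> `|g s - g 0| <= eps * s].
  have S0 : S 0.
    split; first by rewrite lexx.
    move=> s /andP[s0 s0']; have -> : s = 0 by apply/eqP; rewrite eq_le s0 s0'.
    by rewrite subrr normr0 mulr0.
  have Sub : ubound S b by move=> t [/andP[]].
  have hS : has_sup S by split; [exists 0|exists b].
  pose T := sup S.
  have T0 : 0 <= T by apply: ub_le_sup => //; case: hS.
  have Tb : T <= b by apply: sup_le_ub => //; exists 0.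
  have ST : S T.
    split; first by rewrite T0 Tb.
    have lo s : 0 <= s < T -> `|g s - g 0| <= eps * s.
      move=> /andP[s0 sT]; have [t [_ tP] st] := sup_gt (ex_intro _ _ S0) sT.
      by apply: tP; rewrite s0 ltW.
    move=> s /andP[s0 sT]; have [->|sneT] := eqVneq s T; last first.
      by apply: lo; rewrite s0 lt_neqAle sneT.
    have [->|Tn0] := eqVneq T 0; first by rewrite subrr normr0 mulr0.
    have Tp : 0 < T by rewrite lt_neqAle eq_sym Tn0.
    apply/ler_addgt0Pr => e e0; have [d d0 dP] := lc T Tp e e0.
    pose h := Num.min d T / 2.
    have m0 : 0 < Num.min d T by rewrite lt_min d0.
    have h0 : 0 < h by rewrite divr_gt0.
    have [md mT] : Num.min d T <= d /\ Num.min d T <= T.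
      by rewrite !ge_min !lexx orbT.
    have hd : h < d by move: md m0; rewrite /h; lra.
    have hT : h < T by move: mT m0; rewrite /h; lra.
    have h1 := dP h; rewrite h0 hd in h1; have {}h1 := h1 isT.
    have h2 := lo (T - h); rewrite subr_ge0 (ltW hT) ltrBlDr ltrDl h0 in h2.
    have {}h2 := h2 isT.
    have -> : g T - g 0 = (g T - g (T - h)) + (g (T - h) - g 0) by ring.
    apply: (le_trans (ler_normD _ _)).
    by move: h1 h2; clearbody h; nra.
  have [<-|Tneb] := eqVneq T b.
    by case: ST => _; apply; rewrite T0 lexx.
  have Tltb : T < b by rewrite lt_neqAle Tneb.
  have [d d0 dP] := rd T T0 eps eps0.
  pose h := Num.min d (b - T) / 2.
  have m0 : 0 < Num.min d (b - T) by rewrite lt_min d0 subr_gt0.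
  have h0 : 0 < h by rewrite divr_gt0.
  have [md mT] : Num.min d (b - T) <= d /\ Num.min d (b - T) <= b - T.
    by rewrite !ge_min !lexx orbT.
  have hd : h < d by move: md m0; rewrite /h; lra.
  have hT : h < b - T by move: mT m0; rewrite /h; lra.
  have STh : S (T + h).
    split; first by rewrite addr_ge0//= ?ltW//; lra.
    move=> s /andP[s0 sT]; have [sT'|Ts] := leP s T.
      by case: ST => _; apply; rewrite s0.
    have h1 := dP (s - T); rewrite subr_gt0 Ts /= in h1.
    have {}h1 : `|g s - g T| <= eps * (s - T).
      by have := h1 _; rewrite [T + _]addrC subrK; apply; lra.
    have h2 : `|g T - g 0| <= eps * T by case: ST => _; apply; rewrite T0 lexx.
    have -> : g s - g 0 = (g s - g T) + (g T - g 0) by ring.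
    apply: (le_trans (ler_normD _ _)); lra.
  have : T + h <= T by apply: ub_le_sup => //; case: hS.
  by lra.
apply/eqP; rewrite -subr_eq0 -normr_le0; apply/ler_addgt0Pr => e e0; rewrite add0r.
have b1 : 0 < b + 1 by rewrite ltr_wpDl.
apply: (le_trans (key (e / (b + 1)) _)); first by rewrite divr_gt0.
by rewrite mulrAC ler_pdivrMr// ler_pM2l// lerDl.
Qed.

Lemma poly_of_right_deriv (f : R -> R) (p : {poly R}) :
  (forall r, 0 <= r -> (f (r + e) - f r) / e @[e --> (0 : R)^'+] --> (p^`()%R).[r]) ->
  (forall r, 0 < r -> forall eps : R, 0 < eps ->
    exists2 d : R, 0 < d & forall e, 0 < e < d -> `|f r - f (r - e)| <= eps) ->
  forall r, 0 <= r -> f r = f 0 + p.[r] - p.[0].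
Proof.
move=> rd lc.
have rdp r : (p.[r + e] - p.[r]) / e @[e --> (0 : R)^'+] --> (p^`()%R).[r].
  have h : h^-1 *: (p.[h *: 1 + r] - p.[r]) @[h --> 0^'] --> (p^`()%R).[r].
    rewrite derivE derive1E; exact: (@derivable_horner R p r).
  apply/cvgrPdist_le => eps eps0; have /cvgrPdist_le/(_ _ eps0) := h.
  rewrite !near_withinE; apply: filterS => e he e0; have := he (lt0r_neq0 e0).
  by rewrite [e *: 1]mulr1 [e + r]addrC mulrC.
pose g r := f r - p.[r].
move=> r r0; suff : g r = g 0 by rewrite /g; lra.
apply: right_deriv0_const r0.
  move=> {}r r0 eps eps0.
  have /cvgrPdist_le/(_ _ eps0) : (f (r + e) - f r) / e - (p.[r + e] - p.[r]) / e
      @[e --> (0 : R)^'+] --> (0 : R).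
    rewrite -[X in _ --> X](subrr (p^`()%R).[r]).
    by apply: cvgB; [exact: rd|exact: rdp].
  rewrite near_withinE near_nbhs => /nbhs_ballP[d /= d0 dP].
  exists d => // e /andP[e0 ed].
  have := dP e; rewrite /ball /= sub0r normrN (gtr0_norm e0) => /(_ ed e0).
  rewrite sub0r normrN -mulrBl normrM normfV (gtr0_norm e0) ler_pdivrMr//.
  by congr (`|_| <= _); rewrite /g; ring.
move=> {}r r0 eps eps0.
have e20 : 0 < eps / 2 by rewrite divr_gt0.
have [d d0 dP] := lc r r0 _ e20.
have /cvgrPdist_le/(_ _ e20)/nbhs_ballP[d' /= d'0 d'P] := @continuous_horner R p r.
exists (Num.min d d'); first by rewrite lt_min d0.
move=> e; rewrite lt_min => /and3P[e0 ed ed'].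
have h1 := dP e; rewrite e0 ed in h1; have {}h1 := h1 isT.
have h2 := d'P (r - e); rewrite /ball /= opprB addrC subrK (gtr0_norm e0) in h2.
have {}h2 := h2 ed'.
have -> : g r - g (r - e) = (f r - f (r - e)) - (p.[r] - p.[r - e]) by rewrite /g; ring.
apply: (le_trans (ler_normB _ _)); lra.
Qed.

Lemma poly_top_asymp (p : {poly R}) N : (size p <= N.+1)%N ->
  p.[k.+1%:R] / k.+1%:R ^+ N @[k --> \oo] --> p`_N.
Proof.
move=> sp; pose q : {poly R} := \sum_(i < N.+1) p`_i *: 'X^(N - i).
have qE x : q.[x] = \sum_(i < N.+1) p`_i * x ^+ (N - i).
  by rewrite horner_sum; apply: eq_bigr => i _; rewrite hornerZ hornerXn.
have q0 : q.[0] = p`_N.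
  rewrite qE big_ord_recr /= subnn expr0 mulr1 big1 ?add0r// => i _.
  by rewrite expr0n subn_eq0 leqNgt ltn_ord mulr0.
have -> : (fun k : nat => p.[k.+1%:R] / k.+1%:R ^+ N) = (fun k => q.[k.+1%:R^-1]).
  apply/funext => k; rewrite qE (horner_coef_wide _ sp) mulr_suml.
  apply: eq_bigr => i _; rewrite -mulrA; congr (_ * _).
  have iN : (i <= N)%N by rewrite -ltnS.
  move: (nat_of_ord i) iN => {}i iN; rewrite -{1}(subnK iN) exprD invfM mulrCA mulfV ?mulr1 ?exprVn//.
rewrite -q0; apply: continuous_cvg; first exact: continuous_horner.
exact: cvg_invS.
Qed.

(** A finite limit of [p(k) / k^m] forces the degree to be at most [m]: the size bound is lowered
    one step at a time, since a leading coefficient beyond [m] would be a limit equal to 0. *)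
Lemma poly_coef_asymp (p : {poly R}) m (A : R) :
  p.[k.+1%:R] / k.+1%:R ^+ m @[k --> \oo] --> A -> p`_m = A.
Proof.
move=> pA; suff key d : (size p <= (m + d).+1)%N -> p`_m = A.
  by apply: (key (size p)); rewrite leqW// leq_addl.
elim: d => [|d IH] sp.
  rewrite addn0 in sp.
  exact: (cvg_unique (@norm_hausdorff R R^o) (poly_top_asymp sp) pA).
apply: IH; rewrite leq_eqVlt in sp; case/orP: sp => [/eqP sp|]; last by rewrite addnS.
have := @poly_top_asymp p (m + d.+1); rewrite sp => /(_ (leqnn _)) h1.
have h2 : p.[k.+1%:R] / k.+1%:R ^+ m * (k.+1%:R^-1) ^+ d.+1 @[k --> \oo] --> A * 0 ^+ d.+1.
  apply: cvgM => //; rewrite -hornerXn.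
  under eq_fun do rewrite -hornerXn.
  by apply: continuous_cvg; [exact: continuous_horner|exact: cvg_invS].
have E : (fun k : nat => p.[k.+1%:R] / k.+1%:R ^+ (m + d.+1)) =
   (fun k => p.[k.+1%:R] / k.+1%:R ^+ m * (k.+1%:R^-1) ^+ d.+1).
  by apply/funext => k; rewrite exprD invfM mulrA exprVn.
rewrite E in h1; have := cvg_unique (@norm_hausdorff R R^o) h1 h2.
move=> /(_ (fmap_proper_filter _ eventually_filter)); rewrite expr0n mulr0 => p0.
have : lead_coef p = 0 by rewrite lead_coefE sp /= p0.
move/eqP; rewrite lead_coef_eq0 => /eqP pz; by rewrite pz size_poly0 in sp.
Qed.

End Calculus.

(** * Volumes of sums of normals and support points *)

Section NormalSum.
Variable R : realType.
Local Notation mu := (mu R).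

Lemma abs_dotv_le n (x y : 'rV[R]_n) : `|dotv x y| <= enorm x * enorm y.
Proof.
rewrite ler_norml cauchy_schwarz andbT lerNl -dotvNl.
by rewrite (le_trans (cauchy_schwarz _ _))// enormN.
Qed.

Lemma compact_enorm_le n (X : set 'rV[R]_n) : compact X ->
  exists2 B : R, 0 < B & forall x, X x -> enorm x <= B.
Proof.
move=> cX; have [M [M0 MP]] := compact_norm_le cX.
exists (n%:R * M + 1); first by rewrite ltr_wpDl// mulr_ge0// ltW.
move=> x Xx; apply: (le_trans (enorm_le_norm x)).
by rewrite -[leLHS]addr0 lerD// ler_wpM2l// MP.
Qed.

Lemma supp_dist n (X : set 'rV[R]_n) u v (B : R) : compact X -> X !=set0 ->
  (forall x, X x -> enorm x <= B) -> `|supp X u - supp X v| <= B * enorm (u - v).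
Proof.
move=> cX X0 XB; have := @supp_lip R n X v (u - v) 1 (B * enorm (u - v)) cX X0.
rewrite scale1r [v + _]addrC subrK normr1 mul1r; apply => // x Xx.
by apply: (le_trans (abs_dotv_le _ _)); rewrite ler_wpM2r ?enorm_ge0// XB.
Qed.

Lemma continuous_supp n (X : set 'rV[R]_n) : compact X -> X !=set0 ->
  continuous (supp X).
Proof.
move=> cX X0 u; have [B B0 XB] := compact_enorm_le cX.
apply/(@cvgrPdist_lt R R^o _ (nbhs u) (nbhs_filter u)) => e e0.
have : continuous (fun v : 'rV[R]_n => enorm (u - v)).
  by apply: cont_enorm; apply: cont_sub; [exact: cst_continuous|exact: cont_id].
move=> /(_ u)/(@cvgrPdist_lt R R^o _ (nbhs u) (nbhs_filter u))/(_ _ (divr_gt0 e0 B0)).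
apply: filterS => v; rewrite subrr enorm0 sub0r normrN ger0_norm ?enorm_ge0// => h.
apply: (le_lt_trans (supp_dist _ _ cX X0 XB)).
by rewrite mulrC -ltr_pdivlMr.
Qed.

Lemma faceP n (K : set 'rV[R]_n) u x : compact K -> K !=set0 ->
  face K u x <-> K x /\ supp K u <= dotv x u.
Proof.
move=> cK K0; split => [fx|[Kx h]].
  by case: (fx) => Kx _; rewrite (suppE fx).
by split => // y Ky; exact: (le_trans (supp_ge u cK Ky)).
Qed.

Lemma compact_eball n (r : R) : compact [set u : 'rV[R]_n | enorm u <= r].
Proof.
apply: (closed_bounded_compact (@compact_box R n r)).
  apply: closed_leR; last exact: cst_continuous.
  by apply: cont_enorm; exact: cont_id.
move=> u ur i; apply: le_trans ur; apply: le_trans (enorm_ge_norm u).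
exact: le_mx_norm.
Qed.

Lemma finite_net n (K : set 'rV[R]_n) (e : R) : compact K -> 0 < e ->
  exists s : seq 'rV[R]_n, (forall b, b \in s -> K b) /\
    forall a, K a -> exists2 b, b \in s & enorm (a - b) <= e.
Proof.
move=> cK e0; have := cK; rewrite compact_cover.
move=> /(_ _ K (fun b => [set a | enorm (a - b) < e])) [].
- move=> b _.
  have : continuous (fun a : 'rV[R]_n => enorm (a - b)).
    by apply: cont_enorm; apply: cont_sub; [exact: cont_id|exact: cst_continuous].
  by move=> /continuousP/(_ _ (@open_lt R e)).
- by move=> a Ka; exists a => //=; rewrite subrr enorm0.
move=> D DK Kc; exists (finmap.enum_fset D); split.
  by move=> b bD; have := DK b bD; rewrite inE.
by move=> a /Kc[b /= bD h]; exists b => //; exact: ltW.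
Qed.

Lemma seq_argmax (T : eqType) (x0 : T) (s : seq T) (f : T -> R) : s != [::] ->
  exists2 i, (i < size s)%N & forall b, b \in s -> f b <= f (nth x0 s i).
Proof.
case: s => // a s _; elim: s a => [|b s IH] a.
  by exists 0%N => // b; rewrite inE => /eqP ->.
have [i si im] := IH b; have [le|lt] := leP (f a) (f (nth x0 (b :: s) i)).
  by exists i.+1 => // c; rewrite inE => /predU1P[->//|]; exact: im.
exists 0%N => // c; rewrite inE => /predU1P[->//|cs] /=.
by apply: le_trans (ltW lt); exact: im.
Qed.

Lemma closed_cpt n (X : set 'rV[R]_n) : compact X -> closed X.
Proof. by move=> cX; apply: compact_closed => //; exact: (@norm_hausdorff R 'rV[R]_n). Qed.

Lemma closed_face n (T : topologicalType) (K : set 'rV[R]_n) (f g : T -> 'rV[R]_n) :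
  compact K -> K !=set0 -> continuous f -> continuous g ->
  closed [set t | face K (f t) (g t)].
Proof.
move=> cK K0 cf cg.
rewrite (_ : mkset _ = [set t | K (g t)] `&` [set t | supp K (f t) <= dotv (g t) (f t)]).
  apply: closedI; first exact: (closed_preim cg (closed_cpt cK)).
  apply: closed_leR; last exact: (cont_dotv cg cf).
  by move=> p; apply: continuous_comp; [exact: cf|exact: continuous_supp].
by apply/seteqP; split => p /=; [move=> /(faceP _ _ cK K0)|move=> h; apply/(faceP _ _ cK K0)].
Qed.

Lemma closed_normal_sum m (K D : set 'rV[R]_m) : compact K -> K !=set0 -> compact D ->
  closed [set x | exists2 n, D n & face K n (x - n)].
Proof.
move=> cK K0 cD; apply: (@closed_exists_compact R m 'rV[R]_m D
  [set p : 'rV[R]_m * 'rV[R]_m | face K p.1 (p.2 - p.1)]) => //.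
have c1 : continuous (fun p : 'rV[R]_m * 'rV[R]_m => p.1) by move=> p; exact: cvg_fst.
have c2 : continuous (fun p : 'rV[R]_m * 'rV[R]_m => p.2) by move=> p; exact: cvg_snd.
exact: (closed_face cK K0 c1 (cont_sub c2 c1)).
Qed.

(** Monotonicity of normals: for [x = n + a = n' + b] with [a] maximal for [n] and [b] maximal for
    [n'], adding the inequalities gives [|a - b|^2 <= 0]. *)
Lemma translates_disjoint m (a b x : 'rV[R]_m) :
  dotv b (x - a) <= dotv a (x - a) -> dotv a (x - b) <= dotv b (x - b) -> a = b.
Proof.
move=> h1 h2; apply/eqP; rewrite -subr_eq0 -dotv_eq0 eq_le dotv_ge0 andbT.
by move: h1 h2; rewrite !dotvD [dotv b a]dotvC; lra.
Qed.

(* Replacing K by a finite net turns the map n |-> n + (maximiser of <., n> in K)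
   into a piecewise translation; its pieces have disjoint images by monotonicity. *)
Lemma mu_normal_sum m (K D : set 'rV[R]_m) : compact K -> K !=set0 -> compact D ->
  (mu m D <= mu m [set x | exists2 n, D n & face K n (x - n)%R])%E.
Proof.
move=> cK K0 cD.
set A := mkset _.
have clK := closed_cpt cK.
have clA : closed A := closed_normal_sum cK K0 cD.
have [BK BK0 KB] := compact_enorm_le cK; have [BD BD0 DB] := compact_enorm_le cD.
have k0 (k : nat) : 0 < k.+1%:R^-1 :> R by rewrite invr_gt0.
have [s sP] := choice (fun k => finite_net cK (k0 k)).
have sn k : s k != [::].
  by case: K0 => a /(sP k).2[b bs _]; apply: contraTneq bs => ->.
(* Directions for which the i-th net point is maximal among the net; [seqDU] makes these pieces
   disjoint. *)
pose E k i := [set n | [/\ D n, (i < size (s k))%N &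
  forall b, b \in s k -> dotv b n <= dotv (nth 0 (s k) i) n]].
have mE k i : measurable (E k i).
  have [ik|ik] := ltnP i (size (s k)); last first.
    rewrite (_ : E k i = set0)//; apply/seteqP; split => // n [_ h].
    by rewrite ltnNge ik in h.
  apply: closed_measurable_mx.
  rewrite (_ : E k i = D `&` [set n | forall b, b \in s k -> dotv b n <= dotv (nth 0 (s k) i) n]).
    apply: closedI; first exact: closed_cpt.
    apply: closed_forall => b _; apply: closed_leR;
      by apply: cont_dotv; [exact: cst_continuous|exact: cont_id].
  by apply/seteqP; split => [n []//|n [Dn h]]; split.
have mDU k i : measurable (seqDU (E k) i).
  by apply: measurableD => //; apply: bigsetU_measurable.
pose Z k := \bigcup_i [set x | seqDU (E k) i (x - nth 0 (s k) i)].
have mZi k i : measurable [set x | seqDU (E k) i (x - nth 0 (s k) i)].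
  apply: measurable_preimage_fun; last exact: mDU.
  apply: measurable_addmx; [exact: measurable_id|exact: measurable_cst].
have DE k : D = \bigcup_i seqDU (E k) i.
  rewrite -seqDU_bigcup_eq; apply/seteqP; split => [n Dn|n [i _ []]//].
  have [i si im] := @seq_argmax _ 0 _ (fun b => dotv b n) (sn k).
  by exists i.
have inK k i : (i < size (s k))%N -> K (nth 0 (s k) i).
  by move=> h; apply: (sP k).1; exact: mem_nth.
apply: (@mu_limsup R m Z A [set x | forall i, `|x 0 i| <= BD + BK]).
- by move=> k; exact: bigcupT_measurable.
- exact: closed_measurable_mx.
- exact: measurable_box.
- by rewrite mu_box ?ltry// addr_ge0// ltW.
- move=> k x [i _ [[Dx ik _] _]] l.
  apply: (le_trans (le_mx_norm x l)); apply: (le_trans (enorm_ge_norm x)).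
  rewrite -[x](subrK (nth 0 (s k) i)); apply: (le_trans (ler_enormD _ _)).
  by rewrite lerD ?DB ?KB//; exact: inK.
- move=> x xi.
  pose Dx := [set n | D n /\ K (x - n)].
  have cDx : compact Dx.
    apply: (closed_bounded_compact cD); last by move=> n [].
    apply: closedI; first exact: closed_cpt.
    by apply: closed_preim => //; apply: cont_sub; [exact: cst_continuous|exact: cont_id].
  (* Net points are optimal up to the mesh times [|n|], whence the defect [BD / (N+1)]. A maximiser
     over the compact [Dx] then has defect 0. *)
  have near (N : nat) : exists2 n, Dx n & supp K n - dotv (x - n) n <= BD * N.+1%:R^-1.
    have [k Nk [i _ [[Dn ik im] _]]] := xi N.
    set n := x - _ in Dn im; have E' : x - n = nth 0 (s k) i by rewrite /n opprB addrC subrK.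
    exists n; first by split => //; rewrite E'; exact: inK.
    have [a Ka ->] := supp_att n cK K0.
    have [b bs ab] := (sP k).2 a Ka.
    have h1 : dotv (a - b) n <= BD * N.+1%:R^-1.
      apply: (le_trans (cauchy_schwarz _ _)); rewrite mulrC ler_pM ?enorm_ge0 ?DB//.
      by apply: (le_trans ab); rewrite lef_pV2 ?posrE// ler_nat.
    by apply: le_trans h1; rewrite E' dotvBl lerD2l lerN2; exact: im.
  have Dx0 : Dx !=set0 by have [n ? _] := near 0%N; exists n.
  have cf : continuous (fun n : 'rV[R]_m => dotv (x - n) n - supp K n).
    have cx : continuous (fun n : 'rV[R]_m => x - n).
      by apply: cont_sub; [exact: cst_continuous|exact: cont_id].
    have c1 : continuous (fun n : 'rV[R]_m => dotv (x - n) n).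
      by apply: cont_dotv; [exact: cx|exact: cont_id].
    move=> n; exact: (@cvgB R R^o _ (nbhs n) (nbhs_filter n) (fun n : 'rV[R]_m => dotv (x - n) n)
      (supp K) _ _ (c1 n) (continuous_supp cK K0 (x := n))).
  have [n [Dn Kn] nm] := compact_argmax cDx Dx0 cf.
  exists n => //; apply/faceP => //; split => //.
  apply/ler_addgt0Pr => e e0.
  have [N] := ltr_add_invr (divr_gt0 e0 BD0); rewrite add0r => Ne.
  have [n' Dn' h] := near N.
  have h2 : BD * N.+1%:R^-1 < e by rewrite mulrC -ltr_pdivlMr.
  have := nm _ Dn'; rewrite -lerN2 !opprB => h3.
  by rewrite -lerBlDl (le_trans h3)// (le_trans h)// ltW.
- move=> k.
  have tE := @trivIset_seqDU _ (E k).
  have -> : mu m D = (\sum_(i <oo | i \in setT) mu m (seqDU (E k) i))%E.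
    by rewrite [in LHS](DE k); apply: measure_bigcup.
  have -> : mu m (Z k) = (\sum_(i <oo | i \in setT) mu m [set x | seqDU (E k) i (x - nth 0 (s k) i)%R])%E.
    apply: measure_bigcup => //.
    move=> i i' _ _ [x [[[Dn ik im] nn] [[Dn' ik' im'] nn']]].
    move: Dn im nn Dn' im' nn'; set a := nth 0 (s k) i; set b := nth 0 (s k) i'.
    move=> Dn im nn Dn' im' nn'.
    have ab : a = b.
      exact: (translates_disjoint (im b (mem_nth _ ik')) (im' a (mem_nth _ ik))).
    apply: (tE i i') => //; exists (x - a).
    by split; [split|rewrite {1}ab; split] => //; rewrite -?ab.
  apply: lee_nneseries => //= i _; rewrite le_eqVlt; apply/orP; left; apply/eqP.
  by rewrite (mu_shift _ (mDU k i)).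
Qed.

End NormalSum.

(** * Growth of normal tubes *)

Section Parallel.
Variable R : realType.
Local Notation mu := (mu R).
Variables (m j n : nat) (P : set 'rV[R]_n) (W : 'M[R]_(m, n)) (U : 'M[R]_(j, n)).
Hypotheses (nE : n = (m + j)%N) (fr : frame W U).
Hypotheses (cP : compact P) (vP : convex_set P) (P0 : P !=set0).

(** A difference of two tubes is a local parallel set of a parallel body, see
    [local_parallel_tube]. *)
Definition normal_tube (r : R) : set 'rV[R]_n :=
  [set x | exists2 u : 'rV[R]_m, enorm u <= r & face P (u *m W) (x - u *m W)].

Let WW : W *m W^T = 1%:M. Proof. by case: fr. Qed.
Let WU : W *m U^T = 0. Proof. by case: fr. Qed.
Let UW : U *m W^T = 0. Proof. by case: (frameC fr). Qed.
Let UU : U *m U^T = 1%:M. Proof. by case: fr. Qed.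

Let dotWW (u v : 'rV[R]_m) : dotv (u *m W) (v *m W) = dotv u v.
Proof. by rewrite dotv_mulmx -mulmxA WW mulmx1. Qed.

Let dotUW (t : 'rV[R]_j) (v : 'rV[R]_m) : dotv (t *m U) (v *m W) = 0.
Proof. by rewrite dotv_mulmx -mulmxA WU mulmx0 dotv0r. Qed.

Let enormW (u : 'rV[R]_m) : enorm (u *m W) = enorm u.
Proof. by rewrite /enorm dotWW. Qed.

Let coordW (y : 'rV[R]_m) (t : 'rV[R]_j) : (y *m W + t *m U) *m W^T = y.
Proof. by rewrite mulmxDl -!mulmxA WW UW mulmx1 mulmx0 addr0. Qed.

Let coordU (y : 'rV[R]_m) (t : 'rV[R]_j) : (y *m W + t *m U) *m U^T = t.
Proof. by rewrite mulmxDl -!mulmxA UU WU mulmx1 mulmx0 add0r. Qed.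

Lemma normal_unique x (u v : 'rV[R]_m) : face P (u *m W) (x - u *m W) ->
  face P (v *m W) (x - v *m W) -> u = v.
Proof.
move=> [Pu fu] [Pv fv]; have := fu _ Pv; have := fv _ Pu.
move=> h1 h2; apply/eqP; rewrite -subr_eq0 -dotv_eq0 eq_le dotv_ge0 andbT.
move: h1 h2; rewrite !dotvD !dotWW [dotv v u]dotvC; lra.
Qed.

Lemma normal_tube_bounded (B r : R) x : (forall y, P y -> enorm y <= B) ->
  normal_tube r x -> enorm x <= B + r.
Proof.
move=> PB [u ur [Px _]]; rewrite -[x](subrK (u *m W)).
by apply: (le_trans (ler_enormD _ _)); rewrite lerD ?PB// enormW.
Qed.

Lemma compact_normal_tube r : compact (normal_tube r).
Proof.
have [B B0 PB] := compact_enorm_le cP.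
apply: (closed_bounded_compact (@compact_eball R n (B + r))); last first.
  by move=> x; exact: normal_tube_bounded.
apply: (@closed_exists_compact R m 'rV[R]_n [set u | enorm u <= r]
    [set p : 'rV[R]_m * 'rV[R]_n | face P (p.1 *m W) (p.2 - p.1 *m W)]).
  exact: compact_eball.
have c1 : continuous (fun p : 'rV[R]_m * 'rV[R]_n => p.1 *m W).
  by apply: cont_mulmxr => p; exact: cvg_fst.
have c2 : continuous (fun p : 'rV[R]_m * 'rV[R]_n => p.2) by move=> p; exact: cvg_snd.
exact: (closed_face cP P0 c1 (cont_sub c2 c1)).
Qed.

Lemma measurable_normal_tube r : measurable (normal_tube r).
Proof. by apply: compact_measurable_mx; exact: compact_normal_tube. Qed.

(** For [r = 1] this is the limit of tubes whose W-coordinates are divided by their radius. By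
    Tonelli its volume is the integral of the face volumes over the ball of radius [r]. *)
Definition face_bundle (r : R) : set 'rV[R]_(m + j) :=
  [set z | enorm (lsubmx z) <= r /\ Mset P U (lsubmx z *m W) (rsubmx z)].

Lemma compact_face_bundle r : compact (face_bundle r).
Proof.
have [B [B0 UB]] := compact_norm_le (compact_imgmx (A := U) cP).
apply: (closed_bounded_compact (@compact_box R (m + j) (Num.max r B))); last first.
  move=> z [zr [x [Px _] zE]] i.
  case: (split_ordP i) => k ->.
    have -> : z 0 (lshift j k) = lsubmx z 0 k by rewrite mxE.
    rewrite (le_trans (le_mx_norm _ _))// (le_trans (enorm_ge_norm _))//.
    by rewrite (le_trans zr)// le_max lexx.
  have -> : z 0 (rshift m k) = rsubmx z 0 k by rewrite mxE.
  rewrite (le_trans (le_mx_norm _ _))// (@le_trans _ _ B)//; last by rewrite le_max lexx orbT.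
  by apply: UB; exists x.
have cl : continuous (fun z : 'rV[R]_(m + j) => lsubmx z).
  by apply: cont_lsubmx; exact: cont_id.
have cr : continuous (fun z : 'rV[R]_(m + j) => rsubmx z).
  by apply: cont_rsubmx; exact: cont_id.
apply: closedI.
  apply: closed_leR; last exact: cst_continuous.
  exact: cont_enorm.
rewrite [X in closed X](_ : _ = [set z | exists2 x, P x & [set p : 'rV[R]_n * 'rV[R]_(m + j) |
   rsubmx p.2 - p.1 *m U^T = 0 /\ face P (lsubmx p.2 *m W) p.1] (x, z)]).
  apply: closed_exists_compact => //.
  have c1 : continuous (fun p : 'rV[R]_n * 'rV[R]_(m + j) => p.1) by move=> p; exact: cvg_fst.
  have c2 : continuous (fun p : 'rV[R]_n * 'rV[R]_(m + j) => p.2) by move=> p; exact: cvg_snd.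
  apply: closedI.
    apply: (@closed_preim _ _ (fun p : 'rV[R]_n * 'rV[R]_(m + j) => rsubmx p.2 - p.1 *m U^T) [set 0]).
      by apply: cont_sub; [apply: cont_rsubmx|apply: cont_mulmxr].
    exact: (accessible_closed_set1 (hausdorff_accessible (@norm_hausdorff R 'rV[R]_j))).
  apply: (@closed_face R n _ P (fun p : 'rV[R]_n * 'rV[R]_(m + j) => lsubmx p.2 *m W) _ cP P0) => //.
  by apply: cont_mulmxr; exact: cont_lsubmx.
apply/seteqP; split => z /=.
  by move=> [x fx ->]; case: (fx) => Px _; exists x => //; rewrite subrr.
by move=> [x Px [/eqP]]; rewrite subr_eq0 => /eqP zE h; exists x.
Qed.

(** Compare slices at fixed [t]. The slice [D] of the bundle consists of normals, the slice of [P]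
    is a compact [K], and the slice of the tube contains the normal sum of [K] over [D], so
    [mu_normal_sum] applies. *)
Lemma mu_bundle_le r : (mu (m + j) (face_bundle r) <= mu n (normal_tube r))%E.
Proof.
have mB := compact_measurable_mx (@compact_face_bundle r).
rewrite mu_rowC// (mu_frame nE fr (@measurable_normal_tube r)).
apply: ge0_le_integral => //.
- exact: measurable_mu_sliceC.
- by apply: measurable_mu_frame; exact: measurable_normal_tube.
move=> t _.
pose K := [set a : 'rV[R]_m | P (a *m W + t *m U)].
pose D := [set u : 'rV[R]_m | enorm u <= r /\ Mset P U (u *m W) t].
have DE : [set x | face_bundle r (row_mx x t)] = D.
  by apply/seteqP; split => u; rewrite /face_bundle /= row_mxKl row_mxKr.
rewrite DE; have [D0|/set0P Dn] := eqVneq D set0; first by rewrite D0 measure0 measure_ge0.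
have cK : compact K.
  apply: (closed_bounded_compact (compact_imgmx (A := W) cP)).
    apply: closed_preim (closed_cpt cP).
    by apply: cont_add; [apply: cont_mulmxr; exact: cont_id|exact: cst_continuous].
  by move=> a Ka; exists (a *m W + t *m U) => //; rewrite coordW.
have cD : compact D.
  apply: (closed_bounded_compact (@compact_eball R m r)); last by move=> u [].
  rewrite -DE.
  apply: (closed_preim _ (closed_cpt (@compact_face_bundle r))).
  by apply: cont_row_mx; [exact: cont_id|exact: cst_continuous].
have dec u : D u -> exists2 x, face P (u *m W) x & x = (x *m W^T) *m W + t *m U.
  by move=> [_ [x fx ->]]; exists x => //; rewrite frame_decomp.
have K0 : K !=set0.
  have [u /dec[x [Px _] xE]] := Dn.
  by exists (x *m W^T); rewrite /K /= -xE.
apply: (le_trans (mu_normal_sum cK K0 cD)).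
apply: le_measure; rewrite ?inE.
- by apply: closed_measurable_mx; exact: closed_normal_sum.
- apply: measurable_preimage_fun; last exact: measurable_normal_tube.
  exact: measurable_frame_fun.
(* For [u] in [D] the maximum over all of [P] is attained over [t], so a maximiser in the slice is a
   maximiser in [P]. *)
move=> y [u Du [Ky ym]]; have [x [Px xm] xE] := dec u Du.
case: (Du) => ur _; exists u => //.
have -> : y *m W + t *m U - u *m W = (y - u) *m W + t *m U by rewrite mulmxBl addrAC.
split => // x' Px'; apply: (le_trans (xm _ Px')).
rewrite xE !dotvDl !dotUW !addr0 !dotWW; apply: ym.
by rewrite /K /= -xE.
Qed.

Lemma mu_bundle (c : R) r : 
  {ae mu m, forall u, mu j (Mset P U (u *m W)) = c%:E} ->
  mu (m + j) (face_bundle r) = (c%:E * mu m [set u | (enorm u <= r)%R])%E.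
Proof.
move=> aec; have mB := compact_measurable_mx (@compact_face_bundle r).
have mb : measurable [set u : 'rV[R]_m | enorm u <= r].
  by apply: compact_measurable_mx; exact: compact_eball.
have c0 : 0 <= c.
  by have [u uE] := ae_ex aec; rewrite -lee_fin -uE.
rewrite mu_row// (measure_ind (mu m) mb).
rewrite -(ge0_integralZl (mu m) measurableT (@measurable_ind R _ _ _ mb));
  [|by move=> x _; rewrite lee_fin|by rewrite lee_fin].
apply: ge0_ae_eq_integral => //.
- exact: measurable_mu_slice.
- by apply: measurable_funeM; exact: measurable_ind.
- by move=> x _; rewrite mule_ge0 ?lee_fin.
apply: filterS aec => u uE _.
rewrite indicE; case: (boolP (u \in [set u | enorm u <= r])) => [/set_mem|/negP] /= ur.
  rewrite mule1 -uE; congr (mu j _).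
  by apply/seteqP; split => t; rewrite /face_bundle /= row_mxKl row_mxKr => // -[].
rewrite mule0 (_ : mkset _ = set0) ?measure0//; apply/seteqP; split => // t.
by rewrite /face_bundle /= row_mxKl => -[ur' _]; apply: ur; exact/mem_set.
Qed.

Lemma mu_eball (r : R) : 0 < r ->
  mu m [set u | (enorm u <= r)%R] = ((r ^+ m)%:E * mu m [set u | (enorm u <= 1)%R])%E.
Proof.
move=> r0; have mb : measurable [set u : 'rV[R]_m | enorm u <= r].
  by apply: compact_measurable_mx; exact: compact_eball.
rewrite -(mu_scale (lt0r_neq0 r0) mb) (gtr0_norm r0); congr (_ * mu m _)%E.
by apply/seteqP; split => u /=; rewrite enormZ (gtr0_norm r0) ger_pMr.
Qed.

(** The tube of radius [k+1] in frame coordinates, with its W-coordinates divided by [k+1]. *)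
Let A (k : nat) : set 'rV[R]_(m + j) :=
  [set z | normal_tube k.+1%:R ((k.+1%:R *: lsubmx z) *m W + rsubmx z *m U)].

Let measurableA k : measurable (A k).
Proof.
apply: closed_measurable_mx.
apply: (closed_preim _ (closed_cpt (@compact_normal_tube k.+1%:R))).
apply: cont_add; apply: cont_mulmxr.
  by apply: cont_scale; [exact: cst_continuous|apply: cont_lsubmx; exact: cont_id].
by apply: cont_rsubmx; exact: cont_id.
Qed.

Let k0 (k : nat) : 0 < k.+1%:R :> R. Proof. by []. Qed.

Let mu_A k : ((k.+1%:R ^+ m)%:E * mu (m + j) (A k) = mu n (normal_tube k.+1%:R))%E.
Proof.
rewrite mu_rowC// (mu_frame nE fr (@measurable_normal_tube _)).
rewrite -(ge0_integralZl (mu j) measurableT (measurable_mu_sliceC (measurableA k)));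
  [|by []|by rewrite lee_fin exprn_ge0].
apply: eq_integral => t _.
have ms : measurable [set y : 'rV[R]_m | normal_tube k.+1%:R (y *m W + t *m U)].
  apply: measurable_preimage_fun; last exact: measurable_normal_tube.
  exact: measurable_frame_fun.
rewrite -(mu_scale (lt0r_neq0 (k0 k)) ms) (gtr0_norm (k0 k)); congr (_ * mu m _)%E.
by apply/seteqP; split => y; rewrite /A /= row_mxKl row_mxKr.
Qed.

Let A_char k z : A k z -> exists u x, [/\ enorm u <= 1, face P (u *m W) x,
  lsubmx z = u + k.+1%:R^-1 *: (x *m W^T) & rsubmx z = x *m U^T].
Proof.
move=> [u ur fx].
set y := _ *m W + _ in fx.
have kn := lt0r_neq0 (k0 k).
have ki : 0 < k.+1%:R^-1 :> R by rewrite invr_gt0.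
exists (k.+1%:R^-1 *: u), (y - u *m W); split.
- by rewrite enormZ gtr0_norm// mulrC ler_pdivrMr// mul1r.
- by rewrite -scalemxAl faceZ.
- rewrite mulmxBl coordW -mulmxA WW mulmx1 -scalerDr addrC subrK scalerA.
  by rewrite mulVf// scale1r.
- by rewrite mulmxBl coordU -mulmxA WU mulmx0 subr0.
Qed.

(** In [A k] the W-coordinates are a normal [u] of norm at most 1 plus an error of order [1/(k+1)],
    and a point of the face lies over the U-coordinates. Lipschitz continuity of support functions
    carries the face condition to the limit. *)
Let A_limsup z : (forall N, exists2 k, (N <= k)%N & A k z) -> face_bundle 1 z.
Proof.
move=> zA; have [B B0 PB] := compact_enorm_le cP.
have [BW BW0 PBW] := compact_enorm_le (compact_imgmx (A := W) cP).
have app (e : R) : 0 < e -> exists u x, [/\ enorm u <= 1, face P (u *m W) x,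
   rsubmx z = x *m U^T & enorm (lsubmx z - u) <= e].
  move=> e0; have [N] := ltr_add_invr (divr_gt0 e0 BW0); rewrite add0r => Ne.
  have [k Nk /A_char[u [x [u1 fx lE rE]]]] := zA N; exists u, x; split => //.
  rewrite lE addrC addKr enormZ ger0_norm ?invr_ge0//.
  have h1 : k.+1%:R^-1 <= N.+1%:R^-1 :> R by rewrite lef_pV2 ?posrE// ler_nat.
  have h2 : enorm (x *m W^T) <= BW by apply: PBW; exists x => //; case: fx.
  rewrite (@le_trans _ _ (N.+1%:R^-1 * BW))//.
    by rewrite ler_pM ?enorm_ge0 ?invr_ge0.
  by rewrite -ler_pdivlMr// ltW.
pose F := fib P U (rsubmx z).
have cF : compact F by exact: compact_fib.
have F0 : F !=set0.
  by have [u [x [_ [Px _] xE _]]] := app 1 ltr01; exists x.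
have FB x : F x -> enorm x <= B by move=> [Px _]; exact: PB.
split.
  apply/ler_addgt0Pr => e e0; have [u [x [u1 _ _ h]]] := app e e0.
  rewrite -[lsubmx z](subrK u) addrC; apply: (le_trans (ler_enormD _ _)).
  by rewrite lerD.
have [x [Px xE] xs] := supp_att (lsubmx z *m W) cF F0.
exists x => //; apply/faceP => //; split => //; rewrite -xs.
apply/ler_addgt0Pr => e e0.
(* Two support functions are moved from [u] to the limit, that of [P] and that of the fiber [F],
   each with Lipschitz constant [B]. *)
have B20 : 0 < B + B by rewrite addr_gt0.
have [u [x' [_ fx' x'E h]]] := app (e / (B + B)) (divr_gt0 e0 B20).
have h1 := supp_dist (lsubmx z *m W) (u *m W) cP P0 PB.
have h2 := supp_dist (lsubmx z *m W) (u *m W) cF F0 FB.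
rewrite -mulmxBl enormW in h1 h2.
have h3 : supp P (u *m W) <= supp F (u *m W).
  by rewrite (suppE fx'); apply: supp_ge => //; split => //; case: fx'.
have h4 : (B + B) * enorm (lsubmx z - u) <= e by rewrite mulrC -ler_pdivlMr.
move: h1 h2; rewrite !ler_norml => /andP[_ h1] /andP[h2 _].
lra.
Qed.

Lemma normal_tube_asymp (c : R) :
  {ae mu m, forall u, mu j (Mset P U (u *m W)) = c%:E} ->
  fine (mu n (normal_tube k.+1%:R)) / k.+1%:R ^+ m @[k --> \oo] -->
  c * kappa R m.
Proof.
move=> aec.
have mb : measurable [set u : 'rV[R]_m | enorm u <= 1].
  by apply: compact_measurable_mx; exact: compact_eball.
have kE : mu m [set u : 'rV[R]_m | (enorm u <= 1)%R] = (kappa R m)%:E.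
  rewrite /kappa volnE// fineK// ge0_fin_numE//.
  by apply: mu_compact; exact: compact_eball.
have fT k : mu n (normal_tube k) \is a fin_num.
  by rewrite ge0_fin_numE//; apply: mu_compact; exact: compact_normal_tube.
have [B B0 PB] := compact_enorm_le cP.
have [BW [BW0 PBW]] := compact_norm_le (compact_imgmx (A := W) cP).
have [BU [BU0 PBU]] := compact_norm_le (compact_imgmx (A := U) cP).
have AB k : A k `<=` [set z | forall i, `|z 0 i| <= 1 + BW + BU].
  move=> z /A_char[u [x [u1 [Px _] lE rE]]] i.
  case: (split_ordP i) => l ->.
    have -> : z 0 (lshift j l) = lsubmx z 0 l by rewrite mxE.
    rewrite (le_trans (le_mx_norm _ _))// lE (le_trans (ler_normD _ _))//.
    rewrite -[leLHS]addr0 lerD//; last exact: ltW.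
    rewrite lerD//; first by rewrite (le_trans (enorm_ge_norm _)).
    rewrite normrZ ger0_norm ?invr_ge0//.
    rewrite -[BW]mul1r ler_pM ?invr_ge0//; first by rewrite invf_le1// ler1n.
    by apply: PBW; exists x.
  have -> : z 0 (rshift m l) = rsubmx z 0 l by rewrite mxE.
  rewrite (le_trans (le_mx_norm _ _))// rE -[leLHS]add0r lerD//.
    by rewrite addr_ge0// ltW.
  by apply: PBU; exists x.
have fA k : mu (m + j) (A k) \is a fin_num.
  rewrite ge0_fin_numE//; apply: (@le_lt_trans _ _ (mu (m + j) [set z | forall i, (`|z 0 i| <= 1 + BW + BU)%R])).
    by apply: le_measure; rewrite ?inE//; exact: measurable_box.
  by rewrite mu_box ?ltry// !addr_ge0// ltW.
have E k : fine (mu n (normal_tube k.+1%:R)) / k.+1%:R ^+ m = fine (mu (m + j) (A k)).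
  rewrite -mu_A fineM// mulrC mulrA mulVf ?mul1r//.
have lo k : c * kappa R m <= fine (mu (m + j) (A k)).
  have kp : 0 < k.+1%:R ^+ m :> R by rewrite exprn_gt0.
  rewrite -E ler_pdivlMr// -lee_fin fineK//.
  apply: le_trans (@mu_bundle_le _); rewrite (@mu_bundle c)// mu_eball// kE.
  by rewrite -!EFinM lee_fin; lra.
rewrite (_ : (fun k : nat => _) = (fun k => fine (mu (m + j) (A k)))); last first.
  by apply/funext => k; exact: E.
apply/cvgrPdist_le => e e0.
suff : \forall k \near \oo, fine (mu (m + j) (A k)) <= c * kappa R m + e.
  apply: filterS => k h; have := lo k; rewrite ler_norml; lra.
apply: contrapT => nh.
have ex N : exists k, (N <= k)%N /\ c * kappa R m + e < fine (mu (m + j) (A k)).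
  apply: contrapT => h; apply: nh; exists N => // k /= Nk.
  by rewrite leNgt; apply/negP => ?; apply: h; exists k.
have [s sP] := choice ex.
have h : ((c * kappa R m + e)%:E <= mu (m + j) (face_bundle 1))%E.
  apply: (@mu_limsup R (m + j) (fun N => A (s N)) (face_bundle 1)
    [set z | forall i, `|z 0 i| <= 1 + BW + BU]).
  - by move=> N; exact: measurableA.
  - by apply: compact_measurable_mx; exact: compact_face_bundle.
  - exact: measurable_box.
  - by rewrite mu_box ?ltry// !addr_ge0// ltW.
  - by move=> N; exact: AB.
  - move=> z zA; apply: A_limsup => N; have [k Nk Az] := zA N.
    by exists (s k) => //; apply: (leq_trans Nk); case: (sP k).
  - by move=> N; rewrite -(fineK (fA _)) lee_fin ltW//; case: (sP N).
by move: h; rewrite (@mu_bundle c)// kE -EFinM lee_fin gerDl leNgt e0.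
Qed.

End Parallel.

(** * Area measures as coefficients of the tube volume *)

Section AreaMeasure.
Variable R : realType.
Local Notation mu := (mu R).

Lemma ler_enorm n (x y : 'rV[R]_n) : (enorm x <= enorm y) = (dotv x x <= dotv y y).
Proof. by rewrite ler_sqrt// dotv_ge0. Qed.

Lemma nearest_face n (K : set 'rV[R]_n) x p : convex_set K -> K p ->
  (forall y, K y -> enorm (x - p) <= enorm (x - y)) -> face K (x - p) p.
Proof.
move=> vK Kp pm; split => // y Ky; rewrite leNgt; apply/negP => lt.
pose a := dotv (y - p) (x - p); pose b := dotv (y - p) (y - p).
have a0 : 0 < a by rewrite /a dotvBl subr_gt0.
have b0 : 0 <= b by exact: dotv_ge0.
have ab0 : 0 < a + b by exact: ltr_pwDl.
(* A step towards [y] in [0, 1] with [t b <= a]; minimality of the distance would require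
   [2 a <= t b]. *)
pose t := a / (a + b).
have t0 : 0 < t by rewrite divr_gt0.
have t1 : t <= 1 by rewrite ler_pdivrMr// mul1r lerDl.
have := pm _ (vK _ _ t Ky Kp _); rewrite (ltW t0) t1 => /(_ isT).
have -> : x - (t *: y + (1 - t) *: p) = (x - p) - t *: (y - p).
  by apply/rowP => i; rewrite !mxE; ring.
have ex (X Y : 'rV[R]_n) : dotv (X - t *: Y) (X - t *: Y) =
    dotv X X - 2 * t * dotv Y X + t * t * dotv Y Y.
  by rewrite !dotvBl !dotvBr !dotvZl !dotvZr [dotv X Y]dotvC; ring.
rewrite ler_enorm ex -/a -/b => h.
have h1 : 2 * (t * a) <= t * (t * b) by lra.
have h2 : 2 * a <= t * b by rewrite -(ler_pM2l t0); lra.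
have h3 : t * b <= a.
  by rewrite /t mulrAC ler_pdivrMr// ler_pM2l// lerDr ltW.
lra.
Qed.

Section Frame.
Variables (m j n : nat) (P : set 'rV[R]_n) (W : 'M[R]_(m, n)) (U : 'M[R]_(j, n)).
Hypotheses (nE : n = (m + j)%N) (fr : frame W U).
Hypotheses (cP : compact P) (vP : convex_set P) (P0 : P !=set0).

Local Notation tube := (normal_tube P W).

Let enormW (u : 'rV[R]_m) : enorm (u *m W) = enorm u.
Proof. by case: fr => WW _ _; rewrite /enorm dotv_mulmx -mulmxA WW mulmx1. Qed.

Lemma convex_parallel r : convex_set (parallel_body P r).
Proof.
move=> x y t [a [b [Pa [b1 ->]]]] [a' [b' [Pa' [b1' ->]]]] /andP[t0 t1].
exists (t *: a + (1 - t) *: a'), (t *: b + (1 - t) *: b'); split.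
  by apply: vP => //; rewrite t0.
split; last by apply/rowP => i; rewrite !mxE; ring.
apply: (le_trans (ler_enormD _ _)); rewrite !enormZ ger0_norm// ger0_norm ?subr_ge0//.
have h1 : t * enorm b <= t * 1 by rewrite ler_wpM2l.
have h2 : (1 - t) * enorm b' <= (1 - t) * 1 by rewrite ler_wpM2l// subr_ge0.
lra.
Qed.

Lemma unit_dir (u : 'rV[R]_m) : u != 0 -> exists w : 'rV[R]_n,
  [/\ u *m W = enorm u *: w, w = ((enorm u)^-1 *: u) *m W, dotv w w = 1 & enorm w = 1].
Proof.
move=> u0; have N0 : 0 < enorm u by rewrite enorm_gt0.
exists (((enorm u)^-1 *: u) *m W).
have e1 : enorm (((enorm u)^-1 *: u) *m W) = 1.
  by rewrite enormW enormZ gtr0_norm ?invr_gt0// mulVf// gt_eqF.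
split => //; last by rewrite -enorm_sq e1 expr1n.
by rewrite -scalemxAl scalerA mulfV ?scale1r// gt_eqF.
Qed.

(** A point at distance [d] from the parallel body in direction [w] has nearest point [a + r w] with
    [a] in the face of [P] for [w], so it is [a + (r + d) w]. Conversely each such point has this
    nearest point. *)
Lemma local_parallel_tube (E : 'M[R]_n) (r e : R) : (W == E)%MS -> 0 <= r -> 0 < e ->
  local_parallel (parallel_body P r) e (@sphere R n `&` subsp E) = tube (r + e) `\` tube r.
Proof.
move=> /eqmxP WE r0 e0.
apply/seteqP; split => x.
  move=> [p [Pp [pm [/andP[d0 de] [w1 wE]]]]].
  set d := enorm (x - p) in d0 de w1 wE.
  set w := d^-1 *: (x - p) in w1 wE.
  have [u uE] : exists u : 'rV[R]_m, w = u *m W by apply/submxP; rewrite WE.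
  have ww : dotv w w = 1 by rewrite -enorm_sq w1 expr1n.
  have xpE : x - p = d *: w by rewrite /w scalerA mulfV ?scale1r// gt_eqF.
  clearbody w.
  have u1 : enorm u = 1 by rewrite -enormW -uE.
  have := nearest_face (@convex_parallel r) Pp pm; rewrite xpE faceZ// => -[_ fp].
  case: Pp => a [b [Pa [b1 pE]]].
  have fa : face P w a.
    split => // y Py; have := fp (y + r *: b); rewrite pE !dotvDl lerD2r; apply.
    by exists y, b.
  (* Maximality forces equality in Cauchy-Schwarz, so [b = w] when [r > 0]; the factor [r] covers
     [r = 0], where [b] is arbitrary. *)
  have rb : r *: b = r *: w.
    have h : r <= r * dotv b w.
      have := fp (a + r *: w); rewrite pE !dotvDl lerD2l !dotvZl ww mulr1; apply.
      by exists a, w; rewrite w1.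
    have h2 : dotv b b <= 1.
      by rewrite -enorm_sq expr_le1// enorm_ge0.
    apply/eqP; rewrite -subr_eq0 -dotv_eq0 eq_le dotv_ge0 andbT.
    rewrite !dotvBl !dotvBr !dotvZl !dotvZr ww [dotv w b]dotvC.
    have h3 : r * (r * dotv b b) <= r * (r * 1) by rewrite !ler_wpM2l.
    have h4 : r * r <= r * (r * dotv b w) by rewrite ler_wpM2l.
    lra.
  have rd0 : 0 < r + d by exact: ltr_wpDl.
  have xE : x - ((r + d) *: u) *m W = a.
    rewrite -scalemxAl -uE -[x](subrK p) xpE pE rb.
    by apply/rowP => i; rewrite !mxE; ring.
  have fx : face P ((r + d) *: u *m W) (x - (r + d) *: u *m W).
    by rewrite xE -scalemxAl -uE faceZ.
  split.
    by exists ((r + d) *: u) => //; rewrite enormZ u1 mulr1 gtr0_norm// lerD2l.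
  (* The normal representing a point is unique, so its norm [r + d] keeps [x] out of the inner
     tube. *)
  move=> [u2 u2r fu2]; have E2 := normal_unique fr fu2 fx.
  by move: u2r; rewrite E2 enormZ u1 mulr1 gtr0_norm// gerDl leNgt d0.
move=> [[u ur fu] nr].
have rN : r < enorm u by rewrite ltNge; apply/negP => h; apply: nr; exists u.
have N0 : 0 < enorm u by exact: le_lt_trans rN.
have u0 : u != 0 by rewrite -enorm_gt0.
have [w [uW wE ww w1]] := unit_dir u0.
set a := x - u *m W in fu.
have fa : face P w a by rewrite -(faceZ _ _ N0) -uW.
set N := enorm u in ur rN N0 uW.
have Nr : 0 < N - r by rewrite subr_gt0.
have xpE : x - (a + r *: w) = (N - r) *: w.
  by rewrite opprD addrA /a opprB [x + _]addrC subrK uW scalerBl.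
exists (a + r *: w); split.
  by exists a, w; rewrite w1; split; [case: fa|].
rewrite xpE enormZ w1 mulr1 gtr0_norm//; split.
  move=> y [a' [b [Pa' [b1 ->]]]].
  have h1 := cauchy_schwarz (x - (a' + r *: b)) w; rewrite w1 mulr1 in h1.
  apply: le_trans h1.
  have -> : x = a + N *: w by rewrite /a -uW subrK.
  clearbody a; have h2 : dotv a' w <= dotv a w by case: fa => _; apply.
  have h3 : dotv b w <= 1 by apply: (le_trans (cauchy_schwarz _ _)); rewrite w1 mulr1.
  have h4 : r * dotv b w <= r * 1 by rewrite ler_wpM2l.
  rewrite !dotvBl !dotvDl !dotvZl ww; lra.
rewrite Nr /=; split; first by rewrite lerBlDl.
rewrite scalerA mulVf ?scale1r ?gt_eqF//; split => //=.
by rewrite /subsp /= -WE wE submxMl.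
Qed.

Lemma compact_parallel r : compact (parallel_body P r).
Proof.
rewrite (_ : parallel_body P r = [set z | exists2 b, [set b : 'rV[R]_n | enorm b <= 1] b &
   P (z - r *: b)]); last first.
  apply/seteqP; split => z.
    by move=> [a [b [Pa [b1 ->]]]]; exists b => //; rewrite addrK.
  by move=> [b b1 Pz]; exists (z - r *: b), b; rewrite subrK.
have [B B0 PB] := compact_enorm_le cP.
apply: (closed_bounded_compact (@compact_eball R n (B + `|r|))); last first.
  move=> z [b b1 Pz]; rewrite /= -[z](subrK (r *: b)).
  apply: (le_trans (ler_enormD _ _)); rewrite lerD ?PB//.
  by rewrite enormZ ler_piMr.
apply: (@closed_exists_compact R n 'rV[R]_n [set b : 'rV[R]_n | enorm b <= 1]
   [set p : 'rV[R]_n * 'rV[R]_n | P (p.2 - r *: p.1)]); first exact: compact_eball.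
have c1 : continuous (fun p : 'rV[R]_n * 'rV[R]_n => p.1) by move=> p; exact: cvg_fst.
have c2 : continuous (fun p : 'rV[R]_n * 'rV[R]_n => p.2) by move=> p; exact: cvg_snd.
apply: closed_preim (closed_cpt cP).
by apply: (cont_sub c2); apply: cont_scale; [exact: cst_continuous|exact: c1].
Qed.

Let body r := mu n (parallel_body P r).

Let mbody r : measurable (parallel_body P r).
Proof. by apply: compact_measurable_mx; exact: compact_parallel. Qed.

Let L r := fine (mu n (tube r)).

Let tube_mono r s : r <= s -> tube r `<=` tube s.
Proof. by move=> rs x [u ur fu]; exists u => //; exact: le_trans rs. Qed.

Let mtube r : measurable (tube r).
Proof. exact: (measurable_normal_tube fr). Qed.

Let ftube r : mu n (tube r) \is a fin_num.
Proof. by rewrite ge0_fin_numE//; apply: mu_compact; exact: (compact_normal_tube fr). Qed.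

Let fbody r : body r \is a fin_num.
Proof. by rewrite ge0_fin_numE//; apply: mu_compact; exact: compact_parallel. Qed.

Let mu_tubeD r s : r <= s -> fine (mu n (tube s `\` tube r)) = L s - L r.
Proof.
move=> rs; rewrite measureD//; last by rewrite -ge0_fin_numE// ftube.
by rewrite setIC (setIidl (tube_mono rs)) fineB// ?ftube.
Qed.

(** Since [P] contains a ball of radius [rho], the dilate [S] of the parallel body by [1 + d / rho]
    contains the tube shell of thickness [d], while the shell misses the parallel body itself. *)
Let tube_lip (rho r d : R) : 0 < rho -> (forall b, enorm b <= rho -> P b) ->
  0 <= r -> 0 < d -> L (r + d) - L r <= ((1 + d / rho) ^+ n - 1) * fine (body r).
Proof.
move=> rho0 Pb r0 d0.
pose s := d / rho.
have s0 : 0 < s by rewrite divr_gt0.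
have s1 : 0 < 1 + s by exact: addr_gt0.
pose q := (1 + s)^-1.
have q0 : 0 < q by rewrite invr_gt0.
pose S := [set x | parallel_body P r (q *: x)].
have mS : measurable S.
  apply: measurable_preimage_fun => //.
  by apply: (measurable_scalemx (D := setT) (a := fun=> q) (f := fun x : 'rV[R]_n => x));
    [exact: measurable_cst|exact: measurable_id].
have muS : mu n S = (((1 + s) ^+ n)%:E * body r)%E.
  rewrite /body -(mu_scale (lt0r_neq0 q0) (mbody r)) (gtr0_norm q0) muleA -EFinM.
  by rewrite -exprMn mulfV ?expr1n ?mul1e// gt_eqF.
have conv x y : P x -> P y -> P (q *: x + (s * q) *: y).
  move=> Px Py; have -> : s * q = 1 - q by rewrite /q; field; rewrite gt_eqF.
  apply: vP => //; rewrite (ltW q0) /q invf_le1// lerDl ltW//.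
have qle1 : q <= 1 by rewrite /q invf_le1// lerDl ltW.
have sub : tube (r + d) `\` tube r `<=` S `\` parallel_body P r.
  move=> x [[u ur fu] nr].
  have rN : r < enorm u by rewrite ltNge; apply/negP => h; apply: nr; exists u.
  have N0 : 0 < enorm u by exact: le_lt_trans rN.
  have u0 : u != 0 by rewrite -enorm_gt0.
  have [w [uW wE ww w1]] := unit_dir u0.
  set a := x - u *m W in fu.
  have fa : face P w a by rewrite -(faceZ _ _ N0) -uW.
  have Pa : P a by case: fa.
  set N := enorm u in ur rN N0 uW.
  have xE : x = a + N *: w by rewrite /a -uW subrK.
  clearbody a; split.
    (* The excess [N - r <= d] along [w] is taken from the inner ball: as [s = d / rho], the second
       term is [q (N - r) w]. *)
    exists (q *: a + (s * q) *: ((rho * (N - r) / d) *: w)), (q *: w); split.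
      apply: conv => //; apply: Pb; rewrite enormZ w1 mulr1 ger0_norm.
        by rewrite ler_pdivrMr// ler_pM2l// lerBlDl.
      by rewrite divr_ge0 ?mulr_ge0 ?subr_ge0// ltW.
    split; first by rewrite enormZ w1 mulr1 gtr0_norm.
    rewrite xE scalerDr !scalerA -addrA -scalerDl; congr (_ + _ *: _).
    by rewrite /s; field; rewrite !gt_eqF.
  move=> [a' [b [Pa' [b1 x2]]]].
  have h2 : dotv a' w <= dotv a w by case: fa => _; apply.
  have h3 : dotv b w <= 1 by apply: (le_trans (cauchy_schwarz _ _)); rewrite w1 mulr1.
  have h4 : r * dotv b w <= r * 1 by rewrite ler_wpM2l.
  have := congr1 (fun y => dotv y w) x2; rewrite xE !dotvDl !dotvZl ww; lra.
have bS : parallel_body P r `<=` S.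
  move=> x [a [b [Pa [b1 ->]]]].
  have Pz : P 0 by apply: Pb; rewrite enorm0 ltW.
  exists (q *: a), (q *: b); split.
    by rewrite -[q *: a]addr0 -(scaler0 _ (s * q)); exact: conv.
  split; last by rewrite scalerDr !scalerA mulrC.
  by rewrite enormZ gtr0_norm// mulr_ile1// ?enorm_ge0// ltW.
rewrite -mu_tubeD; last by rewrite lerDl ltW.
have fS : (mu n S < +oo)%E by rewrite muS -(fineK (fbody r)) -EFinM ltry.
have -> : ((1 + d / rho) ^+ n - 1) * fine (body r) = fine (mu n (S `\` parallel_body P r)).
  have -> : mu n (S `\` parallel_body P r) = (mu n S - body r)%E.
    by rewrite measureD// setIC (setIidl bS).
  rewrite muS -(fineK (fbody r)) -EFinM -EFinB /=.
  by rewrite /s; ring.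
rewrite fine_le//.
- rewrite ge0_fin_numE//; apply: (@le_lt_trans _ _ (mu n (tube (r + d)))); last by rewrite -ge0_fin_numE// ftube.
 
    by apply: le_measure => //; rewrite inE; [exact: measurableD|exact: mtube].
- rewrite ge0_fin_numE//; apply: le_lt_trans fS.
  by apply: le_measure => //; rewrite inE//; exact: measurableD.
- by apply: le_measure; rewrite ?inE//; exact: measurableD.
Qed.

Let tube_left_cont (rho r : R) : 0 < rho -> (forall b, enorm b <= rho -> P b) ->
  0 < r -> forall eps : R, 0 < eps ->
  exists2 d : R, 0 < d & forall e, 0 < e < d -> `|L r - L (r - e)| <= eps.
Proof.
move=> rho0 Pb r0 eps eps0.
pose M := fine (body r) + 1.
have M0 : 0 < M by rewrite ltr_wpDl// fine_ge0.
pose p : {poly R} := (1 + rho^-1 *: 'X) ^+ n.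
have pE x : p.[x] = (1 + x / rho) ^+ n.
  by rewrite horner_exp hornerD hornerC hornerZ hornerX mulrC.
have /cvgrPdist_le/(_ _ (divr_gt0 eps0 M0))/nbhs_ballP[d /= d0 dP] := @continuous_horner R p 0.
exists (Num.min d r); first by rewrite lt_min d0.
move=> e; rewrite lt_min => /and3P[e0 ed er].
have re : 0 <= r - e by rewrite subr_ge0 ltW.
have := @tube_lip rho (r - e) e rho0 Pb re e0; rewrite subrK => h.
have LL : L (r - e) <= L r.
  apply: fine_le; [exact: ftube|exact: ftube|]; apply: le_measure; rewrite ?inE//.
  by apply: tube_mono; rewrite gerBl ltW.
rewrite ger0_norm ?subr_ge0//; apply: (le_trans h).
have := dP e; rewrite /ball /= sub0r normrN gtr0_norm// => /(_ ed).
rewrite !pE mul0r addr0 expr1n distrC => h2.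
have h3 : (1 + e / rho) ^+ n - 1 <= eps / M by apply: le_trans h2; exact: ler_norm.
have h4 : fine (body (r - e)) <= M.
  apply: (@le_trans _ _ (fine (body r))); last by rewrite lerDl.
  apply: fine_le; [exact: fbody|exact: fbody|]; apply: le_measure; rewrite ?inE//.
  move=> x [a [b [Pa [b1 ->]]]]; exists a, ((r - e) / r *: b); split => //.
  split; last by rewrite scalerA mulrCA mulfV ?mulr1// gt_eqF.
  rewrite enormZ ger0_norm ?divr_ge0// ?(ltW r0)//.
  rewrite mulr_ile1 ?enorm_ge0 ?divr_ge0// ?(ltW r0)//.
  by rewrite ler_pdivrMr// mul1r gerBl ltW.
have h5 : 0 <= (1 + e / rho) ^+ n - 1.
  by rewrite subr_ge0 exprn_ege1// lerDl divr_ge0// ltW.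
apply: (@le_trans _ _ (eps / M * M)); last by rewrite mulfVK// gt_eqF.
by apply: ler_pM => //; exact: fine_ge0.
Qed.

(** The defining expansion says that the tube volume has a polynomial right derivative, so the
    volume is an antiderivative of it. Its coefficient at [r^m] comes from [S_j], because
    [n - 1 - j = m - 1], and [normal_tube_asymp] computes it. *)
Lemma area_measure_tube (E : 'M[R]_n) (cs : nat -> R) (rho c : R) : (0 < m)%N ->
  (W == E)%MS -> 0 < rho -> (forall b, enorm b <= rho -> P b) ->
  {ae mu m, forall u, mu j (Mset P U (u *m W)) = c%:E} ->
  area_measures_at P (@sphere R n `&` subsp E) cs ->
  'C(n.-1, j)%:R * cs j = m%:R * (c * kappa R m).
Proof.
move=> m0 WE rho0 Pb aec am.
(* [g l] is the coefficient of [r^l] in the expansion, and [p] its antiderivative with zero constant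
   term. *)
pose g l := 'C(n.-1, n.-1 - l)%:R * cs (n.-1 - l)%N.
pose p : {poly R} := \poly_(k < n.+1) (if k is l.+1 then g l / l.+1%:R else 0).
have pdE r : (p^`()%R).[r] = \sum_(i < n) r ^+ (n.-1 - i) * 'C(n.-1, i)%:R * cs i.
  have sp : (size (p^`()%R)%R <= n)%N.
    apply/leq_sizeP => l nl; rewrite coef_deriv coef_poly ltnS ltnNge nl /=.
    by rewrite mul0rn.
  rewrite (horner_coef_wide _ sp) (reindex_inj rev_ord_inj) /=.
  apply: eq_bigr => i _; rewrite coef_deriv coef_poly ltnS.
  have iN := ltn_ord i.
  have -> : (n - i.+1 < n)%N by rewrite -subSn// subSS leq_subr.
  have e1 : (n - i.+1 = n.-1 - i)%N by move: iN; lia.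
  rewrite -[X in X * _]mulr_natr mulfVK ?pnatr_eq0// /g e1 subKn; last by rewrite -ltnS prednK// (leq_ltn_trans _ iN).
  by rewrite -mulrA mulrC.
have Lp : forall r, 0 <= r -> L r = L 0 + p.[r] - p.[0].
  apply: poly_of_right_deriv; last first.
    by move=> r r0 eps eps0; apply: (tube_left_cont rho0).
  move=> r r0; rewrite pdE.
  have := am r r0; rewrite /surface_area_is => /cvgrPdist_le h.
  apply/cvgrPdist_le => eps eps0; have := h eps eps0.
  rewrite !near_withinE; apply: filterS => e he e0; have := he e0.
  rewrite (local_parallel_tube WE r0 e0) volnE; last by exact: measurableD.
  by rewrite mu_tubeD// lerDl ltW.
have := normal_tube_asymp nE fr cP P0 aec.
(* The constant that turns [p] into the tube volume does not affect the coefficient at [m > 0]. *)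
pose q : {poly R} := p + (L 0 - p.[0])%:P.
rewrite (_ : (fun k : nat => _) = (fun k => q.[k.+1%:R] / k.+1%:R ^+ m)); last first.
  apply/funext => k; congr (_ / _); rewrite -/(L _) Lp// /q hornerD hornerC; ring.
move=> /poly_coef_asymp <-.
rewrite /q coefD coefC (gtn_eqF m0) addr0 coef_poly ltnS nE leq_addr -nE.
have -> : m = m.-1.+1 by rewrite prednK.
rewrite /= mulrCA mulfV ?mulr1 ?pnatr_eq0//.
by rewrite /g (_ : (n.-1 - m.-1)%N = j)// nE; case: (m) m0 => // m' _; rewrite addSn /= addKn.
Qed.

End Frame.
End AreaMeasure.

(** * Faces of positive volume *)

Section Faces.
Variable R : realType.
Local Notation mu := (mu R).
Local Notation Rm := (measurableTypeR R).

Lemma mu_hyperplane0 m (a c : 'rV[R]_m) : c != 0 ->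
  mu m [set x | dotv (x - a) c = 0] = 0%E.
Proof.
move=> c0; apply: (@mu_null_line R m _ c).
  apply: closed_measurable_mx.
  have cf : continuous (fun x : 'rV[R]_m => dotv (x - a) c).
    apply: cont_dotv; last exact: cst_continuous.
    by apply: cont_sub; [exact: cont_id|exact: cst_continuous].
  rewrite (_ : mkset _ = [set x | dotv (x - a) c <= 0] `&` [set x | 0 <= dotv (x - a) c]).
    by apply: closedI; apply: closed_leR => //; exact: cst_continuous.
  apply/seteqP; split => x /=; first by move=> ->; rewrite lexx.
  by move=> [h1 h2]; apply/eqP; rewrite eq_le h1.
move=> v; apply: countable_lebesgue_measure0; apply: finite_set_countable.
apply: (@sub_finite_set _ _ [set - dotv (v - a) c / dotv c c]) => // l [_ /=].
rewrite addrAC dotvDl dotvZl => h.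
have -> : dotv (v - a) c = - (l * dotv c c) by lra.
by rewrite opprK mulfK// gt_eqF// dotv_gt0.
Qed.

(** A set of positive measure lies in no hyperplane, so a further independent difference from [a0]
    exists as long as fewer than [m] have been chosen. *)
Lemma ex_indep_differences m (A : set 'rV[R]_m) : measurable A -> (0 < mu m A)%E ->
  exists2 N : 'M[R]_m, N \in unitmx & forall i, exists x y, [/\ A x, A y & row i N = x - y].
Proof.
move=> mA A0.
have [a0 Aa0] : A !=set0 by apply/set0P; apply: contraTneq A0 => ->; rewrite measure0 ltxx.
have step r : (r <= m)%N -> exists2 N : 'M[R]_(r, m), row_free N &
    forall i, exists2 x, A x & row i N = x - a0.
  elim: r => [|r IH] rm.
    by exists 0; [rewrite -row_leq_rank|case].
  have [N fN Nd] := IH (ltnW rm).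
  have [c c0 cN] : exists2 c : 'rV[R]_m, c != 0 & c *m N^T = 0.
    have k0 : kermx N^T != 0.
      by rewrite kermx_eq0 -row_leq_rank mxrank_tr (eqP fN) -ltnNge.
    exists (nz_row (kermx N^T)); first by rewrite nz_row_eq0.
    by apply/eqP; rewrite -sub_kermx nz_row_sub.
  have [a Aa ac] : exists2 a, A a & dotv (a - a0) c != 0.
    apply: contrapT => h; move: A0; rewrite ltNge => /negP; apply.
    rewrite -(mu_hyperplane0 a0 c0); apply: le_measure; rewrite ?inE//.
      apply: closed_measurable_mx.
      apply: (@closed_preim _ _ (fun x : 'rV[R]_m => dotv (x - a0) c) [set 0]).
        apply: cont_dotv; last exact: cst_continuous.
        by apply: cont_sub; [exact: cont_id|exact: cst_continuous].
      exact: (accessible_closed_set1 (hausdorff_accessible (@norm_hausdorff R R^o))).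
    by move=> a Aa /=; apply/eqP; apply: contrapT => /negP ?; apply: h; exists a.
  exists (col_mx (a - a0) N); last first.
    move=> i; case: (@split_ordP 1 r i) => k ->.
      by exists a => //; rewrite (@rowKu _ 1 r) ord1 row_id.
    by have [x Ax xE] := Nd k; exists x => //; rewrite (@rowKd _ 1 r).
  apply: inj_row_free => w; rewrite -[w](@hsubmxK _ 1 1 r) (@mul_row_col _ 1 1 r) => h.
  have w1 : lsubmx (w : 'rV[R]_(1 + r)) = 0.
    have := congr1 (fun z => z *m c^T) h; rewrite mulmxDl -!mulmxA mul0mx.
    have -> : N *m c^T = 0 by apply: (can_inj trmxK); rewrite trmx_mul trmxK cN trmx0.
    rewrite mulmx0 addr0 mul_trmx_dotv mul_mx_scalar => /eqP.
    by rewrite scaler_eq0 (negbTE ac) => /eqP.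
  move: h; rewrite w1 mul0mx add0r => /eqP; rewrite mulmx_free_eq0// => /eqP ->.
  exact: (@row_mx0 _ 1 1 r).
have [N fN Nd] := step m (leqnn m).
exists N; first by rewrite -row_free_unit.
by move=> i; have [x Ax xE] := Nd i; exists x, a0.
Qed.

Lemma convex_sum n (A : set 'rV[R]_n) k (x : 'I_k -> 'rV[R]_n) (l : 'I_k -> R) :
  convex_set A -> (forall i, A (x i)) -> (forall i, 0 <= l i) -> \sum_i l i = 1 ->
  A (\sum_i l i *: x i).
Proof.
move=> vA; elim: k x l => [|k IH] x l Ax l0.
  by rewrite big_ord0 => /eqP; rewrite eq_sym oner_eq0.
rewrite !big_ord_recl => l1.
pose s := \sum_(i < k) l (lift ord0 i).
have s0 : 0 <= s by apply: sumr_ge0.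
have lE : l ord0 = 1 - s by rewrite -l1 /s addrK.
have [sz|sn] := eqVneq s 0.
  have lz i : l (lift ord0 i) = 0.
    by apply: (psumr_eq0P _ sz) => // j _.
  rewrite big1; last by move=> i _; rewrite lz scale0r.
  by rewrite lE sz subr0 scale1r addr0.
have -> : \sum_(i < k) l (lift ord0 i) *: x (lift ord0 i) =
    s *: \sum_(i < k) (l (lift ord0 i) / s) *: x (lift ord0 i).
  by rewrite scaler_sumr; apply: eq_bigr => i _; rewrite scalerA mulrCA mulfV ?mulr1.
rewrite addrC lE; apply: vA => //.
  apply: IH => //; first by move=> i; rewrite divr_ge0.
  by rewrite -mulr_suml mulfV.
by rewrite s0 /= -subr_ge0 -lE.
Qed.

Lemma interior_of_differences m (A : set 'rV[R]_m) (N : 'M[R]_m) :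
  convex_set A -> A !=set0 -> N \in unitmx ->
  (forall i, exists x y, [/\ A x, A y & row i N = x - y]) -> A° !=set0.
Proof.
move=> vA [a0 Aa0] uN Nd.
have [x xP] := choice Nd; have [y yP] := choice xP.
case: m => [|m] in A N vA a0 Aa0 uN Nd x xP y yP *.
  exists a0; rewrite (_ : A = setT); first exact: filterT.
  by apply/seteqP; split => // b _; rewrite [b]thinmx0 -[0](thinmx0 a0).
pose M : R := m.+1%:R.
have M0 : 0 < M by [].
(* The mean of the midpoints: adding [t_i] times row [i] moves the i-th midpoint by
   [M t_i (x i - y i)], which stays on its segment if [|t_i| <= 1 / (2 M)]. *)
pose c := \sum_i M^-1 *: (2^-1 *: (x i + y i)).
have cb (t : 'rV[R]_m.+1) : (forall i, `|t 0 i| <= (2 * M)^-1) -> A (c + t *m N).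
  move=> tb.
  have -> : c + t *m N = \sum_i M^-1 *: ((2^-1 + M * t 0 i) *: x i + (1 - (2^-1 + M * t 0 i)) *: y i).
    rewrite mulmx_sum_row -big_split /=; apply: eq_bigr => i _.
    have [_ _ ->] := yP i; apply/rowP => k; rewrite !mxE; field.
    by rewrite gt_eqF.
  apply: convex_sum => //.
  - move=> i; have [Ax Ay _] := yP i; apply: vA => //.
    have : `|M * t 0 i| <= 2^-1.
      rewrite normrM gtr0_norm// (le_trans (ler_wpM2l (ltW M0) (tb i)))//.
      by rewrite invfM mulrCA mulfV ?mulr1// gt_eqF.
    by rewrite ler_norml; lra.
  - by move=> i; rewrite invr_ge0 ltW.
  - by rewrite sumr_const card_ord -mulr_natr mulVf// gt_eqF.
exists c.
have cf : continuous (fun z : 'rV[R]_m.+1 => (z - c) *m invmx N).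
  by apply: cont_mulmxr; apply: cont_sub; [exact: cont_id|exact: cst_continuous].
have e0 : 0 < (2 * M)^-1 by rewrite invr_gt0 mulr_gt0.
have : nbhs ((c - c) *m invmx N) (ball ((c - c) *m invmx N) (2 * M)^-1).
  exact: nbhsx_ballx.
move=> /(cf c) h; apply: (@filterS _ (nbhs c) (nbhs_filter c) _ A _ h) => z {h}.
rewrite subrr mul0mx /= => /mx_ballP[_ h].
have := cb ((z - c) *m invmx N); rewrite -mulmxA mulVmx// mulmx1 [c + _]addrC subrK; apply.
by move=> i; have := h 0 i; rewrite mxE sub0r normrN => /ltW.
Qed.

(** Along a line in direction [e_i] the i-th coordinates of maximisers increase monotonically. Where
    two maximisers differ in it there is a rational between their coordinates, and these rationals
    are distinct along the line, so the exceptional set is null by [mu_null_line]. *)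
Lemma ae_face_unique k (K : set 'rV[R]_k) : compact K -> K !=set0 ->
  {ae mu k, forall v, forall x y, face K v x -> face K v y -> x = y}.
Proof.
move=> cK K0.
pose S (i : 'I_k) (q : nat) := [set v | exists2 x, K x & exists2 y, K y &
  [/\ face K v x, face K v y & q.+1%:R^-1 <= x 0 i - y 0 i]].
have clS i q : closed (S i q).
  have c11 : continuous (fun p : 'rV[R]_k * ('rV[R]_k * 'rV[R]_k) => p.1) by move=> p; exact: cvg_fst.
  have c2 : continuous (fun p : 'rV[R]_k * ('rV[R]_k * 'rV[R]_k) => p.2) by move=> p; exact: cvg_snd.
  have c21 : continuous (fun p : 'rV[R]_k * ('rV[R]_k * 'rV[R]_k) => p.2.1).
    by move=> p; apply: continuous_comp; [exact: c2|exact: cvg_fst].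
  have c22 : continuous (fun p : 'rV[R]_k * ('rV[R]_k * 'rV[R]_k) => p.2.2).
    by move=> p; apply: continuous_comp; [exact: c2|exact: cvg_snd].
  pose T := [set p : 'rV[R]_k * ('rV[R]_k * 'rV[R]_k) | face K p.2.2 p.2.1 /\
    (face K p.2.2 p.1 /\ q.+1%:R^-1 <= (p.2.1 - p.1) 0 i)].
  have clT : closed T.
    apply: closedI; first exact: (closed_face cK K0 c22 c21).
    apply: closedI; first exact: (closed_face cK K0 c22 c11).
    apply: closed_leR; first exact: cst_continuous.
    by apply: cont_coord; exact: (cont_sub c21 c11).
  have := closed_exists_compact cK (closed_exists_compact cK clT).
  rewrite (_ : mkset _ = S i q)//; apply/seteqP; split => v.
    move=> [x Kx [y Ky [fx [fy h]]]]; exists x => //; exists y => //.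
    by split => //; move: h; rewrite /= !mxE.
  move=> [x Kx [y Ky [fx fy h]]]; exists x => //; exists y => //.
  by split => //; split => //=; rewrite !mxE.
have S0 i q : mu k (S i q) = 0%E.
  apply: (@mu_null_line R k _ (delta_mx 0 i)); first exact: closed_measurable_mx.
  move=> v; apply: countable_lebesgue_measure0.
  set Z := mkset _.
  have rex l : exists r : rat, Z l -> exists x y, [/\ face K (v + l *: delta_mx 0 i) x,
      face K (v + l *: delta_mx 0 i) y & y 0 i < ratr r < x 0 i].
    have [[_ [x _ [y _ [fx fy h]]]]|nZ] := pselect (Z l); last by exists 0.
    have lt : y 0 i < x 0 i.
      by rewrite -subr_gt0; apply: lt_le_trans h; rewrite invr_gt0.
    by have [r] := rat_in_itvoo lt; rewrite in_itv /= => rP; exists r => _; exists x, y.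
  have [r rP] := choice rex.
  apply/countable_injP; exists (fun l => pickle (r l)) => l1 l2 /set_mem Z1 /set_mem Z2.
  move=> /(pcan_inj pickleK) r12.
  have mono a b : a < b -> Z a -> Z b -> r a = r b -> False.
    move=> ab /rP[x [_ [fx _ /andP[_ h1]]]] /rP[_ [y [_ fy /andP[h2 _]]]] rab.
    have := (fx.2 y fy.1); have := (fy.2 x fx.1).
    rewrite !dotvDr !dotvZr => g1 g2.
    have cd (z : 'rV[R]_k) : dotv z (delta_mx 0 i) = z 0 i.
      rewrite dotvE (bigD1 i)//= mxE !eqxx mulr1 big1 ?addr0// => l lin.
      by rewrite mxE (negbTE lin) andbF mulr0.
    rewrite !cd in g1 g2.
    rewrite rab in h1; have h := lt_trans h2 h1.
    have : 0 < (b - a) * (x 0 i - y 0 i) by rewrite mulr_gt0 ?subr_gt0.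
    lra.
  case: (ltgtP l1 l2) => // h.
    by case: (mono _ _ h Z1 Z2 r12).
  by case: (mono _ _ h Z2 Z1 (esym r12)).
have aeS i : {ae mu k, forall v, forall q, ~ S i q v}.
  apply: ae_foralln => q; exists (S i q).
  by split; [exact: closed_measurable_mx|exact: S0|move=> v /= /contrapT].
have : {ae mu k, forall v, forall i q, ~ S i q v}.
  apply: filter_forall => i; exact: aeS.
apply: filterS => v h x y fx fy.
have le i (a b : 'rV[R]_k) : face K v a -> face K v b -> a 0 i <= b 0 i.
  move=> fa fb; rewrite leNgt; apply/negP => lt.
  have [q] := ltr_add_invr lt; rewrite -ltrBrDl => qP.
  apply: (h i q); exists a; first by case: fa.
  by exists b; [case: fb|split => //; exact: ltW].
by apply/rowP => i; apply/eqP; rewrite eq_le !le.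
Qed.

Lemma fin_argmin (T : finType) (A : pred T) (f : T -> R) t0 : A t0 ->
  exists2 t1, A t1 & forall t, A t -> f t1 <= f t.
Proof.
move=> At0; pose s := [seq t <- enum T | A t].
have s0 : s != [::].
  by apply/eqP => h; have := mem_filter A t0 (enum T); rewrite -/s h mem_enum At0.
have [q sq qm] := seq_argmax t0 (fun t => - f t) s0.
have : nth t0 s q \in s by exact: mem_nth.
rewrite mem_filter => /andP[h _]; exists (nth t0 s q) => // t At.
by have := qm t; rewrite mem_filter At mem_enum lerN2; apply.
Qed.

Lemma finite_eps (T : finType) (A : T -> R -> Prop) :
  (forall t (d e : R), 0 < d <= e -> A t e -> A t d) ->
  (forall t, exists2 e : R, 0 < e & A t e) -> exists2 e : R, 0 < e & forall t, A t e.
Proof.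
move=> anti ex.
suff [e e0 eP] : exists2 e : R, 0 < e & forall t, t \in enum T -> A t e.
  by exists e => // t; apply: eP; rewrite mem_enum.
elim: (enum T) => [|t s [e e0 eP]]; first by exists 1.
have [d d0 dP] := ex t; exists (Num.min d e); first by rewrite lt_min d0.
have m0 : 0 < Num.min d e by rewrite lt_min d0.
move=> t'; rewrite inE => /predU1P[->|/eP h].
  by apply: anti dP; rewrite m0 ge_min lexx.
by apply: anti h; rewrite m0 ge_min lexx orbT.
Qed.

Lemma ae_ex_in k (A B : set 'rV[R]_k) : {ae mu k, forall v, A v} -> measurable B ->
  (0 < mu k B)%E -> exists2 v, B v & A v.
Proof.
move=> [N [mN N0 AN]] mB B0; apply: contrapT => nA.
move: B0; rewrite ltNge => /negP; apply; rewrite -N0; apply: le_measure; rewrite ?inE//.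
by move=> v Bv; apply: AN => /= Av; apply: nA; exists v.
Qed.

Lemma measurable_eball_at k (a : 'rV[R]_k) (d : R) : measurable [set w | enorm (w - a) <= d].
Proof.
apply: closed_measurable_mx; apply: closed_leR; last exact: cst_continuous.
by apply: cont_enorm; apply: cont_sub; [exact: cont_id|exact: cst_continuous].
Qed.

Lemma mu_eball_gt0 k (a : 'rV[R]_k) (d : R) : 0 < d ->
  (0 < mu k [set w | (enorm (w - a) <= d)%R])%E.
Proof.
move=> d0; set B := mkset _.
have cB : continuous (fun w : 'rV[R]_k => enorm (w - a)).
  by apply: cont_enorm; apply: cont_sub; [exact: cont_id|exact: cst_continuous].
apply: mu_open_gt0; first exact: measurable_eball_at.
exists a; have : nbhs (enorm (a - a)) [set r : R | r < d].
  by rewrite subrr enorm0; exact: open_nbhs_nbhs (conj (@open_lt R d) d0).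
move=> /(cB a) h; apply: (@filterS _ (nbhs a) (nbhs_filter a) _ B _ h).
by move=> w /= /ltW.
Qed.

Lemma frame_perp m j n (W : 'M[R]_(m, n)) (U : 'M[R]_(j, n)) (F : 'M[R]_n) :
  n = (m + j)%N -> frame W U -> (U == F)%MS -> (W == perp F)%MS.
Proof.
move=> nE [WW UU WU] /eqmxP UF.
have WF : W *m F^T = 0.
  have /submxP[D ->] : (F <= U)%MS by rewrite UF.
  by rewrite trmx_mul mulmxA WU mul0mx.
have s : (W <= perp F)%MS by apply/sub_kermxP.
have rF : \rank F = j by rewrite -UF (orthonormal_rank UU).
have e : \rank W = \rank (perp F).
  by rewrite (orthonormal_rank WW) mxrank_ker mxrank_tr rF nE addnK.
by have := mxrank_leqif_eq s; rewrite e => -[_ <-].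
Qed.

Lemma dotv_mulmx_tr j n (x : 'rV[R]_n) (U : 'M[R]_(j, n)) (v : 'rV[R]_j) :
  dotv x (v *m U) = dotv (x *m U^T) v.
Proof. by rewrite dotvC dotv_mulmx dotvC. Qed.

Lemma face_transfer m j n (P Q : set 'rV[R]_n) (F : 'M[R]_n) :
  n = (m.+1 + j.+1)%N -> polytope P ->
  compact P -> convex_set P -> P !=set0 -> origin_symmetric P ->
  compact Q -> convex_set Q -> Q !=set0 -> origin_symmetric Q ->
  proj_eq m.+1 j.+1 P Q -> \rank F = j.+1 ->
  has_face_parallel P j.+1 F -> has_face_parallel Q m.+1 (perp F).
Proof.
move=> nE [k [p PE]] cP vP P0 sP cQ vQ Q0 sQ PQ rF [u0].
rewrite -/(face P u0); set G := face P u0 => -[Gd [M [/eqmxP MF Md]]].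
have [U [UU /[dup] UFb /eqmxP UF]] := ex_orthonormal rF.
have nE' : n = (j.+1 + m.+1)%N by rewrite addnC.
have [W /frameC fr] := ex_frame nE' UU.
have /eqmxP Wp := frame_perp nE fr UFb.
case: (fr) => WW _ WU; have [_ _ UW] := frameC fr.
have enW (w : 'rV[R]_m.+1) : enorm (w *m W) = enorm w.
  by rewrite /enorm dotv_mulmx -mulmxA WW mulmx1.
have perpW x w : (x <= F)%MS -> dotv x (w *m W) = 0.
  rewrite -UF => /submxP[D ->]; rewrite dotv_mulmx -mulmxA WU mulmx0 dotv0r//.
have Meq : (M :=: U)%MS by apply: eqmx_trans MF (eqmx_sym UF).
(* Differences of points of [G] span [F], and [u0] is constant on [G]; hence [u0] is a combination
   [w0 *m W]. *)
have u0U : u0 *m U^T = 0.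
  have u0M : u0 *m M^T = 0.
    apply/eqP; rewrite mulmx_eq0_perp; apply/forallP => i; apply/eqP.
    have [x [y [[Px xm] [[Py ym] ->]]]] := Md i.
    have := xm _ Py; have := ym _ Px.
    by rewrite dotvBr ![dotv u0 _]dotvC; lra.
  have /submxP[D ->] : (U <= M)%MS by rewrite Meq.
  by rewrite trmx_mul mulmxA u0M mul0mx.
have u0E : u0 = (u0 *m W^T) *m W.
  by rewrite -[LHS](frame_decomp u0 nE fr) u0U mul0mx addr0.
set w0 := u0 *m W^T in u0E.
have [x0 Gx0] : G !=set0 by exact: face_nonempty.
have cst x w : G x -> dotv x (w *m W) = dotv x0 (w *m W).
  by move=> Gx; apply/eqP; rewrite -subr_eq0 -dotvBl perpW//; exact: Gd.
have Pp i : P (p i).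
  rewrite PE; exists (fun l => (l == i)%:R); split; first by move=> l; rewrite ler0n.
  split; first by rewrite (bigD1 i)//= eqxx big1 ?addr0// => l /negbTE ->.
  by rewrite (bigD1 i)//= eqxx scale1r big1 ?addr0// => l /negbTE ->; rewrite scale0r.
(* A vertex in [G] ties with [x0] for every [w]; any other vertex is lower by a gap [g], which
   survives small changes of [w] by Cauchy-Schwarz. *)
have [d d0 dP] : exists2 d : R, 0 < d & forall i, forall w, enorm (w - w0) <= d ->
    dotv (p i) (w *m W) <= dotv x0 (w *m W).
  apply: finite_eps => [i d e /andP[_ de] h w wd|i]; first by apply: h; exact: le_trans de.
  have [Gi|nGi] := pselect (G (p i)); first by exists 1 => // w _; rewrite cst.
  have g0 : 0 < dotv x0 u0 - dotv (p i) u0.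
    rewrite subr_gt0 ltNge; apply/negP => h; apply: nGi; split => // y Py.
    by apply: le_trans h; case: Gx0 => _; exact.
  set g := _ - _ in g0; have B0 : 0 < enorm (p i - x0) + 1 by rewrite ltr_wpDl ?enorm_ge0.
  exists (g / (enorm (p i - x0) + 1)); first by rewrite divr_gt0.
  move=> w wd; rewrite -subr_le0 -dotvBl.
  have -> : w *m W = u0 + (w - w0) *m W by rewrite {1}u0E -mulmxDl addrC subrK.
  rewrite dotvDr dotvBl.
  have h1 := cauchy_schwarz (p i - x0) ((w - w0) *m W); rewrite enW in h1.
  have h2 : (enorm (p i - x0) + 1) * enorm (w - w0) <= g by rewrite mulrC -ler_pdivlMr.
  have := enorm_ge0 (w - w0); rewrite mulrDl mul1r in h2; move: h1 h2; rewrite /g; lra.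
have GW w : enorm (w - w0) <= d -> G `<=` face P (w *m W).
  move=> wd x Gx; split; first by case: Gx.
  move=> y; rewrite PE => -[l [l0 [l1 ->]]]; rewrite dotv_suml cst//.
  rewrite -[leRHS]mul1r -l1 mulr_suml; apply: ler_sum => i _.
  by rewrite dotvZl ler_wpM2l//; exact: dP.
have cG : compact (img G U) by apply: compact_imgmx; exact: compact_face.
have g0 : (0 < mu j.+1 (img G U))%E.
  apply: mu_open_gt0; first exact: compact_measurable_mx.
  apply: (@interior_of_differences _ _ (M *m U^T)).
  - move=> _ _ t [x Gx ->] [y Gy ->] t01.
    exists (t *: x + (1 - t) *: y); last by rewrite mulmxDl !scalemxAl.
    exact: convex_face.
  - by exists (x0 *m U^T); exists x0.
  - have /submxP[D DE] : (M <= U)%MS by rewrite Meq.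
    rewrite -row_free_unit -row_leq_rank DE -mulmxA UU mulmx1.
    apply: leq_trans (mxrankM_maxl D U).
    by rewrite -DE Meq (orthonormal_rank UU).
  - move=> i; have [x [y [Gx [Gy xyE]]]] := Md i.
    exists (x *m U^T), (y *m U^T); split; [by exists x|by exists y|].
    by rewrite row_mul xyE mulmxBl.
have [c [aeP aeQ _ _]] := ae_const_Mset cP vP P0 sP cQ vQ Q0 sQ PQ fr.
have c0 : 0 < c.
  have [w Bw wE] := ae_ex_in aeP (measurable_eball_at w0 d) (mu_eball_gt0 w0 d0).
  rewrite -lte_fin -wE; apply: lt_le_trans g0 _; apply: le_measure; rewrite ?inE.
  - exact: compact_measurable_mx.
  - exact: measurable_Mset.
  - by move=> _ [x Gx ->]; exists x => //; exact: GW.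
have Q0' : img Q U !=set0 by case: Q0 => x Qx; exists (x *m U^T); exists x.
(* For this [v] the face of [Q] has shadow volume [c] on [W] and a single point as shadow on [U]. *)
have [v [vc vu]] := ae_ex (filterI aeQ (ae_face_unique (compact_imgmx (A := U) cQ) Q0')).
have dU x y : face Q (v *m U) x -> face Q (v *m U) y -> (x - y) *m U^T = 0.
  move=> fx fy; apply/eqP; rewrite mulmxBl subr_eq0; apply/eqP; apply: vu.
    split; first by exists x => //; case: fx.
    by move=> _ [z Qz ->]; rewrite -!dotv_mulmx_tr; case: fx => _; exact.
  split; first by exists y => //; case: fy.
  by move=> _ [z Qz ->]; rewrite -!dotv_mulmx_tr; case: fy => _; exact.
have dE x y : face Q (v *m U) x -> face Q (v *m U) y -> x - y = ((x - y) *m W^T) *m W.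
  by move=> fx fy; rewrite -[LHS](frame_decomp _ nE fr) dU// mul0mx addr0.
have mM := measurable_Mset W (v *m U) cQ.
have [|N uN Nd] := ex_indep_differences mM; first by rewrite vc lte_fin.
exists (v *m U); split.
  by move=> x y fx fy; rewrite -Wp (dE x y)// submxMl.
exists (N *m W); split.
  apply/eqmxP; apply: eqmx_trans Wp; apply: eqmxMfull; by rewrite row_full_unit.
move=> i; have [_ [_ [[x fx ->] [y fy ->] xyE]]] := Nd i.
exists x, y; split => //; split => //.
by rewrite row_mul xyE -mulmxBl -dE.
Qed.

End Faces.

(** * Stability of the optimum of a linear program *)

Section LinearProgram.
Variable R : realType.
Local Notation mu := (mu R).
Variables (k l n : nat) (p : 'I_k -> 'rV[R]_n) (e : 'M[R]_(l, n)).

Definition hull : set 'rV[R]_n := [set x | exists l : 'I_k -> R, (forall i, 0 <= l i) /\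
  \sum_(i < k) l i = 1 /\ x = \sum_(i < k) l i *: p i].

Definition comb (a : 'I_k -> R) : 'rV[R]_n := \sum_(i < k) a i *: p i.

Definition supp_in (I : {set 'I_k}) (a : 'I_k -> R) := forall i, i \notin I -> a i = 0.

Definition carrier (a : 'I_k -> R) : {set 'I_k} := finset (fun i => a i != 0).

(** Affine independence of the shadows on [e]: such an [I] is the index set of a basic solution of
    the linear program that maximises over a fiber. *)
Definition aff_indep (I : {set 'I_k}) := forall b, supp_in I b -> \sum_i b i = 0 ->
  comb b *m e^T = 0 -> forall i, b i = 0.

(** Weights are updated in the form [a i + t * b i], with [t = -1] for differences and [a = 0] for
    multiples, so that this lemma and [sumD] cover all cases. *)
Lemma combD a b (t : R) : comb (fun i => a i + t * b i) = comb a + t *: comb b.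
Proof.
rewrite /comb scaler_sumr -big_split /=; apply: eq_bigr => i _.
by rewrite scalerDl scalerA.
Qed.

Lemma sumD (a b : 'I_k -> R) (t : R) : \sum_i (a i + t * b i) = \sum_i a i + t * \sum_i b i.
Proof. by rewrite big_split mulr_sumr. Qed.

Lemma comb_delta i : comb (fun l => (l == i)%:R) = p i.
Proof.
rewrite /comb (bigD1 i)//= eqxx scale1r big1 ?addr0// => j /negbTE ->.
by rewrite scale0r.
Qed.

Lemma sum_delta i : \sum_(l < k) (l == i)%:R = 1 :> R.
Proof. by rewrite (bigD1 i)//= eqxx big1 ?addr0// => j /negbTE ->. Qed.

Lemma convex_hull : convex_set hull.
Proof.
move=> x y t [a [a0 [a1 ->]]] [b [b0 [b1 ->]]] /andP[t0 t1].
exists (fun i => t * a i + (1 - t) * b i); split.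
  by move=> i; rewrite addr_ge0// mulr_ge0// subr_ge0.
split; first by rewrite big_split -!mulr_sumr a1 b1 !mulr1 /= addrC subrK.
rewrite !scaler_sumr -big_split /=; apply: eq_bigr => i _.
by rewrite !scalerA -scalerDl.
Qed.

(** A basic optimal solution: take optimal weights of least support. A dependency among the shadows
    would allow a move that keeps optimality and annihilates a weight. *)
Lemma ex_min_support z u : compact hull -> img hull e z -> exists a,
  [/\ forall i, 0 <= a i, \sum_i a i = 1, face (fib hull e z) u (comb a) &
    aff_indep (carrier a)].
Proof.
move=> cP zP.
pose ok a := [/\ forall i, 0 <= a i, \sum_i a i = 1 & face (fib hull e z) u (comb a)].
pose S N := `[< exists2 a, ok a & #|(carrier a)| = N >].
have exN : exists N, S N.
  have [x fx] := face_nonempty u (compact_fib (e := e) (z := z) cP) (fib_nonempty zP).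
  have [[[a [a0 [a1 xE]]] _] _] := fx.
  exists #|(carrier a)|; apply/asboolP; exists a => //.
  by split => //; rewrite /comb -xE.
case: (ex_minnP exN) => N /asboolP[a [a0 a1 fa] aN] Nmin.
exists a; split => // b bI b0 be.
apply: contrapT => /existsNP[i0 /eqP bi0].
(* Negating the dependency if necessary, the move does not lower the objective. *)
wlog bu : b bI b0 be bi0 / 0 <= dotv (comb b) u => [hw|].
  have [|lt] := leP 0 (dotv (comb b) u); first exact: hw.
  pose b' i := 0 + (-1) * b i.
  have cb' : comb b' = - comb b.
    by rewrite combD scaleN1r /comb big1 ?add0r// => i _; rewrite scale0r.
  apply: (hw b').
  - by move=> i /bI; rewrite /b' => ->; rewrite mulr0 addr0.
  - by rewrite sumD b0 mulr0 addr0 big1.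
  - by rewrite cb' mulNmx be oppr0.
  - by rewrite /b' add0r mulN1r oppr_eq0.
  - by rewrite cb' dotvNl oppr_ge0 ltW.
have [i2 bi2] : exists i, b i < 0.
  apply: contrapT => h.
  have bp i : true -> 0 <= b i.
    by move=> _; rewrite leNgt; apply/negP => ?; apply: h; exists i.
  by move: bi0; rewrite (psumr_eq0P bp b0)// eqxx.
have [i1 bi1 i1m] : exists2 i1, b i1 < 0 & forall i, b i < 0 -> a i1 / - b i1 <= a i / - b i.
  exact: (fin_argmin (fun i => a i / - b i) bi2).
(* The ratio test: the first weight to reach 0 is that of [i1]. *)
pose t := a i1 / - b i1.
have t0 : 0 <= t by rewrite divr_ge0// oppr_ge0 ltW.
pose a' i := a i + t * b i.
have a'0 i : 0 <= a' i.
  rewrite /a'; have [bi|bi] := ltP (b i) 0; last by rewrite addr_ge0// mulr_ge0.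
  have := i1m i bi; rewrite -/t ler_pdivlMr ?oppr_gt0// mulrN; lra.
have fa' : face (fib hull e z) u (comb a').
  case: (fa) => [[Pa az] am].
  have Fa' : fib hull e z (comb a').
    split; last by rewrite combD mulmxDl -scalemxAl be scaler0 addr0.
    by exists a'; split => //; split => //; rewrite sumD b0 mulr0 addr0.
  split => // y /am h; apply: (le_trans h).
  by rewrite combD dotvDl dotvZl lerDl mulr_ge0.
have ok' : ok a' by split => //; rewrite sumD b0 mulr0 addr0.
have : (N <= #|(carrier a')|)%N by apply: Nmin; apply/asboolP; exists a'.
rewrite leqNgt => /negP; apply; rewrite -aN; apply: proper_card.
apply/properP; split.
  apply/fintype.subsetP => i; rewrite !inE; apply: contraNN => /eqP ai.
  by rewrite /a' ai bI ?mulr0 ?addr0// inE ai eqxx.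
exists i1; rewrite inE.
  by apply/negP => /eqP ai; move: bi1; rewrite bI ?ltxx// inE ai eqxx.
rewrite negbK /a' /t; apply/eqP; field.
by rewrite lt_eqF.
Qed.

(** With [a] the affine coordinates of the shadow of [p i'] in the basis [I], the pairing with [u]
    is the reduced cost of [i']. The bound prevents a perturbation [s v], [|s| <= eps], from
    reversing its sign. *)
Definition reduced_cost_eps (u v : 'rV[R]_n) (eps : R) := forall I a i',
  aff_indep I -> supp_in I a -> \sum_i a i = 1 -> comb a *m e^T = p i' *m e^T ->
  eps * `|dotv (p i' - comb a) v| <= `|dotv (p i' - comb a) u|.

(** Nondegeneracy: [z] lies in the affine hull of the shadows of [I] only if that hull contains the
    shadows of all vertices. *)
Definition generic_fiber (z : 'rV[R]_l) := forall I a i', supp_in I a ->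
  \sum_i a i = 1 -> comb a *m e^T = z ->
  exists b, [/\ supp_in I b, \sum_i b i = 1 & comb b *m e^T = p i' *m e^T].

(** A basic optimal solution for [u] has nonpositive reduced costs; by the choice of [eps] they
    remain so for [u + s v], and nonpositive reduced costs imply optimality. *)
Lemma stable_optimum z u v eps : compact hull -> img hull e z -> 0 <= eps ->
  generic_fiber z -> reduced_cost_eps u v eps ->
  exists x, forall s, `|s| <= eps -> face (fib hull e z) (u + s *: v) x.
Proof.
move=> cP zP e0 gz re.
have [a [a0 a1 fa ai]] := ex_min_support u cP zP.
set I := (carrier a) in ai.
have aI : supp_in I a by move=> i; rewrite inE negbK => /eqP.
have [[Pa az] am] := fa.
have [al alP] := choice (fun i' => gz I a i' aI a1 az).
have du i' : dotv (p i' - comb (al i')) u <= 0.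
  have [alI al1 ale] := alP i'.
  set d := p i' - comb (al i').
  pose g i := (i == i')%:R + (-1) * al i' i.
  have gE : comb g = d by rewrite combD comb_delta scaleN1r.
  have g0 : \sum_i g i = 0 by rewrite sumD sum_delta al1 mulr1 subrr.
  (* The exchange [g] is negative only at indices in the carrier, whose weights are positive, so a
     small step is feasible; optimality then bounds the reduced cost. *)
  have [t t0 tP] : exists2 t : R, 0 < t & forall i, 0 <= a i + t * g i.
    apply: finite_eps => [i d' e' /andP[d'0 de'] h|i].
      have := a0 i; have [gi|gi] := leP 0 (g i) => ai0.
        by rewrite addr_ge0// mulr_ge0// ltW.
      by apply: (le_trans h); rewrite lerD2l ler_nM2r.
    have [gi|gi] := leP 0 (g i); first by exists 1 => //; rewrite mul1r addr_ge0.
    have ip : 0 < a i.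
      rewrite lt_neqAle a0 andbT eq_sym; apply/negP => /eqP ai0.
      move: gi; rewrite /g alI ?inE ?ai0 ?eqxx// mulr0 addr0 ltNge ler0n//.
    exists (a i / - g i); first by rewrite divr_gt0// oppr_gt0.
    by rewrite invrN mulrN mulNr mulfVK ?subrr// lt_eqF.
  have Pn : fib hull e z (comb (fun i => a i + t * g i)).
    split.
      by exists (fun i => a i + t * g i); split => //; split => //; rewrite sumD g0 mulr0 addr0.
    rewrite combD mulmxDl -scalemxAl az gE /d mulmxBl ale subrr scaler0 addr0//.
  have := am _ Pn; rewrite combD gE dotvDl dotvZl gerDl.
  by rewrite pmulr_rle0.
exists (comb a) => s se; split => // x [[b [b0 [b1 xE]]] xz].
(* Rewriting the weights of a competitor [x] in the basis [I] gives weights on [I] with the shadow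
   of [a], hence [a] itself. So [x - comb a] is a nonnegative combination of the reduced
   differences. *)
pose c i := \sum_i' b i' * al i' i.
have ac i : a i + (-1) * c i = 0.
  move: i; apply: ai.
  - move=> i iI; rewrite aI// add0r mulN1r /c big1 ?oppr0// => i' _.
    by have [alI _ _] := alP i'; rewrite alI// mulr0.
  - rewrite sumD a1 /c exchange_big /=.
    under eq_bigr => i' _ do (have [_ al1 _] := alP i'; rewrite -mulr_sumr al1 mulr1).
    by rewrite b1 mulr1 subrr.
  - rewrite combD mulmxDl az -scalemxAl scaleN1r.
    have -> : comb c = \sum_i' b i' *: comb (al i').
      rewrite /comb /c; under eq_bigr do rewrite scaler_suml.
      rewrite exchange_big /=; apply: eq_bigr => i' _.
      by rewrite scaler_sumr; apply: eq_bigr => i _; rewrite scalerA.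
    rewrite mulmx_suml.
    under eq_bigr => i' _ do (have [_ _ ale] := alP i'; rewrite -scalemxAl ale scalemxAl).
    by rewrite -mulmx_suml -xE xz subrr.
have xaE : x - comb a = \sum_i' b i' *: (p i' - comb (al i')).
  have -> : comb a = comb c.
    by rewrite /comb; apply: eq_bigr => i _; congr (_ *: _); have := ac i; lra.
  have -> : comb c = \sum_i' b i' *: comb (al i').
    rewrite /comb /c; under eq_bigr do rewrite scaler_suml.
    rewrite exchange_big /=; apply: eq_bigr => i' _.
    by rewrite scaler_sumr; apply: eq_bigr => i _; rewrite scalerA.
  rewrite xE -sumrB; apply: eq_bigr => i' _; by rewrite scalerBr.
rewrite -subr_le0 -dotvBl xaE dotv_suml; apply: sumr_le0 => i' _.
rewrite dotvZl mulr_ge0_le0//.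
have [alI al1 ale] := alP i'.
have h1 := du i'; have h2 := re I (al i') i' ai alI al1 ale.
rewrite dotvDr dotvZr.
have h3 : s * dotv (p i' - comb (al i')) v <= eps * `|dotv (p i' - comb (al i')) v|.
  apply: le_trans (ler_norm _) _; rewrite normrM ler_wpM2r//.
rewrite (ler0_norm h1) in h2; lra.
Qed.

(** Independence of [I] leaves one reduced difference for each of the finitely many pairs (I, i'),
    so a common [eps] exists once a vanishing cost for [u] also vanishes for [v]. *)
Lemma ex_reduced_cost_eps u v :
  (forall I a i', aff_indep I -> supp_in I a -> \sum_i a i = 1 ->
    comb a *m e^T = p i' *m e^T -> dotv (p i' - comb a) u = 0 ->
    dotv (p i' - comb a) v = 0) ->
  exists2 eps : R, 0 < eps & reduced_cost_eps u v eps.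
Proof.
move=> h.
have [eps eps0 epsP] : exists2 eps : R, 0 < eps & forall t : {set 'I_k} * 'I_k,
    forall a, aff_indep t.1 -> supp_in t.1 a -> \sum_i a i = 1 ->
    comb a *m e^T = p t.2 *m e^T ->
    eps * `|dotv (p t.2 - comb a) v| <= `|dotv (p t.2 - comb a) u|.
  apply: finite_eps => [t d d' /andP[_ dd'] hd a aI sa a1 ae|[I i'] /=].
    by apply: le_trans (hd a aI sa a1 ae); rewrite ler_wpM2r.
  have [[a [aI sa a1 ae]]|nx] := pselect (exists a, [/\ aff_indep I, supp_in I a,
      \sum_i a i = 1 & comb a *m e^T = p i' *m e^T]); last first.
    by exists 1 => // a aI sa a1 ae; case: nx; exists a.
  have un a' : supp_in I a' -> \sum_i a' i = 1 -> comb a' *m e^T = p i' *m e^T ->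
      comb a' = comb a.
    move=> sa' a1' ae'; rewrite /comb; apply: eq_bigr => i _; congr (_ *: _).
    have : a' i + (-1) * a i = 0.
      move: i; apply: aI.
      - by move=> i iI; rewrite sa// sa'// mulr0 addr0.
      - by rewrite sumD a1 a1' mulr1 subrr.
      - by rewrite combD scaleN1r mulmxBl ae ae' subrr.
    by lra.
  have [du0|dun] := eqVneq (dotv (p i' - comb a) u) 0.
    exists 1 => // a' _ sa' a1' ae'; rewrite un// (h I a i')// normr0 mulr0//.
  set A := dotv _ u in dun *; set B := dotv (p i' - comb a) v.
  have B1 : 0 < `|B| + 1 by rewrite ltr_wpDl.
  exists (`|A| / (`|B| + 1)); first by rewrite divr_gt0// normr_gt0.
  move=> a' _ sa' a1' ae'; rewrite un// -/A -/B mulrAC ler_pdivrMr//.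
  by rewrite ler_wpM2l// lerDl.
exists eps => // I a i' aI sa a1 ae; exact: (epsP (I, i')).
Qed.

(** If the affine hull of the shadows of [I] misses the shadow of some [p i'], it lies in a
    hyperplane, which is null; there are finitely many such pairs. *)
Lemma ae_generic_fiber : {ae mu l, forall z, generic_fiber z}.
Proof.
have key (t : {set 'I_k} * 'I_k) : {ae mu l, forall z, forall a, supp_in t.1 a ->
  \sum_i a i = 1 -> comb a *m e^T = z ->
  exists b, [/\ supp_in t.1 b, \sum_i b i = 1 & comb b *m e^T = p t.2 *m e^T]}.
  case: t => I i' /=.
  have [ex|nex] := pselect (exists b, [/\ supp_in I b, \sum_i b i = 1 & comb b *m e^T = p i' *m e^T]).
    by apply: filterE.
  (* The leading 1 turns affine relations between shadows into linear ones. *)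
  pose w i : 'rV[R]_(1 + l) := row_mx 1%:M (p i *m e^T).
  pose M : 'M[R]_(k, 1 + l) := \matrix_i (if i \in I then w i else 0).
  have wsum a : supp_in I a -> (\row_i a i) *m M = row_mx (\sum_i a i)%:M (comb a *m e^T).
    move=> sa; rewrite mulmx_sum_row.
    have -> : \sum_i (\row_i a i) 0 i *: row i M = \sum_i a i *: w i.
      apply: eq_bigr => i _; rewrite mxE rowK; case: ifPn => // /sa ->.
      by rewrite !scale0r.
    rewrite /w; under eq_bigr do rewrite scale_row_mx scalemx1 scalemxAl.
    rewrite /comb mulmx_suml.
    elim/big_ind3: _ => [|x1 x2 y1 y2 z1 z2 -> ->|//]; first by rewrite raddf0 row_mx0.
    by rewrite add_row_mx raddfD.
  have nw : ~~ (w i' <= M)%MS.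
    apply/negP => /submxP[D DE]; apply: nex.
    pose b i := if i \in I then D 0 i else 0.
    have sb : supp_in I b by move=> i /negbTE iI; rewrite /b iI.
    have : (\row_i b i) *m M = w i'.
      rewrite DE !mulmx_sum_row; apply: eq_bigr => i _; rewrite rowK mxE /b.
      by case: ifP => // _; rewrite !scaler0.
    rewrite wsum// => /eq_row_mx[/(congr1 (fun x : 'M[R]_1 => x 0 0)) h1 h2].
    by exists b; split => //; move: h1; rewrite !mxE eqxx !mulr1n.
  have [c0 c0P] : exists c0, (w i' *m cokermx M) 0 c0 != 0.
    apply: contrapT => h; move/negP: nw; apply; rewrite submxE; apply/eqP/rowP => c; rewrite [RHS]mxE.
    by apply/eqP; apply: contrapT => /negP ?; apply: h; exists c.
  (* A linear form that vanishes on the lifted shadows of [I] but not on that of [i']; it supplies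
     the equation of the hyperplane. *)
  pose c : 'cV[R]_(1 + l) := cokermx M *m delta_mx c0 0.
  have Mc : M *m c = 0 by rewrite /c mulmxA mulmx_coker mul0mx.
  pose c1 : R := usubmx c 0 0; pose c2 : 'rV[R]_l := (dsubmx c)^T.
  have wc (t : R) (y : 'rV[R]_l) : (row_mx t%:M y *m c) 0 0 = t * c1 + dotv y c2.
    rewrite -[c]vsubmxK mul_row_col mxE mul_scalar_mx mxE /dotv trmxK//.
  have wi' : c1 + dotv (p i' *m e^T) c2 != 0.
    have -> : c1 + dotv (p i' *m e^T) c2 = (w i' *m c) 0 0 by rewrite /w wc mul1r.
    by rewrite /c mulmxA -colE [X in X != 0]mxE.
  have zc a : supp_in I a -> \sum_i a i = 1 -> c1 + dotv (comb a *m e^T) c2 = 0.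
    move=> sa a1; rewrite -[X in X + _]mul1r -wc -a1 -wsum// -mulmxA Mc mulmx0 mxE//.
  have [c20|c2n] := eqVneq c2 0.
    apply: filterE => z a sa a1 _; move: wi'; have := zc a sa a1.
    by rewrite c20 !dotv0r addr0 => ->; rewrite eqxx.
  pose q : 'rV[R]_l := - (c1 / dotv c2 c2) *: c2.
  exists [set z | dotv (z - q) c2 = 0]; split.
  - apply: closed_measurable_mx.
    apply: (@closed_preim _ _ (fun x : 'rV[R]_l => dotv (x - q) c2) [set 0]).
      apply: cont_dotv; last exact: cst_continuous.
      by apply: cont_sub; [exact: cont_id|exact: cst_continuous].
    exact: (accessible_closed_set1 (hausdorff_accessible (@norm_hausdorff R R^o))).
  - exact: mu_hyperplane0.
  - move=> z /= /existsNP[a /not_implyP[sa /not_implyP[a1 /not_implyP[az _]]]].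
    rewrite -az dotvBl /q dotvZl mulNr mulfVK ?opprK; last by rewrite gt_eqF// dotv_gt0.
    by rewrite addrC zc.
have : {ae mu l, forall z, forall t : {set 'I_k} * 'I_k, forall a, supp_in t.1 a ->
  \sum_i a i = 1 -> comb a *m e^T = z ->
  exists b, [/\ supp_in t.1 b, \sum_i b i = 1 & comb b *m e^T = p t.2 *m e^T]}.
  apply: filter_forall => t; exact: key.
by apply: filterS => z h I a i' sa a1 az; exact: (h (I, i') a).
Qed.

(** The direction space of the affine hull of the points [p i *m pi], [i] in [J]. *)
Definition dir_space (pi : 'M[R]_n) (J : {set 'I_k}) (y : 'rV[R]_n) :=
  exists a, [/\ supp_in J a, \sum_i a i = 0 & comb a *m pi = y].

Lemma dir_spaceD pi J x y (s t : R) : dir_space pi J x -> dir_space pi J y ->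
  dir_space pi J (s *: x + t *: y).
Proof.
move=> [a [sa a0 aE]] [b [sb b0 bE]].
exists (fun i => (0 + s * a i) + t * b i); split.
- by move=> i iJ; rewrite sa// sb// !mulr0 !addr0.
- by rewrite !sumD a0 b0 !mulr0 !addr0 big1.
- rewrite !combD !mulmxDl -!scalemxAl aE bE.
  by rewrite /comb big1 ?mul0mx ?add0r// => i _; rewrite scale0r.
Qed.

(** If a reduced difference [d] is orthogonal to [u] but not to [v], then [d *m pi] is a nonzero
    multiple of [v], so the direction space of [I] and [i'] contains [v], hence [u]. As the shadows
    of [I] are independent, [u] would then be a multiple of [d *m pi], that is, of [v]. *)
Lemma generic_reduced_cost (u v : 'rV[R]_n) (pi : 'M[R]_n) :
  pi = u^T *m u + v^T *m v + e^T *m e -> u *m u^T = 1%:M ->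
  u *m v^T = 0 -> u *m e^T = 0 -> v *m e^T = 0 -> e *m e^T = 1%:M ->
  (forall J, dir_space pi J v -> dir_space pi J u) ->
  exists2 eps : R, 0 < eps & reduced_cost_eps u v eps.
Proof.
move=> piE uu uv ue ve ee C; apply: ex_reduced_cost_eps => I a i' iI sa a1 ae du0.
set d := p i' - comb a in du0 *.
apply/eqP; apply: contrapT => /negP dvn.
pose g i := (i == i')%:R + (-1) * a i.
have gE : comb g = d by rewrite combD comb_delta scaleN1r.
have g0 : \sum_i g i = 0 by rewrite sumD sum_delta a1 mulr1 subrr.
have de : d *m e^T = 0 by rewrite mulmxBl ae subrr.
have [i'I|i'I] := boolP (i' \in I).
  have gz : forall i, g i = 0.
    apply: iI => //; last by rewrite gE.
    move=> i iI; rewrite /g sa// mulr0 addr0.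
    by case: eqVneq => // ii'; move: iI; rewrite ii' i'I.
  move: dvn; rewrite -gE /comb big1 ?dotv0l ?eqxx// => i _.
  by rewrite gz scale0r.
have dpi : d *m pi = dotv d v *: v.
  rewrite piE !mulmxDr !mulmxA de mul0mx addr0 !mul_trmx_dotv du0.
  by rewrite !mul_scalar_mx scale0r add0r.
have [] := C (i' |: I).
  exists (fun i => 0 + (dotv d v)^-1 * g i); split.
  - move=> i; rewrite !inE negb_or => /andP[ii' niI].
    by rewrite /g (negbTE ii') sa// mulr0 addr0 mulr0 addr0.
  - by rewrite sumD g0 mulr0 addr0 big1.
  - rewrite combD gE mulmxDl -scalemxAl dpi scalerA mulVf// scale1r.
    by rewrite /comb big1 ?mul0mx ?add0r// => i _; rewrite scale0r.
move=> b [sb b0 bu].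
have pie : pi *m e^T = e^T.
  rewrite piE !mulmxDl -!mulmxA ue ve ee !mulmx0 mulmx1 !add0r//.
(* Subtracting the multiple of [g] removes the index [i'] and leaves a dependency on [I] alone. *)
have bz : forall i, b i + (- b i') * g i = 0.
  apply: iI.
  - move=> i iI; have [->|ii'] := eqVneq i i'.
      by rewrite /g eqxx sa// mulr0 addr0 mulr1 subrr.
    rewrite sb; last by rewrite !inE negb_or ii'.
    by rewrite /g (negbTE ii') sa// mulr0 addr0 mulr0 addr0.
  - by rewrite sumD b0 g0 mulr0 addr0.
  - rewrite combD gE mulmxDl -scalemxAl de scaler0 addr0.
    by rewrite -pie mulmxA bu ue.
have : comb b = b i' *: d.
  rewrite -gE /comb scaler_sumr; apply: eq_bigr => i _; rewrite scalerA.
  by congr (_ *: _); have := bz i; lra.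
move=> cb; move: bu; rewrite cb -scalemxAl dpi scalerA => uE.
have vu : v *m u^T = 0 by apply: (can_inj trmxK); rewrite trmx_mul trmxK uv trmx0.
have := uu; rewrite -{1}uE -scalemxAl vu scaler0 => /matrixP/(_ 0 0).
by rewrite !mxE eqxx => /eqP; rewrite eq_sym oner_eq0.
Qed.

(** On a generic fiber the maximisers for [u] and [-u] do not change during the rotation, so the
    width is affine in [s]. *)
Lemma integral_fibdiff_hull u v eps : compact hull -> 0 < eps ->
  reduced_cost_eps u v eps ->
  (\int[mu l]_z (fibdiff hull e u v eps z)%:E = 0)%E.
Proof.
move=> cP e0 re.
have vP := convex_hull.
rewrite -[RHS](integral0 (mu l) setT).
apply: ge0_ae_eq_integral => //.
- exact: measurable_fibdiff.
- by move=> z _; rewrite lee_fin fibdiff_ge0.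
apply: filterS ae_generic_fiber => z gz _; congr EFin; rewrite /fibdiff /fibwidth.
case: ifPn => [/set_mem zP|_]; last by rewrite mulr0 subr0 addr0.
have reN : reduced_cost_eps (- u) v eps.
  by move=> I a i' h1 h2 h3 h4; rewrite dotvNr normrN; exact: (re I).
have [x xP] := stable_optimum cP zP (ltW e0) gz re.
have [y yP] := stable_optimum cP zP (ltW e0) gz reN.
have n1 : `|eps| <= eps by rewrite gtr0_norm.
have n2 : `|- eps| <= eps by rewrite normrN gtr0_norm.
have n0 : `|0 : R| <= eps by rewrite normr0 ltW.
have s1 := suppE (xP _ n1); have s2 := suppE (xP _ n2); have s3 := suppE (xP _ n0).
have t1 := suppE (yP _ n1); have t2 := suppE (yP _ n2); have t3 := suppE (yP _ n0).
rewrite scale0r addr0 in s3; rewrite scale0r addr0 in t3.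
rewrite scaleNr in s2; rewrite scaleNr in t2.
rewrite /width !opprD opprK s1 s2 s3 t1 t2 t3 !dotvDr !dotvNr.
ring.
Qed.

End LinearProgram.

(** * Regular normals *)

Section Regular.
Variable R : realType.
Local Notation mu := (mu R).

(** The inner ball with centre [c] and radius [rho] touches the supporting hyperplane with normal
    [nu] at [c + rho nu]. *)
Definition regular_normal n (Q : set 'rV[R]_n) (nu : 'rV[R]_n) := dotv nu nu = 1 /\
  exists c rho, [/\ 0 < rho, forall b, enorm b <= rho -> Q (c + b) &
    forall x, Q x -> dotv x nu <= dotv c nu + rho].

Lemma dotv0_mx n (x y : 'rV[R]_n) : x *m y^T = 0 -> dotv x y = 0.
Proof. by rewrite /dotv => ->; rewrite mxE. Qed.

Lemma dotv1_mx n (x y : 'rV[R]_n) : x *m y^T = 1%:M -> dotv x y = 1.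
Proof. by rewrite /dotv => ->; rewrite mxE eqxx. Qed.

(* The ball touching Q at x0 bends away from the supporting hyperplane at a
   definite rate on both sides, and this persists on the fibers close to x0. *)
Lemma fibdiff_regular n q (Q : set 'rV[R]_n) (e : 'M[R]_(q, n)) (u v nu : 'rV[R]_n)
    (t : 'rV[R]_q) (c eps : R) : compact Q -> convex_set Q ->
  u *m u^T = 1%:M -> v *m v^T = 1%:M -> u *m v^T = 0 -> u *m e^T = 0 ->
  v *m e^T = 0 -> e *m e^T = 1%:M -> nu = c *: v + t *m e -> 0 < c -> 0 < eps ->
  regular_normal Q nu -> (\int[mu q]_z (fibdiff Q e v u eps z)%:E <> 0)%E.
Proof.
move=> cQ vQ uu vv uv ue ve ee nuE c0 eps0 [nu1 [y0 [rho [rho0 Qb Qh]]]] int0.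
have duu := dotv1_mx uu; have dvv := dotv1_mx vv; have duv := dotv0_mx uv.
have dte w x : w *m e^T = 0 -> dotv (x *m e) w = 0.
  by move=> we; rewrite dotv_mulmx we dotv0r.
have ct : c ^+ 2 + dotv t t = 1.
  rewrite -nu1 nuE !dotvDl !dotvDr !dotvZl !dotvZr dvv dte// [dotv v _]dotvC dte//.
  by rewrite dotv_mulmx -mulmxA ee mulmx1; ring.
pose N := Num.sqrt (1 + eps ^+ 2).
have NN : N ^+ 2 = 1 + eps ^+ 2 by rewrite sqr_sqrtr// addr_ge0// sqr_ge0.
have N1 : 1 < N.
  by rewrite -[ltLHS]sqrtr1 ltr_sqrt ?ltrDl ?exprn_gt0// ltr_wpDr// sqr_ge0.
have Np : 0 < N by apply: lt_trans N1.
(* [N] is the length of [v + eps u] and of [v - eps u]. With [th < 1] there is room left in the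
   ball, while [th N > 1] is the relative gain [1 + eta] in height. *)
pose th := (1 + N^-1) / 2.
have Ni : 0 < N^-1 < 1 by rewrite invr_gt0 Np invf_lt1.
have th0 : 0 < th by rewrite /th; lra.
have th1 : th < 1 by rewrite /th; lra.
pose eta := (N - 1) / 2.
have eta0 : 0 < eta by rewrite /eta; lra.
have thN : th * N - 1 = eta by rewrite /th /eta; field; rewrite gt_eqF.
pose beta := Num.sqrt (dotv t t + (c * th) ^+ 2).
have bb0 : 0 <= dotv t t + (c * th) ^+ 2 by rewrite addr_ge0 ?dotv_ge0 ?sqr_ge0.
have beta1 : beta < 1.
  rewrite -[ltRHS]sqrtr1 ltr_sqrt// -ct addrC ltrD2r exprMn gtr_pMr ?exprn_gt0//.
  by rewrite expr_lt1// ltW.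
pose z0 := y0 *m e^T + rho *: t.
(* The first bound keeps the points [x s] in the inner ball; the second costs at most half of the
   gain [rho c eta] in the height bound [h3]. *)
pose D := Num.min (rho * (1 - beta)) (rho * c ^+ 2 * eta / 2).
have D0 : 0 < D.
  by rewrite lt_min !mulr_gt0 ?subr_gt0 ?exprn_gt0 ?divr_gt0// invr_gt0.
have pos z : enorm (z - z0) <= D -> 0 < fibdiff Q e v u eps z.
  rewrite le_min => /andP[zD1 zD2].
  (* The component [rho c v] of the contact vector is replaced by one of length [rho c th] along
     [v + s u], and the last term shifts the point to the fiber over [z]. *)
  pose x (s : R) := y0 + (rho *: (t *m e) + (rho * c * th / N) *: (v + s *: u) + (z - z0) *m e).
  have xF s : s ^+ 2 = eps ^+ 2 -> fib Q e z (x s).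
    move=> sE; split.
      apply: Qb; apply: (le_trans (ler_enormD _ _)).
      have -> : enorm ((z - z0) *m e) = enorm (z - z0).
        by rewrite /enorm dotv_mulmx -mulmxA ee mulmx1.
      have -> : enorm (rho *: (t *m e) + (rho * c * th / N) *: (v + s *: u)) = rho * beta.
        apply/eqP; rewrite -(@eqrXn2 _ 2) ?enorm_ge0//; last first.
          by rewrite mulr_ge0 ?sqrtr_ge0// ltW.
        rewrite enorm_sq exprMn sqr_sqrtr//; apply/eqP.
        have TT : dotv (t *m e) (t *m e) = dotv t t by rewrite dotv_mulmx -mulmxA ee mulmx1.
        have Tv := dte v t ve; have Tu := dte u t ue.
        move: (t *m e) TT Tv Tu => T TT Tv Tu.
        rewrite !dotvDl !dotvDr !dotvZl !dotvZr !dotvDl !dotvDr !dotvZl !dotvZr.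
        rewrite duu dvv duv [dotv v u]dotvC duv [dotv v T]dotvC [dotv u T]dotvC Tv Tu TT.
        have -> : (c * th) ^+ 2 = (c * th / N) ^+ 2 * (1 + s ^+ 2).
          by rewrite sE -NN; field; rewrite gt_eqF.
        ring.
      by move: zD1; lra.
    rewrite !mulmxDl -!scalemxAl -!mulmxA ee !mulmx1 mulmxDl -scalemxAl ue ve.
    by rewrite scaler0 addr0 scaler0 addr0 /z0 addrA addrC subrK.
  have xd s : s ^+ 2 = eps ^+ 2 -> dotv (x s) (v + s *: u) =
      dotv y0 (v + s *: u) + rho * c * th * N.
    move=> sE.
    have we : (v + s *: u) *m e^T = 0 by rewrite mulmxDl -scalemxAl ue ve scaler0 addr0.
    rewrite !dotvDl !dotvZl !(dte (v + s *: u))// mulr0 add0r addr0; congr (_ + _).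
    rewrite !dotvDl !dotvDr !dotvZl !dotvZr duu dvv duv [dotv v u]dotvC duv.
    have -> : 1 + s * 0 + (s * 0 + s * (s * 1)) = N ^+ 2 by rewrite NN -sE; ring.
    by field; rewrite gt_eqF.
  have cF := compact_fib (e := e) (z := z) cQ.
  have Fx := xF eps erefl; have F0 : fib Q e z !=set0 by exists (x eps).
  have Fx' : fib Q e z (x (- eps)) by apply: xF; rewrite sqrrN.
  have zi : z \in img Q e by apply/mem_set; exists (x eps); [case: Fx|case: Fx => _ ->].
  rewrite /fibdiff /fibwidth zi /width.
  have h1 := supp_ge (v + eps *: u) cF Fx; rewrite xd// in h1.
  have h2 := supp_ge (v - eps *: u) cF Fx'; rewrite -scaleNr xd ?sqrrN// in h2.
  have h3 : supp (fib Q e z) v <= dotv y0 v + rho * c + rho * c * eta / 2.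
    have [y [Qy yz] ->] := supp_att v cF F0.
    have := Qh _ Qy; rewrite nuE !dotvDr !dotvZr [dotv y (_ *m _)]dotvC [dotv y0 (_ *m _)]dotvC.
    rewrite !dotv_mulmx yz => h.
    have cs := cauchy_schwarz t (z0 - z).
    have t1 : enorm t <= 1.
      by rewrite -[leRHS]sqrtr1 ler_sqrt// -ct lerDr sqr_ge0.
    have h4 : enorm t * enorm (z0 - z) <= 1 * (rho * c ^+ 2 * eta / 2).
      rewrite ler_pM ?enorm_ge0//; by rewrite -enormN opprB.
    move: cs; rewrite dotvBr /z0 dotvDr dotvZr => cs.
    have h5 : c * dotv y v <= c * (dotv y0 v + rho * c + rho * c * eta / 2).
      have ctr : rho * c ^+ 2 + rho * dotv t t = rho by rewrite -mulrDr ct mulr1.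
      lra.
    by rewrite ler_pM2l in h5.
  have h6 := @supp_mid R n (fib Q e z) (- v) (- (eps *: u)) cF F0.
  rewrite !opprD !opprK in h6 *.
  have h7 : rho * c * th * N = rho * c * eta + rho * c by rewrite -thN; ring.
  rewrite dotvDr in h1; rewrite dotvDr scaleNr dotvNr in h2.
  have h8 : 0 < rho * c * eta by rewrite mulr_gt0// mulr_gt0.
  rewrite h7 in h1 h2.
  move: h1 h2 h3 h6 h8; rewrite ?dotvDr ?dotvNr; lra.
have mf := measurable_fibdiff e cQ vQ v u eps.
have : (\int[mu q]_z `|(fibdiff Q e v u eps z)%:E| = 0)%E.
  rewrite -[RHS]int0; apply: eq_integral => z _; rewrite gee0_abs// lee_fin.
  exact: fibdiff_ge0.
move=> /(ae_eq_integral_abs (mu q) measurableT mf) ae0.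
have [z zB zE] := ae_ex_in ae0 (measurable_eball_at z0 D) (mu_eball_gt0 z0 D0).
by have := pos z zB; rewrite -lte_fin (zE I) ltxx.
Qed.

(** * Finiteness of the set of regular normals *)

Section Normals.
Variables (k l q n : nat) (p : 'I_k -> 'rV[R]_n) (Q : set 'rV[R]_n).
Hypotheses (cP : compact (hull p)) (vP : convex_set (hull p)).
Hypotheses (cQ : compact Q) (vQ : convex_set Q).
Hypotheses (PQ : proj_eq q.+1 l.+1 (hull p) Q) (nE : n = (q + (2 + l))%N).

Section Subspace.
Variables (e1 : 'M[R]_(q, n)) (G : 'M[R]_(2 + l, n)).
Hypothesis (fr : frame e1 G).
Let pi := G^T *m G.

(** Otherwise [generic_reduced_cost] makes a second difference of [P] vanish; by the rotation
    identity that of [Q] vanishes too, against [fibdiff_regular]. *)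
Lemma no_generic_rotation (u' v' : 'rV[R]_(2 + l)) nu c : regular_normal Q nu ->
  u' *m u'^T = 1%:M -> v' *m v'^T = 1%:M -> u' *m v'^T = 0 ->
  nu *m G^T = c *: v' -> 0 < c ->
  exists2 J, dir_space p pi J (v' *m G) & ~ dir_space p pi J (u' *m G).
Proof.
move=> rnu uu vv uv nuG c0; apply: contrapT => nJ.
have C J : dir_space p pi J (v' *m G) -> dir_space p pi J (u' *m G).
  by move=> h; apply: contrapT => nh; apply: nJ; exists J.
have vu : v' *m u'^T = 0 by apply: (can_inj trmxK); rewrite trmx_mul trmxK uv trmx0.
have T1 : col_mx u' v' *m (col_mx u' v')^T = 1%:M :> 'M[R]_(1 + 1).
  by rewrite tr_col_mx mul_col_row uu vv uv vu -scalar_mx_block.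
have [e2' fr2] := @ex_frame R (1 + 1) l (2 + l) (col_mx u' v') erefl T1.
have full := @frame_full R (1 + 1) l (2 + l) _ _ erefl fr2.
rewrite tr_col_mx mul_row_col in full.
case: fr => e11 GG e1G; have [_ _ Ge1] := frameC fr.
case: fr2 => _ e22 T2e; rewrite mul_col_mx in T2e.
have ue : u' *m e2'^T = 0.
  by have := congr1 usubmx T2e; rewrite col_mxKu linear0.
have ve : v' *m e2'^T = 0.
  by have := congr1 dsubmx T2e; rewrite col_mxKd linear0.
set u := u' *m G in C; set v := v' *m G in C; pose e2 := e2' *m G.
have GT r s (x : 'M[R]_(r, 2 + l)) (y : 'M[R]_(s, 2 + l)) : (x *m G) *m (y *m G)^T = x *m y^T.
  by rewrite trmx_mul mulmxA -[x *m G *m G^T]mulmxA GG mulmx1.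
have piE : pi = u^T *m u + v^T *m v + e2^T *m e2.
  rewrite /pi -[X in X *m G]mulmx1 -full !mulmxDr !mulmxDl.
  by rewrite /u /v /e2 !trmx_mul !mulmxA.
have Gz r (x : 'M[R]_(r, 2 + l)) : (x *m G) *m e1^T = 0 by rewrite -mulmxA Ge1 mulmx0.
have zG r (x : 'M[R]_(r, 2 + l)) : e1 *m (x *m G)^T = 0.
  by rewrite trmx_mul mulmxA e1G mul0mx.
have fr' : frame (col_mx u e1) (col_mx v e2).
  apply/frame_colP; split; split => //; rewrite ?GT ?Gz ?zG//.
have uu2 : u *m u^T = 1%:M by rewrite GT.
have vv2 : v *m v^T = 1%:M by rewrite GT.
have uv2 : u *m v^T = 0 by rewrite GT.
have ue2 : u *m e2^T = 0 by rewrite GT.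
have ve2 : v *m e2^T = 0 by rewrite GT.
have ee2 : e2 *m e2^T = 1%:M by rewrite GT.
have [eps eps0 re] := generic_reduced_cost piE uu2 uv2 ue2 ve2 ee2 C.
have i0 := integral_fibdiff_hull cP eps0 re.
have nu2 : nu = c *: v + (nu *m e1^T) *m e1.
  by rewrite -[LHS](frame_decomp nu nE fr) nuG addrC /v scalemxAl.
apply: (fibdiff_regular cQ vQ uu2 vv2 uv2 (Gz _ _) (Gz _ _) e11 nu2 c0 eps0 rnu).
rewrite -[RHS]i0 !integral_fibdiff//; congr EFin.
have r1 := rotated_img eps cP vP cQ vQ PQ fr'.
have r2 := rotated_img (- eps) cP vP cQ vQ PQ fr'.
have r3 := rotated_img 0 cP vP cQ vQ PQ fr'.
rewrite !scaleNr opprK in r2; rewrite !scale0r addr0 subr0 in r3.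
by rewrite r1 r2 r3; ring.
Qed.

(** If the projections were not parallel, the part of that of [nu'] orthogonal to that of [nu] would
    be a rotation direction lying in every direction space that contains the projection of [nu],
    which [no_generic_rotation] forbids. *)
Lemma regular_proj_parallel nu nu' : regular_normal Q nu -> regular_normal Q nu' ->
  nu *m G^T != 0 -> 
  (forall J, dir_space p pi J (nu *m pi) -> dir_space p pi J (nu' *m pi)) ->
  exists a, nu' *m G^T = a *: (nu *m G^T).
Proof.
move=> r1 r2 y0 C.
set y := nu *m G^T in y0 *; set y' := nu' *m G^T.
have [ni vv] := unit_normalize y0.
set v' := _ *: y in vv.
have yv : y = enorm y *: v'.
  by rewrite /v' scalerA mulfV ?scale1r// gt_eqF// -invr_gt0.
pose a := dotv y' v'; pose u0 := y' - a *: v'.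
have [u00|u0n] := eqVneq u0 0.
  exists (a * (enorm y)^-1); rewrite -scalerA -/v'.
  by apply/eqP; rewrite -subr_eq0 -/u0 u00.
have [nu0 uu] := unit_normalize u0n.
have uv0 : u0 *m v'^T = 0.
  rewrite mulmxBl -scalemxAl vv mul_trmx_dotv -/a.
  by rewrite scalemx1 subrr.
have uvs : ((enorm u0)^-1 *: u0) *m v'^T = 0 by rewrite -scalemxAl uv0 scaler0.
have py : 0 < enorm y by rewrite -invr_gt0.
have [J Jv Ju] := no_generic_rotation r1 uu vv uvs yv py.
exfalso; apply: Ju.
have Jn : dir_space p pi J (nu' *m pi).
  apply: C; have := dir_spaceD (enorm y) 0 Jv Jv.
  by rewrite scale0r addr0 scalemxAl -yv /y /pi -mulmxA.
have := dir_spaceD (enorm u0)^-1 (- ((enorm u0)^-1 * a)) Jn Jv.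
rewrite (_ : _ + _ = (enorm u0)^-1 *: u0 *m G)//.
rewrite /pi mulmxA -/y' -[RHS]scalemxAl /u0 mulmxBl -[(a *: v') *m G]scalemxAl.
by rewrite scaleNr -[X in _ - X]scalerA -scalerBr.
Qed.

End Subspace.

(** A row space of the right dimension containing two coordinate axes: the projection of a vector
    onto it still shows its coordinates [i] and [b]. *)
Lemma ex_coord_frame (i b : 'I_n) : exists (e1 : 'M[R]_(q, n)) (G : 'M[R]_(2 + l, n)),
  [/\ frame e1 G, (delta_mx 0 i : 'rV[R]_n) = delta_mx 0 i *m G^T *m G &
    (delta_mx 0 b : 'rV[R]_n) = delta_mx 0 b *m G^T *m G].
Proof.
have main (i' b' : 'I_n) : i' != b' -> exists (e1 : 'M[R]_(q, n)) (G : 'M[R]_(2 + l, n)),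
  [/\ frame e1 G, (delta_mx 0 i' : 'rV[R]_n) = delta_mx 0 i' *m G^T *m G &
    (delta_mx 0 b' : 'rV[R]_n) = delta_mx 0 b' *m G^T *m G].
  move=> ib.
  have dd (x y : 'I_n) : (delta_mx 0 x : 'rV[R]_n) *m (delta_mx 0 y)^T = (x == y)%:R%:M.
    rewrite trmx_delta mul_delta_mx_cond; apply/matrixP => s t; rewrite !ord1 !mxE eqxx.
    by case: eqVneq => _; rewrite !mxE ?eqxx// ?mul0rn.
  pose di : 'rV[R]_n := delta_mx 0 i'; pose db : 'rV[R]_n := delta_mx 0 b'.
  have T1 : col_mx di db *m (col_mx di db)^T = 1%:M :> 'M[R]_(1 + 1).
    rewrite tr_col_mx mul_col_row !dd !eqxx (negbTE ib) eq_sym (negbTE ib).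
    by rewrite (scalar_mx_block 1 1) raddf0.
  have nE2 : n = ((1 + 1) + (l + q))%N by rewrite nE; lia.
  have [C fr] := ex_frame nE2 T1.
  rewrite -[C]vsubmxK in fr.
  have [[ii bb ib0] [C11 C22 C12] [iC1 iC2 bC1 bC2]] := (frame_colP _ _ _ _).1 fr.
  set C1 := usubmx C in C11 C12 iC1 bC1; set C2 := dsubmx C in C22 C12 iC2 bC2.
  have z0 r s (M : 'M[R]_(r, n)) (N : 'M[R]_(s, n)) : M *m N^T = 0 -> N *m M^T = 0.
    by move=> h; apply: (can_inj trmxK); rewrite trmx_mul trmxK h trmx0.
  pose G : 'M[R]_(2 + l, n) := col_mx (col_mx di db) C1.
  have GG : G *m G^T = 1%:M.
    rewrite /G tr_col_mx mul_col_row T1 C11.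
    have -> : col_mx di db *m C1^T = 0 by rewrite mul_col_mx iC1 bC1 col_mx0.
    have -> : C1 *m (col_mx di db)^T = 0.
      by apply: z0; rewrite mul_col_mx iC1 bC1 col_mx0.
    by rewrite -scalar_mx_block.
  have fx (x : 'rV[R]_n) (y : 'rV[R]_(2 + l)) : x = y *m G -> x = x *m G^T *m G.
    by move=> ->; rewrite -[_ *m G *m G^T]mulmxA GG mulmx1.
  exists C2, G; split.
  - split; [exact: C22|exact: GG|].
    apply: (z0 _ _ G C2); rewrite /G (@mul_col_mx _ (1 + 1) l) C12.
    by rewrite mul_col_mx iC2 bC2 !col_mx0.
  - apply: (fx _ (row_mx (row_mx 1%:M 0) 0)).
    by rewrite /G (@mul_row_col _ 1 (1 + 1) l) mul0mx addr0 mul_row_col mul0mx addr0 mul1mx.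
  - apply: (fx _ (row_mx (row_mx (0 : 'M[R]_1) (1%:M : 'M[R]_1)) 0)).
    by rewrite /G (@mul_row_col _ 1 (1 + 1) l) mul0mx addr0 mul_row_col mul0mx add0r mul1mx.
have [ib|] := eqVneq i b; last exact: main.
have [c ic] : exists c : 'I_n, i != c.
  have n0 : (0 < n)%N by rewrite nE addnCA.
  have n1 : (1 < n)%N by rewrite nE addnCA.
  have [i0|] := eqVneq i (Ordinal n0); last by exists (Ordinal n0).
  by exists (Ordinal n1); rewrite i0.
by have [e1 [G [fr Gi _]]] := main _ _ ic; exists e1, G; split => //; rewrite -ib.
Qed.

(** For every pair of axes [tau] records which direction spaces contain the projection, and for
    every axis the sign of the coordinate. The former makes all 2 by 2 minors of [nu] and [nu']
    vanish; the signs and the unit length then give equality. *)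
Lemma finitely_many_regular_normals : exists (T : finType) (tau : 'rV[R]_n -> T),
  forall nu nu', regular_normal Q nu -> regular_normal Q nu' -> tau nu = tau nu' -> nu = nu'.
Proof.
have [e1 e1P] := choice (fun a : 'I_n * 'I_n => ex_coord_frame a.1 a.2).
have [G GP] := choice e1P.
pose tau (nu : 'rV[R]_n) : {ffun 'I_n * 'I_n -> bool * {set {set 'I_k}}} * {ffun 'I_n -> bool * bool} :=
  ([ffun a => (nu *m (G a)^T == 0,
     finset (fun J => `[< dir_space p ((G a)^T *m G a) J (nu *m ((G a)^T *m G a)) >]))],
   [ffun i => (0 < nu 0 i, nu 0 i < 0)]).
exists _, tau => nu nu' r1 r2 [/ffunP h1 /ffunP h2].
have cE (x : 'rV[R]_n) i : dotv x (delta_mx 0 i) = x 0 i.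
  rewrite dotvE (bigD1 i)//= mxE !eqxx mulr1 big1 ?addr0// => j ji.
  by rewrite mxE (negbTE ji) andbF mulr0.
have par i b : nu 0 i * nu' 0 b = nu 0 b * nu' 0 i.
  have [fr Gi Gb] := GP (i, b); rewrite /= in Gi Gb.
  have := h1 (i, b); rewrite !ffunE => -[z1 z2].
  have co (x : 'rV[R]_n) s : (delta_mx 0 s : 'rV[R]_n) = delta_mx 0 s *m (G (i, b))^T *m G (i, b) ->
      x 0 s = dotv (x *m (G (i, b))^T) (delta_mx 0 s *m (G (i, b))^T).
    by move=> sE; rewrite -cE {1}sE dotv_mulmx_tr.
  rewrite !(co _ i Gi) !(co _ b Gb).
  have [y0|yn] := eqVneq (nu *m (G (i, b))^T) 0.
    by rewrite y0 !dotv0l !mul0r.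
  have hJ J : dir_space p ((G (i, b))^T *m G (i, b)) J (nu *m ((G (i, b))^T *m G (i, b))) ->
      dir_space p ((G (i, b))^T *m G (i, b)) J (nu' *m ((G (i, b))^T *m G (i, b))).
    have := congr1 (fun S : {set {set 'I_k}} => J \in S) z2; rewrite !inE => h.
    by move=> hA; apply/asboolP; rewrite -h; exact/asboolP.
  have [a ->] := regular_proj_parallel fr r1 r2 yn hJ.
  by rewrite !dotvZl; ring.
have [nn1 _] := r1; have [nn1' _] := r2.
have [i nui] : exists i, nu 0 i != 0.
  apply: contrapT => h; move: nn1; rewrite (_ : nu = 0) ?dotv0l.
    by move/eqP; rewrite eq_sym oner_eq0.
  apply/rowP => i; rewrite mxE; apply/eqP; apply: contrapT => /negP ?.
  by apply: h; exists i.
pose a := nu' 0 i / nu 0 i.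
have nuE : nu' = a *: nu.
  apply/rowP => b; rewrite mxE /a; have := par i b => h.
  by rewrite mulrAC [nu' 0 i * _]mulrC -h mulrAC mulfV ?mul1r.
have a0 : 0 < a.
  have := h2 i; rewrite !ffunE => -[p1 p2].
  rewrite /a; move: nui; rewrite neq_lt => /orP[ng|ps].
    by rewrite -mulrNN -invrN divr_gt0// oppr_gt0 -?p2.
  by rewrite divr_gt0 -?p1.
have : a ^+ 2 = 1 by move: nn1'; rewrite nuE dotvZl dotvZr nn1 mulr1.
move/eqP; rewrite -[1](expr1n _ 2) eqrXn2 ?(ltW a0)// => /eqP a1.
by rewrite nuE a1 scale1r.
Qed.

End Normals.
End Regular.

(** * Intersections of half-spaces *)

Section Halfspaces.
Variable R : realType.

Lemma separation n (K : set 'rV[R]_n) y : compact K -> convex_set K -> K !=set0 ->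
  ~ K y -> exists2 nu : 'rV[R]_n, dotv nu nu = 1 & supp K nu < dotv y nu.
Proof.
move=> cK vK K0 nKy.
have cf : continuous (fun x : 'rV[R]_n => - enorm (y - x)).
  have c1 : continuous (fun x : 'rV[R]_n => enorm (y - x)).
    by apply: cont_enorm; apply: cont_sub; [exact: cst_continuous|exact: cont_id].
  move=> x; exact: (@cvgN R R^o _ (nbhs x) (nbhs_filter x) _ _ (c1 x)).
have [x Kx xm] := compact_argmax cK K0 cf.
have fx : face K (y - x) x.
  by apply: nearest_face => // z Kz; rewrite -lerN2; exact: xm.
have w0 : y - x != 0.
  by rewrite subr_eq0; apply: contra_notN nKy => /eqP ->.
have [i0 nn] := unit_normalize w0.
exists ((enorm (y - x))^-1 *: (y - x)); first exact: dotv1_mx.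
have fx' : face K ((enorm (y - x))^-1 *: (y - x)) x by rewrite faceZ.
rewrite (suppE fx') -subr_gt0 -dotvBl dotvZr.
by rewrite mulr_gt0// dotv_gt0.
Qed.

(** The normal comes from the largest ball in [Q] around a point [t1 y] just inside the boundary. If
    its hyperplane did not separate [y], the radius would be at least [(1 - t1) r], too large so
    close to the boundary. *)
Lemma regular_separation n (Q : set 'rV[R]_n) (r : R) y : compact Q -> convex_set Q ->
  0 < r -> (forall b, enorm b <= r -> Q b) -> ~ Q y ->
  exists2 nu, regular_normal Q nu & supp Q nu < dotv y nu.
Proof.
move=> cQ vQ r0 Qb nQy.
have Q0 : Q 0 by apply: Qb; rewrite enorm0 ltW.
have Qn : Q !=set0 by exists 0.
have [ts [ts0 ts1 Qts tsm]] : exists t : R, [/\ 0 <= t, t <= 1, Q (t *: y) &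
    forall t', 0 <= t' -> t' <= 1 -> Q (t' *: y) -> t' <= t].
  pose S := [set s : 'rV[R]_1 | (0 <= s 0 0 /\ s 0 0 <= 1) /\ Q (s 0 0 *: y)].
  have cc : continuous (fun s : 'rV[R]_1 => s 0 0) by apply: cont_coord; exact: cont_id.
  have cS : compact S.
    apply: (closed_bounded_compact (@compact_box R 1 1)).
      apply: closedI.
        by apply: closedI; apply: closed_leR => //; exact: cst_continuous.
      apply: closed_preim (closed_cpt cQ).
      by apply: cont_scale => //; exact: cst_continuous.
    by move=> s [[s0 s1] _] i; rewrite ord1 ger0_norm.
  have S0 : S !=set0.
    by exists 0; rewrite /S /= mxE scale0r ler01 lexx.
  have [s [[s0 s1] Qs] sm] := compact_argmax cS S0 cc.
  exists (s 0 0); split => // t' t0 t1 Qt.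
  by have := sm (\row_(_ < 1) t'); rewrite mxE; apply; rewrite /S /= mxE.
have tsn1 : ts < 1.
  rewrite lt_neqAle ts1 andbT; apply: contra_notN nQy => /eqP t1.
  by move: Qts; rewrite t1 scale1r.
have rsupp nu : dotv nu nu = 1 -> r <= supp Q nu.
  move=> n1; have : Q (r *: nu).
    by apply: Qb; rewrite enormZ /enorm n1 sqrtr1 mulr1 gtr0_norm.
  by move=> /(supp_ge nu cQ); rewrite dotvZl n1 mulr1.
pose M := 2 * (enorm y + 1).
have M0 : 0 < M by rewrite mulr_gt0// ltr_wpDl ?enorm_ge0.
(* Respectively: [ts + ka] stays within [0, 1], where [ts] is maximal; [1 - ka] stays nonnegative;
   and the radius [rho] falls below [(1 - t1) r]. *)
pose ka := Num.min (Num.min (1 - ts) (2^-1)) ((1 - ts) * r / M).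
have tp : 0 < 1 - ts by rewrite subr_gt0.
have ka0 : 0 < ka by rewrite !lt_min tp invr_gt0 ltr0n divr_gt0// mulr_gt0.
have [k1 [k2 k3]] : ka <= 1 - ts /\ (ka <= 2^-1 /\ ka <= (1 - ts) * r / M).
  by rewrite !ge_min !lexx ?orbT.
clearbody ka.
pose t1 := (1 - ka) * ts.
have t1ts : t1 <= ts by rewrite ler_piMl// gerBl ltW.
have t10 : 0 <= t1 by rewrite mulr_ge0//; lra.
pose S := [set nu : 'rV[R]_n | dotv nu nu = 1].
have cd : continuous (fun nu : 'rV[R]_n => dotv nu nu).
  by apply: cont_dotv; exact: cont_id.
have cS : compact S.
  apply: (closed_bounded_compact (@compact_eball R n 1)); last first.
    by move=> nu n1; rewrite /= /enorm n1 sqrtr1.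
  apply: (@closed_preim _ _ (fun nu : 'rV[R]_n => dotv nu nu) [set (1 : R)]); first exact: cd.
  exact: (accessible_closed_set1 (hausdorff_accessible (@norm_hausdorff R R^o))).
have cg : continuous (fun nu : 'rV[R]_n => dotv (t1 *: y) nu - supp Q nu).
  have c1 : continuous (fun nu : 'rV[R]_n => dotv (t1 *: y) nu).
    by apply: cont_dotv; [exact: cst_continuous|exact: cont_id].
  move=> nu; exact: (@cvgB R R^o _ (nbhs nu) (nbhs_filter nu) (fun nu : 'rV[R]_n => dotv (t1 *: y) nu)
      (supp Q) _ _ (c1 nu) (continuous_supp cQ Qn (x := nu))).
have nQt : ~ Q ((ts + ka) *: y).
  by move=> /tsm; lra.
have [nu1 nn1 sep1] := separation cQ vQ Qn nQt.
have [nu0 nn0 nm] := compact_argmax cS (ex_intro _ _ nn1) cg.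
(* The least distance from [t1 y] to a supporting hyperplane, that is, the radius of the largest
   ball around it. *)
pose rho := supp Q nu0 - dotv (t1 *: y) nu0.
have rho_min nu : dotv nu nu = 1 -> rho <= supp Q nu - dotv (t1 *: y) nu.
  by move=> n1; have := nm nu n1; rewrite /rho => h; rewrite -lerN2 !opprB.
have rho0 : 0 < rho.
  rewrite /rho /t1 -scalerA dotvZl.
  have h1 := supp_ge nu0 cQ Qts; have h2 := rsupp nu0 nn0.
  have h3 : 0 < ka * supp Q nu0 by rewrite mulr_gt0// (lt_le_trans r0).
  have k10 : 0 <= 1 - ka by lra.
  have h4 : (1 - ka) * dotv (ts *: y) nu0 <= (1 - ka) * supp Q nu0 by rewrite ler_wpM2l.
  lra.
have rhor : rho < (1 - t1) * r.
  have h1 := rho_min nu1 nn1; rewrite dotvZl in h1; rewrite dotvZl in sep1.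
  have h2 : dotv y nu1 <= enorm y.
    by apply: (le_trans (cauchy_schwarz _ _)); rewrite [enorm nu1]/enorm nn1 sqrtr1 mulr1.
  have h3 : (ts + ka - t1) * dotv y nu1 <= (ts + ka - t1) * enorm y.
    by rewrite ler_wpM2l//; lra.
  have h4 : (ts + ka - t1) * enorm y <= (2 * ka) * enorm y.
    rewrite ler_wpM2r ?enorm_ge0// /t1; have : ka * ts <= ka * 1 by rewrite ler_pM2l.
    lra.
  have h5 : ka * M <= (1 - ts) * r by rewrite -ler_pdivlMr.
  have h6 : (1 - ts) * r <= (1 - t1) * r by rewrite ler_pM2r// lerD2l lerN2.
  move: h5; rewrite /M; lra.
have reg : regular_normal Q nu0.
  split => //; exists (t1 *: y), rho; split => //.
    move=> b bz; apply: contrapT => nQ.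
    have [nu n1 sp] := separation cQ vQ Qn nQ.
    have := rho_min nu n1; move: sp; rewrite dotvDl.
    have : dotv b nu <= rho.
      apply: (le_trans (cauchy_schwarz _ _)).
      by rewrite [enorm nu]/enorm n1 sqrtr1 mulr1.
    lra.
  move=> x Qx; apply: (le_trans (supp_ge nu0 cQ Qx)); rewrite /rho; lra.
exists nu0 => //; rewrite ltNge; apply/negP => h.
have h1 : t1 * dotv y nu0 <= t1 * supp Q nu0 by rewrite ler_wpM2l.
have h2 := rsupp nu0 nn0.
have h3 : (1 - t1) * r <= (1 - t1) * supp Q nu0.
  by rewrite ler_wpM2l// subr_ge0 (le_trans t1ts).
move: rhor; rewrite /rho dotvZl; lra.
Qed.

(** * Bounded intersections of finitely many half-spaces are polytopes *)

Section HRepresentation.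
Variables (n : nat) (F : finType) (a : F -> 'rV[R]_n) (b : F -> R).
Let Q := [set x | forall f, dotv x (a f) <= b f].
Hypotheses (cQ : compact Q) (Q0 : Q !=set0).

Let act x : {set F} := finset (fun f => dotv x (a f) == b f).

Let vQ : convex_set Q.
Proof.
move=> x y t Qx Qy /andP[t0 t1] f; rewrite dotvDl !dotvZl.
have h1 : t * dotv x (a f) <= t * b f by rewrite ler_wpM2l.
have h2 : (1 - t) * dotv y (a f) <= (1 - t) * b f by rewrite ler_wpM2l// subr_ge0.
lra.
Qed.

(** Moving along a direction tangent to the active constraints must meet a new constraint, because
    [Q] is bounded; the first one met is chosen by [fin_argmin]. *)
Let ray x d : Q x -> d != 0 -> (forall f, f \in act x -> dotv d (a f) = 0) ->
  exists2 t : R, 0 < t & Q (x + t *: d) /\ act x \proper act (x + t *: d).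
Proof.
move=> Qx d0 da.
have [f0 df0] : exists f, 0 < dotv d (a f).
  apply: contrapT => h; have [B B0 QB] := compact_enorm_le cQ.
  have le0 f : dotv d (a f) <= 0 by rewrite leNgt; apply/negP => ?; apply: h; exists f.
  have e0 : 0 < enorm d by rewrite enorm_gt0.
  pose t := (B + enorm x + 1) / enorm d.
  have t0 : 0 <= t by rewrite divr_ge0 ?addr_ge0 ?enorm_ge0// ltW.
  have : Q (x + t *: d).
    move=> f; rewrite dotvDl dotvZl; have := Qx f => h1.
    have : t * dotv d (a f) <= 0 by rewrite mulr_ge0_le0.
    lra.
  move=> /QB; apply/negP; rewrite -ltNge.
  have h1 := ler_enormD (x + t *: d) (- x).
  rewrite enormN [x + _]addrC addrK enormZ (ger0_norm t0) /t mulfVK ?gt_eqF// in h1.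
  by rewrite [t *: d + x]addrC in h1; move: h1; rewrite /t; lra.
have [f1 df1 f1m] := fin_argmin (A := fun f => 0 < dotv d (a f))
  (fun f => (b f - dotv x (a f)) / dotv d (a f)) df0.
pose t := (b f1 - dotv x (a f1)) / dotv d (a f1).
have f1n : f1 \notin act x.
  by apply/negP => /da h; move: df1; rewrite h ltxx.
have t0 : 0 < t.
  rewrite divr_gt0// subr_gt0 lt_neqAle Qx andbT.
  by move: f1n; rewrite inE.
exists t => //; split.
  move=> f; rewrite dotvDl dotvZl.
  have [df|df] := ltP 0 (dotv d (a f)).
    by have := f1m f df; rewrite -/t ler_pdivlMr//; lra.
  have h1 := Qx f; have : t * dotv d (a f) <= 0 by rewrite mulr_ge0_le0// ltW.
  lra.
apply/properP; split.
  apply/fintype.subsetP => f fx; move: (fx); rewrite !inE dotvDl dotvZl da// mulr0 addr0//.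
exists f1 => //; rewrite inE dotvDl dotvZl /t mulfVK; last by rewrite gt_eqF.
by rewrite addrC subrK.
Qed.

Let vertex x := Q x /\ forall d, (forall f, f \in act x -> dotv d (a f) = 0) -> d = 0.

Let vertex_inj x y : vertex x -> vertex y -> act x = act y -> x = y.
Proof.
move=> [Qx vx] [Qy vy] E; apply/eqP; rewrite -subr_eq0; apply/eqP; apply: vx => f fx.
have fy : f \in act y by rewrite -E.
move: fx fy; rewrite !inE dotvBl => /eqP -> /eqP ->; exact: subrr.
Qed.

(** A point that is no vertex lies between two points with more active constraints, so induction on
    the number of inactive ones ends at vertices. A vertex is determined by its active set, so these
    are finitely many. *)
Lemma polytope_halfspaces : polytope Q.
Proof.
have [q0 Qq0] := Q0.
(* Active sets of no vertex get the default [q0], a point of [Q], which leaves the hull inside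
   [Q]. *)
have ex (S : {set F}) : exists v, Q v /\ ((exists2 x, vertex x & act x = S) ->
    vertex v /\ act v = S).
  have [[x vx xS]|nx] := pselect (exists2 x, vertex x & act x = S).
    by exists x; split => //; case: vx.
  by exists q0.
have [k [p [Qp vp]]] : exists k (p : 'I_k -> 'rV[R]_n), (forall i, Q (p i)) /\
    forall x, vertex x -> exists i, x = p i.
  have [V VP] := choice ex; exists #|{set F}|, (fun i => V (enum_val i)).
  split => [i|x vx]; first by case: (VP (enum_val i)).
  exists (enum_rank (act x)); rewrite enum_rankK.
  have [_ [|vV aV]] := VP (act x); first by exists x.
  exact: vertex_inj.
exists k, p; rewrite -/(hull p).
apply/seteqP; split; last by move=> x [l [l0 [l1 ->]]]; exact: convex_sum.
have vh x : vertex x -> hull p x.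
  move=> /vp[i ->]; rewrite -comb_delta; exists (fun l => (l == i)%:R).
  by split; [move=> l; rewrite ler0n|split => //; exact: sum_delta].
suff key N x : Q x -> (#|~: act x| < N)%N -> hull p x by move=> x Qx; exact: key (ltnSn _).
elim: N x => // N IH x Qx xN.
have [|nvx] := pselect (vertex x); first exact: vh.
have [d d0 da] : exists2 d, d != 0 & forall f, f \in act x -> dotv d (a f) = 0.
  apply: contrapT => h; apply: nvx; split => // d da; apply/eqP.
  by apply: contrapT => /negP d0; apply: h; exists d.
have [t t0 [Qt pt]] := ray Qx d0 da.
have dN0 : - d != 0 by rewrite oppr_eq0.
have daN f : f \in act x -> dotv (- d) (a f) = 0 by move=> /da h; rewrite dotvNl h oppr0.
have [s s0 [Qs ps]] := ray Qx dN0 daN.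
have lt y : act x \proper act y -> (#|~: act y| < N)%N.
  move=> pxy; apply: leq_trans (_ : #|~: act x| <= N)%N; last by rewrite -ltnS.
  by have := proper_card pxy; have := cardsC (act x); have := cardsC (act y); lia.
have st : 0 < t + s by rewrite addr_gt0.
have -> : x = (s / (t + s)) *: (x + t *: d) + (1 - s / (t + s)) *: (x + s *: - d).
  by apply/rowP => i; rewrite !mxE; field; rewrite gt_eqF.
apply: convex_hull.
- by apply: IH => //; exact: lt.
- by apply: IH => //; exact: lt.
- apply/andP; split; first by apply: divr_ge0; exact: ltW.
  by rewrite ler_pdivrMr// mul1r lerDr ltW.
Qed.

End HRepresentation.
End Halfspaces.

(** * Transfer between the two bodies *)

Section Assembly.
Variable R : realType.
Local Notation mu := (mu R).

Lemma symmetric_ball n (K : set 'rV[R]_n) : convex_set K -> origin_symmetric K ->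
  K° !=set0 -> exists2 rho : R, 0 < rho & forall b, enorm b <= rho -> K b.
Proof.
move=> vK sK [x]; rewrite /interior /= => /nbhs_ballP[d /= d0 dK].
have d20 : 0 < d / 2 by rewrite divr_gt0.
exists (d / 2) => // b bd.
have near z : enorm z <= d / 2 -> K (x + z).
  move=> zd; apply: dK; apply/mx_ballP; split => // i j.
  rewrite !mxE opprD addrA subrr sub0r normrN ord1.
  apply: (le_lt_trans (le_mx_norm z j)); apply: (le_lt_trans (enorm_ge_norm z)).
  by apply: (le_lt_trans zd); lra.
have h1 := near _ bd; have h2 : K (- (x - b)).
  by apply: sK; apply: near; rewrite enormN.
have := vK _ _ 2^-1 h1 h2.
rewrite (_ : 2^-1 *: (x + b) + (1 - 2^-1) *: - (x - b) = b); first by apply; lra.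
by apply/rowP => i; rewrite !mxE; field.
Qed.

(** Every frame arises from [E = W^T W], whose row space is that of [W] and whose [perp] is that of
    [U]. *)
Lemma jprojection_proj_eq n j (P Q : set 'rV[R]_n) : (j <= n)%N ->
  compact P -> compact Q -> jprojection_body j P Q -> proj_eq (n - j) j P Q.
Proof.
move=> jn cP cQ PQ W U fr.
have nE : n = (n - j + j)%N by rewrite subnK.
have nE' : n = (j + (n - j))%N by rewrite subnKC.
have [WW UU WU] := fr.
pose E := W^T *m W.
have WE : (W == E)%MS.
  rewrite /E submxMl andbT; apply/submxP; exists W.
  by rewrite mulmxA WW mul1mx.
have UE := frame_perp nE' (frameC fr) WE.
have rE : \rank E = (n - j)%N by have /eqmxP <- := WE; exact: orthonormal_rank.
have img_proj k (X : set 'rV[R]_n) (B : 'M[R]_(k, n)) (A : 'M[R]_n) : compact X ->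
    B *m B^T = 1%:M -> (B == A)%MS -> volk B (proj X A) = mu k (img X B).
  move=> cX BB /eqmxP BA; rewrite /volk.
  rewrite (_ : mkset _ = img X B); first by rewrite volnE//; exact: measurable_img.
  have kerE (y : 'rV[R]_n) : (y *m A^T == 0) = (y *m B^T == 0).
    have /submxP[D DE] : (A <= B)%MS by rewrite BA.
    have /submxP[D' DE'] : (B <= A)%MS by rewrite BA.
    apply/eqP/eqP => h; first by rewrite DE' trmx_mul mulmxA h mul0mx.
    by rewrite DE trmx_mul mulmxA h mul0mx.
  apply/seteqP; split => z /=.
    move=> [_ [x [Xx /eqP]]]; rewrite kerE mulmxBl -mulmxA BB mulmx1 subr_eq0.
    by move=> /eqP h; exists x.
  move=> [x Xx ->]; split; first by rewrite -BA submxMl.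
  exists x; split => //; apply/eqP; rewrite kerE mulmxBl -[_ *m B *m _]mulmxA BB mulmx1.
  by rewrite subrr.
have := PQ E rE U W UU UE WW WE.
by rewrite (img_proj _ P U (perp E))// (img_proj _ Q W E).
Qed.

Lemma polytope_transfer q l n (P Q : set 'rV[R]_n) : n = (q + (2 + l))%N ->
  polytope P -> compact P -> compact Q -> convex_set Q -> origin_symmetric Q ->
  Q° !=set0 -> proj_eq q.+1 l.+1 P Q -> polytope Q.
Proof.
move=> nE [k [p PE]] cP cQ vQ sQ iQ PQ; rewrite -/(hull p) in PE; subst P.
have [r r0 Qr] := symmetric_ball vQ sQ iQ.
have [T [tau tauP]] := finitely_many_regular_normals cP (@convex_hull R k n p) cQ vQ PQ nE.
(* One half-space for each value of [tau]; values taken by no regular normal get the trivial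
   constraint [(0, 0)]. *)
have ex f : exists c : 'rV[R]_n * R, (forall x, Q x -> dotv x c.1 <= c.2) /\
    forall nu, regular_normal Q nu -> tau nu = f -> c = (nu, supp Q nu).
  have [[nu [rnu nuf]]|nx] := pselect (exists nu, regular_normal Q nu /\ tau nu = f).
    exists (nu, supp Q nu); split; first by move=> x Qx; exact: supp_ge.
    by move=> nu' rnu' f'; rewrite (tauP nu nu')// f'.
  exists (0, 0); split; first by move=> x _; rewrite dotv0r.
  by move=> nu rnu nuf; case: nx; exists nu.
have [c cP'] := choice ex.
have QE : Q = [set x | forall f, dotv x (c f).1 <= (c f).2].
  apply/seteqP; split => x; first by move=> Qx f; case: (cP' f) => + _; apply.
  move=> xc; apply: contrapT => nQx.
  have [nu rnu sep] := regular_separation cQ vQ r0 Qr nQx.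
  have := xc (tau nu); have [_ /(_ nu rnu erefl) ->] := cP' (tau nu).
  by rewrite leNgt sep.
have Q0 : Q !=set0 by exists 0; apply: Qr; rewrite enorm0 ltW.
rewrite QE in cQ Q0 *; exact: (polytope_halfspaces cQ Q0).
Qed.

Lemma has_face_parallel_eqmx n (K : set 'rV[R]_n) k (F F' : 'M[R]_n) :
  (F == F')%MS -> has_face_parallel K k F -> has_face_parallel K k F'.
Proof.
move=> /eqmxP FF [u [h1 [M [/eqmxP MF h2]]]]; exists u; split.
  by move=> x y Gx Gy; rewrite -FF; exact: h1.
by exists M; split => //; apply/eqmxP; exact: eqmx_trans FF.
Qed.

Lemma kappa_gt0 m : 0 < kappa R m.
Proof.
have mb : measurable [set u : 'rV[R]_m | enorm u <= 1].
  by apply: compact_measurable_mx; exact: compact_eball.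
rewrite /kappa volnE//.
have := @mu_eball_gt0 R m 0 1 ltr01.
rewrite (_ : mkset _ = [set u | enorm u <= 1]); last first.
  by apply/seteqP; split => u /=; rewrite subr0.
move=> h; apply: fine_gt0; rewrite h /=; apply: mu_compact; exact: compact_eball.
Qed.

(** Relates the binomial factors that [area_measure_tube] produces for the two bodies. *)
Lemma bin_mul_swap m j : (j.+1 * 'C(m + j.+1, j.+1) = m.+1 * 'C(m + j.+1, m.+1))%N.
Proof.
rewrite -!mul_bin_diag addnS /=; congr (_ * _)%N.
by rewrite -[in RHS]bin_sub ?leq_addr// addKn.
Qed.

End Assembly.

Unset Implicit Arguments.

Theorem theorem5p3 (R : realType) (n j : nat) (P Q : set 'rV[R]_n) :
  (3 <= n)%N -> (1 <= j <= n - 1)%N ->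
  convex_body P -> convex_body Q ->
  origin_symmetric P -> origin_symmetric Q ->
  (interior P) !=set0 -> (interior Q) !=set0 ->
  jprojection_body j P Q ->
  (forall E : 'M[R]_n, \rank E = (n - j)%N ->
     forall cP cQ : nat -> R,
       area_measures_at P (@sphere R n `&` subsp E) cP ->
       area_measures_at Q (@sphere R n `&` subsp (perp E)) cQ ->
       cP j = kappa R (n - j) / kappa R j * cQ (n - j)%N)
  /\
  (polytope P ->
     polytope Q /\
     forall F : 'M[R]_n, \rank F = j ->
       (has_face_parallel P j F <-> has_face_parallel Q (n - j) (perp F))).
Proof.
move=> n3 /andP[j1 jn1] [cP [vP P0]] [cQ [vQ Q0]] sP sQ iP iQ PQ.
have jn : (j < n)%N by move: n3 jn1; lia.
have {}PQ := jprojection_proj_eq (ltnW jn) cP cQ PQ.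
have : n = (n - j + j)%N by rewrite subnK// ltnW.
have : (0 < n - j)%N by rewrite subn_gt0.
(* With [n - j] a variable [m] and [n = m + j], the two bodies play symmetric roles. *)
move: (n - j)%N PQ {jn jn1} => m PQ m0 nE.
case: m m0 nE PQ => // m _ nE PQ; case: j j1 nE PQ => // j _ nE PQ.
have nE' : n = (j.+1 + m.+1)%N by rewrite addnC.
have [rP rP0 Pr] := symmetric_ball vP sP iP.
have [rQ rQ0 Qr] := symmetric_ball vQ sQ iQ.
split.
  move=> E rE aP aQ areaP areaQ.
  have [W [WW WE]] := ex_orthonormal rE.
  have [U fr] := ex_frame nE WW.
  have UE := frame_perp nE' (frameC fr) WE.
  (* The same constant [c] serves both bodies and cancels in the quotient of the two area
     formulas. *)
  have [c [aeP aeQ _ _]] := ae_const_Mset cP vP P0 sP cQ vQ Q0 sQ PQ fr.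
  have hP := area_measure_tube nE fr cP vP P0 (ltn0Sn m) WE rP0 Pr aeP areaP.
  have hQ := area_measure_tube nE' (frameC fr) cQ vQ Q0 (ltn0Sn j) UE rQ0 Qr aeQ areaQ.
  have kj := kappa_gt0 R j.+1.
  have nN : n.-1 = (m + j.+1)%N by rewrite nE.
  rewrite nN in hP hQ.
  have := congr1 (fun k : nat => k%:R : R) (bin_mul_swap m j); rewrite !natrM => sw.
  have Cj : 0 < 'C(m + j.+1, j.+1)%:R :> R by rewrite ltr0n bin_gt0 leq_addl.
  have Cm : 0 < 'C(m + j.+1, m.+1)%:R :> R by rewrite ltr0n bin_gt0 addnS ltnS leq_addr.
  have j0 : 0 < j.+1%:R :> R by [].
  have m0 : 0 < m.+1%:R :> R by [].
  apply: (mulfI (lt0r_neq0 Cj)); rewrite hP.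
  apply: (mulfI (lt0r_neq0 Cm)); apply: (mulfI (lt0r_neq0 j0)).
  have -> : j.+1%:R * ('C(m + j.+1, m.+1)%:R * ('C(m + j.+1, j.+1)%:R *
      (kappa R m.+1 / kappa R j.+1 * aQ m.+1))) =
    j.+1%:R * 'C(m + j.+1, j.+1)%:R * ('C(m + j.+1, m.+1)%:R * aQ m.+1) *
      (kappa R m.+1 / kappa R j.+1) by ring.
  by rewrite hQ sw; field; rewrite gt_eqF.
move=> pP.
have pQ : polytope Q.
  apply: (@polytope_transfer R m j n P Q) => //; first by rewrite nE; lia.
split => // F rF; split; first exact: face_transfer.
(* The converse is the same transfer with the bodies exchanged, since [Q] is now known to be a
   polytope; [UFF] identifies the double complement of [F] with [F]. *)
move=> h.
have [U [UU UF]] := ex_orthonormal rF.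
have [W /frameC fr] := ex_frame nE' UU.
have WF := frame_perp nE fr UF.
have UFF := frame_perp nE' (frameC fr) WF.
have rW : \rank (perp F) = m.+1.
  by have /eqmxP <- := WF; case: fr => WW _ _; exact: orthonormal_rank.
have := face_transfer nE' pQ cQ vQ Q0 sQ cP vP P0 sP (proj_eqC PQ) rW h.
apply: has_face_parallel_eqmx; apply/eqmxP.
by move/eqmxP: UFF => /eqmx_sym UFF; move/eqmxP: UF => UF; exact: eqmx_trans UFF UF.
Qed.
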